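(* Let $N$ be a $4$-dimensional Riemannian space form with constant sectional curvature $L_0$, $M$ a Riemann surface and $F:M\to N$ a conformal immersion satisfying $K\equiv L_0$ and $R^{\perp}\equiv 0$. Let $\lambda,\gamma,k_\pm,X_\pm,Y_\pm,\theta_-,\psi,f_+,f_-$ be the functions attached to $F$ as in the context, and put $$A:=(f_+)_v(f_-)_u+(f_-)_v(f_+)_u,\qquad A':=(f_+)_v(f_-)_u-(f_-)_v(f_+)_u .$$ Then $F$ satisfies $k_\pm\neq 0$ and $X_+^2Y_-^2-X_-^2Y_+^2\neq 0$ if and only if $\lambda$ with (i) $\lambda_{uu}+\lambda_{vv}+L_0e^{2\lambda}=0$, and $\gamma,\theta_-,\psi,f_+,f_-$ satisfy (ii) $\theta_-\neq 0$; (iii) $AA'=(f_+)_v^2(f_-)_u^2-(f_-)_v^2(f_+)_u^2\neq 0$; (iv) $$\begin{bmatrix}(f_-)_u\\ (f_-)_v\end{bmatrix}=\begin{bmatrix}\cos\psi&-\sin\psi\\ \sin\psi&\cos\psi\end{bmatrix}\begin{bmatrix}(f_+)_v\\ (f_+)_u\end{bmatrix};$$ (v) $$\begin{bmatrix}\gamma_u\\ \gamma_v\end{bmatrix}=-\begin{bmatrix}(\theta_-)_u\\ (\theta_-)_v\end{bmatrix}+\frac{\frac{\partial(f_+,\psi)}{\partial(u,v)}}{\frac{\partial(f_+,f_-)}{\partial(u,v)}}\begin{bmatrix}(f_-)_u\\ (f_-)_v\end{bmatrix}-\frac1{A'}\begin{bmatrix}2(f_+)_u(f_-)_u & A\\ A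 & 2(f_+)_v(f_-)_v\end{bmatrix}\begin{bmatrix}\lambda_u\\ \lambda_v\end{bmatrix}.$$ In addition, for functions $\lambda,\gamma,\theta_-,\psi,f_+,f_-$ satisfying (i)–(v) on a simply connected open set $O$ of the $uv$-plane, there exists a conformal immersion $F$ of $O$ into $N$ with $K\equiv L_0$, $R^{\perp}\equiv 0$ such that the second fundamental form does not satisfy the linearly dependent condition, and which is unique up to an isometry of $N$.
   Context: $E^n_k$ is $\mathbb R^n$ with the flat metric with $k$ minus signs, $E^n=E^n_0$. $N$ is taken to be $E^4$ if $L_0=0$, $\{x\in E^5:\langle x,x\rangle=1/L_0\}$ if $L_0>0$, $\{x\in E^5_1:\langle x,x\rangle=1/L_0\}$ if $L_0<0$; $h$ is its metric and $\nabla$ its Levi-Civita connection. $K$ is the curvature of the metric $g$ induced by $F$ and $R^{\perp}$ the curvature tensor of the normal connection $\nabla^{\perp}$. Everything is expressed in local isothermal coordinates $(u,v)$ compatible with the complex structure, with $g=e^{2\lambda}(du^2+dv^2)$; $T_1=dF(\partial_u)$, $T_2=dF(\partial_v)$; $N_1,N_2$ are normal vector fields with $h(N_1,N_1)=h(N_2,N_2)=e^{2\lambda}$, $h(N_1,N_2)=0$. The real functions $\alpha_k,\beta_k$ ($k=1,2,3$), $\mu_l$ ($l=1,2$) are defined by: the normal components of $\nabla_{T_1}T_1$, $\nabla_{T_1}T_2$, $\nabla_{T_2}T_2$ are $\alpha_1N_1+\beta_1N_2$, $\alpha_2N_1+\beta_2N_2$, $\alpha_3N_1+\beta_3N_2$;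 and $\nabla^{\perp}_{T_1}N_1=\lambda_uN_1+\mu_1N_2$, $\nabla^{\perp}_{T_1}N_2=-\mu_1N_1+\lambda_uN_2$, $\nabla^{\perp}_{T_2}N_1=\lambda_vN_1+\mu_2N_2$, $\nabla^{\perp}_{T_2}N_2=-\mu_2N_1+\lambda_vN_2$. Since $R^{\perp}\equiv0$, there is a function $\gamma$ with $\gamma_u=\mu_1$, $\gamma_v=\mu_2$. Put $W_\pm=\alpha_2\pm\beta_1$, $X_\pm=\alpha_2\pm\beta_3$, $Y_\pm=\beta_2\pm\alpha_1$, $Z_\pm=\beta_2\pm\alpha_3$. For $F$ with $K\equiv L_0$, $R^\perp\equiv0$ one has $W_\mp X_\pm+Y_\pm Z_\mp=0$, and it is supposed that there exist functions $k_\pm$ with $(W_-,Z_-)=k_+(-Y_+,X_+)$, $(W_+,Z_+)=k_-(-Y_-,X_-)$. The functions $f_\pm$ are functions with $X_+=\frac{(f_+)_v}{\sqrt{1+k_+^2}}$, $Y_+=\frac{(f_+)_u}{\sqrt{1+k_+^2}}$, $X_-=-\frac{(f_-)_v}{\sqrt{1+k_-^2}}$, $Y_-=\frac{(f_-)_u}{\sqrt{1+k_-^2}}$; $\theta_-$ is a function with $\tan\theta_-=k_-$; and $\psi$ is the function defined by relation (iv). The second fundamental form satisfies the linearly dependent condition if there is a function $\theta$ of $(u,v)$ with $\cos\theta(\alpha_1,\alpha_2,\alpha_3)+\sin\theta(\beta_1,\beta_2,\beta_3)=0$. $\partial(p,q)/\partial(u,v)=p_uq_v-p_vq_u$. In the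 last assertion, the immersion $F$ is the one obtained from the given functions by putting $k_-:=\tan\theta_-$, $B:=(f_+)_u(f_-)_u-(f_+)_v(f_-)_v$, $k_+:=\frac{Bk_--A}{Ak_-+B}$, $\mu_1:=\gamma_u$, $\mu_2:=\gamma_v$, and defining $X_\pm,Y_\pm,W_\pm,Z_\pm$ and from them $\alpha_k,\beta_k$ by the formulas above; uniqueness refers to the immersion with these data.
   Formalization: (i)-(v) do not imply k_+≠0 (Clifford torus), so B tan θ_-≠A is added to them in the equivalence; θ_- lies in (-π/2,π/2); ''obtained from the data'' and uniqueness assume Ak_-+B≠0, with f_+ replaced by -f_+ when Ak_-+B>0, where the formulas are inconsistent. *)

(* Defs.v *)
From mathcomp Require Import all_boot all_order all_algebra.
From mathcomp Require Import all_classical all_reals all_analysis.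
Set Implicit Arguments.
Unset Strict Implicit.
Unset Printing Implicit Defensive.
Import Order.TTheory GRing.Theory Num.Theory.
Import numFieldNormedType.Exports.
Local Open Scope classical_set_scope.
Local Open Scope ring_scope.

(* Everything takes place in a chart z = u + iv of the Riemann surface: an open
   set O of the uv-plane R * R, a point being p = (u, v).  Maps are total and
   only their restriction to O matters. *)

Definition pd (R : realType) (V : normedModType R) (i : 'I_2)
    (f : R * R -> V) (p : R * R) : V :=
  'D_(if i == 0 then (1, 0) else (0, 1)) f p.
Definition du (R : realType) (V : normedModType R) (f : R * R -> V) := pd 0 f.
Definition dv (R : realType) (V : normedModType R) (f : R * R -> V) := pd 1 f.

Fixpoint Ck (R : realType) (V : normedModType R) (k : nat)
    (O : set (R * R)) (f : R * R -> V) : Prop :=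
  (forall p, O p -> {for p, continuous f}) /\
  (if k is k'.+1 then
     [/\ forall p, O p -> derivable f p (1, 0) /\ derivable f p (0, 1),
         Ck k' O (du f) & Ck k' O (dv f)]
   else True).

Definition smooth (R : realType) (V : normedModType R) (O : set (R * R))
    (f : R * R -> V) : Prop := forall k, Ck k O f.

(* d(f, g) / d(u, v) *)
Definition jac2 (R : realType) (f g : R * R -> R) (p : R * R) : R :=
  du f p * dv g p - dv f p * du g p.

Definition simply_connected (R : realType) (O : set (R * R)) : Prop :=
  [/\ O !=set0, connected O &
      forall c : R -> R * R,
        {within `[0, 1], continuous c} ->
        (forall t, 0 <= t <= 1 -> O (c t)) -> c 0 = c 1 ->
        exists H : R * R -> R * R,
          [/\ {within `[0, 1] `*` `[0, 1], continuous H},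
              (forall s t, 0 <= s <= 1 -> 0 <= t <= 1 -> O (H (s, t))),
              (forall t, 0 <= t <= 1 -> H (0, t) = c t),
              (forall t, 0 <= t <= 1 -> H (1, t) = c 0) &
              (forall s, 0 <= s <= 1 -> H (s, 0) = c 0 /\ H (s, 1) = c 0)]].

(* The ambient flat space of the model of N: E^4 if L0 = 0, E^5 if L0 > 0,
   E^5_1 (minus sign on the last coordinate) if L0 < 0. *)
Definition adim (R : realType) (L0 : R) : nat := if L0 == 0 then 4%N else 5%N.

Definition ip (R : realType) (L0 : R) (x y : 'rV[R]_(adim L0)) : R :=
  \sum_(i < adim L0)
    (if (L0 < 0) && (i == 4%N :> nat) then -1 else 1) * x 0 i * y 0 i.

Definition in_space_form (R : realType) (L0 : R) (x : 'rV[R]_(adim L0))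
    : Prop := L0 != 0 -> ip x x = L0^-1.

(* Isometries of the models are the restrictions of the affine isometries of
   the ambient space, fixing the origin when L0 <> 0. *)
Definition is_isometry (R : realType) (L0 : R)
    (Phi : 'rV[R]_(adim L0) -> 'rV[R]_(adim L0)) : Prop :=
  exists (Q : 'M[R]_(adim L0)) (b : 'rV[R]_(adim L0)),
    [/\ forall x y, ip (x *m Q) (y *m Q) = ip x y,
        L0 != 0 -> b = 0 &
        forall x, Phi x = x *m Q + b].

(* christoffel G k i j = Gamma^k_ij *)
Definition christoffel (R : realType) (G : R * R -> 'M[R]_2) (k i j : 'I_2)
    (p : R * R) : R :=
  2^-1 * \sum_(l < 2) invmx (G p) k l *
    (pd i (fun q => G q j l) p + pd j (fun q => G q i l) p
     - pd l (fun q => G q i j) p).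

(* k-th component of R(d_u, d_v) d_v, where
   R(X, Y)Z = D_X D_Y Z - D_Y D_X Z - D_[X, Y] Z *)
Definition riemann_uvv (R : realType) (G : R * R -> 'M[R]_2) (k : 'I_2)
    (p : R * R) : R :=
  du (christoffel G k 1 1) p - dv (christoffel G k 0 1) p
  + \sum_(m < 2) (christoffel G m 1 1 p * christoffel G k 0 m p
                  - christoffel G m 0 1 p * christoffel G k 1 m p).

Definition curvature (R : realType) (G : R * R -> 'M[R]_2) (p : R * R) : R :=
  (\sum_(k < 2) riemann_uvv G k p * G p k 0) / \det (G p).

Definition induced_metric (R : realType) (L0 : R)
    (F : R * R -> 'rV[R]_(adim L0)) (p : R * R) : 'M[R]_2 :=
  \matrix_(i, j) ip (pd i F p) (pd j F p).

(* Levi-Civita connection of N along F: tangential part in N of the flat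
   derivative; F is normal to N, with <F, F> = 1 / L0, when L0 <> 0. *)
Definition nabla (R : realType) (L0 : R) (F : R * R -> 'rV[R]_(adim L0))
    (i : 'I_2) (V : R * R -> 'rV[R]_(adim L0)) (p : R * R)
    : 'rV[R]_(adim L0) :=
  pd i V p - (L0 * ip (pd i V p) (F p)) *: F p.

(* component orthogonal to dF(d_u), dF(d_v) *)
Definition normal_part (R : realType) (L0 : R)
    (F : R * R -> 'rV[R]_(adim L0)) (p : R * R) (w : 'rV[R]_(adim L0))
    : 'rV[R]_(adim L0) :=
  w - \sum_(k < 2) \sum_(l < 2)
        (invmx (induced_metric F p) k l * ip w (pd l F p)) *: pd k F p.

Definition nabla_perp (R : realType) (L0 : R)
    (F : R * R -> 'rV[R]_(adim L0)) (i : 'I_2)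
    (xi : R * R -> 'rV[R]_(adim L0)) (p : R * R) : 'rV[R]_(adim L0) :=
  normal_part F p (nabla F i xi p).

Definition normal_field (R : realType) (L0 : R) (O : set (R * R))
    (F xi : R * R -> 'rV[R]_(adim L0)) : Prop :=
  smooth O xi /\
  forall p, O p -> (L0 != 0 -> ip (xi p) (F p) = 0) /\
                   (forall i, ip (xi p) (pd i F p) = 0).

Definition conformal_immersion (R : realType) (L0 : R) (O : set (R * R))
    (lam : R * R -> R) (F : R * R -> 'rV[R]_(adim L0)) : Prop :=
  [/\ smooth O F, smooth O lam &
      forall p, O p -> in_space_form (F p) /\
                       induced_metric F p = (expR (2 * lam p))%:M].

Definition curvature_eq (R : realType) (L0 : R) (O : set (R * R))
    (F : R * R -> 'rV[R]_(adim L0)) : Prop :=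
  forall p, O p -> curvature (induced_metric F) p = L0.

(* R^perp = 0; on a surface it is enough to evaluate R^perp(d_u, d_v) *)
Definition flat_normal_connection (R : realType) (L0 : R) (O : set (R * R))
    (F : R * R -> 'rV[R]_(adim L0)) : Prop :=
  forall xi, normal_field O F xi -> forall p, O p ->
    nabla_perp F 0 (nabla_perp F 1 xi) p
    - nabla_perp F 1 (nabla_perp F 0 xi) p = 0.

Definition normal_frame (R : realType) (L0 : R) (O : set (R * R))
    (lam : R * R -> R) (F N1 N2 : R * R -> 'rV[R]_(adim L0)) : Prop :=
  [/\ normal_field O F N1, normal_field O F N2 &
      forall p, O p ->
        [/\ ip (N1 p) (N1 p) = expR (2 * lam p),
            ip (N2 p) (N2 p) = expR (2 * lam p) & ip (N1 p) (N2 p) = 0]].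

Record sff (R : realType) := Sff {
  al1 : R * R -> R; al2 : R * R -> R; al3 : R * R -> R;
  be1 : R * R -> R; be2 : R * R -> R; be3 : R * R -> R }.

Definition is_sff (R : realType) (L0 : R) (O : set (R * R))
    (F N1 N2 : R * R -> 'rV[R]_(adim L0)) (s : sff R) : Prop :=
  forall p, O p ->
    [/\ normal_part F p (nabla F 0 (du F) p)
          = al1 s p *: N1 p + be1 s p *: N2 p,
        normal_part F p (nabla F 0 (dv F) p)
          = al2 s p *: N1 p + be2 s p *: N2 p &
        normal_part F p (nabla F 1 (dv F) p)
          = al3 s p *: N1 p + be3 s p *: N2 p].

Definition is_normal_connection (R : realType) (L0 : R) (O : set (R * R))
    (lam : R * R -> R) (F N1 N2 : R * R -> 'rV[R]_(adim L0))
    (mu1 mu2 : R * R -> R) : Prop :=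
  forall p, O p ->
    [/\ nabla_perp F 0 N1 p = du lam p *: N1 p + mu1 p *: N2 p,
        nabla_perp F 0 N2 p = - mu1 p *: N1 p + du lam p *: N2 p,
        nabla_perp F 1 N1 p = dv lam p *: N1 p + mu2 p *: N2 p &
        nabla_perp F 1 N2 p = - mu2 p *: N1 p + dv lam p *: N2 p].

Definition linearly_dependent (R : realType) (L0 : R) (O : set (R * R))
    (lam : R * R -> R) (F : R * R -> 'rV[R]_(adim L0)) : Prop :=
  exists (N1 N2 : R * R -> 'rV[R]_(adim L0)) (s : sff R) (theta : R * R -> R),
    [/\ normal_frame O lam F N1 N2, is_sff O F N1 N2 s &
        forall p, O p ->
          [/\ cos (theta p) * al1 s p + sin (theta p) * be1 s p = 0,
              cos (theta p) * al2 s p + sin (theta p) * be2 s p = 0 &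
              cos (theta p) * al3 s p + sin (theta p) * be3 s p = 0]].

(* suffixes p and m stand for the subscripts + and - *)
Definition Wp (R : realType) (s : sff R) (p : R * R) : R := al2 s p + be1 s p.
Definition Wm (R : realType) (s : sff R) (p : R * R) : R := al2 s p - be1 s p.
Definition Xp (R : realType) (s : sff R) (p : R * R) : R := al2 s p + be3 s p.
Definition Xm (R : realType) (s : sff R) (p : R * R) : R := al2 s p - be3 s p.
Definition Yp (R : realType) (s : sff R) (p : R * R) : R := be2 s p + al1 s p.
Definition Ym (R : realType) (s : sff R) (p : R * R) : R := be2 s p - al1 s p.
Definition Zp (R : realType) (s : sff R) (p : R * R) : R := be2 s p + al3 s p.
Definition Zm (R : realType) (s : sff R) (p : R * R) : R := be2 s p - al3 s p.

(* lam, gam, kp, km, thm, fp, fm (for lambda, gamma, k+, k-, theta-, f+, f-)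
   are the functions attached to F and to the normal frame (N1, N2).  The
   function theta- with tan theta- = k- is the branch in ]-pi/2, pi/2[. *)
Record attached (R : realType) (L0 : R) (O : set (R * R))
    (F N1 N2 : R * R -> 'rV[R]_(adim L0)) (s : sff R)
    (lam gam kp km thm fp fm : R * R -> R) : Prop := Attached {
  att_immersion : conformal_immersion O lam F;
  att_frame : normal_frame O lam F N1 N2;
  att_sff : is_sff O F N1 N2 s;
  att_connection : is_normal_connection O lam F N1 N2 (du gam) (dv gam);
  att_smooth : [/\ smooth O gam, smooth O kp & smooth O km] /\
               [/\ smooth O thm, smooth O fp & smooth O fm];
  att_kp : forall p, O p ->
    Wm s p = kp p * (- Yp s p) /\ Zm s p = kp p * Xp s p;
  att_km : forall p, O p ->
    Wp s p = km p * (- Ym s p) /\ Zp s p = km p * Xm s p;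
  att_fp : forall p, O p ->
    Xp s p = dv fp p / Num.sqrt (1 + kp p ^+ 2) /\
    Yp s p = du fp p / Num.sqrt (1 + kp p ^+ 2);
  att_fm : forall p, O p ->
    Xm s p = - (dv fm p / Num.sqrt (1 + km p ^+ 2)) /\
    Ym s p = du fm p / Num.sqrt (1 + km p ^+ 2);
  att_thm : forall p, O p -> - (pi / 2) < thm p < pi / 2 /\ tan (thm p) = km p
}.

Definition coefA (R : realType) (fp fm : R * R -> R) (p : R * R) : R :=
  dv fp p * du fm p + dv fm p * du fp p.
Definition coefA' (R : realType) (fp fm : R * R -> R) (p : R * R) : R :=
  dv fp p * du fm p - dv fm p * du fp p.
Definition coefB (R : realType) (fp fm : R * R -> R) (p : R * R) : R :=
  du fp p * du fm p - dv fp p * dv fm p.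

Definition cond_i (R : realType) (L0 : R) (O : set (R * R))
    (lam : R * R -> R) : Prop :=
  forall p, O p ->
    du (du lam) p + dv (dv lam) p + L0 * expR (2 * lam p) = 0.

Definition cond_ii (R : realType) (O : set (R * R)) (thm : R * R -> R) : Prop :=
  forall p, O p -> thm p != 0.

Definition cond_iii (R : realType) (O : set (R * R)) (fp fm : R * R -> R)
    : Prop :=
  forall p, O p ->
    coefA fp fm p * coefA' fp fm p
      = dv fp p ^+ 2 * du fm p ^+ 2 - dv fm p ^+ 2 * du fp p ^+ 2 /\
    coefA fp fm p * coefA' fp fm p != 0.

Definition cond_iv (R : realType) (O : set (R * R)) (psi fp fm : R * R -> R)
    : Prop :=
  forall p, O p ->
    du fm p = cos (psi p) * dv fp p - sin (psi p) * du fp p /\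
    dv fm p = sin (psi p) * dv fp p + cos (psi p) * du fp p.

Definition cond_v (R : realType) (O : set (R * R))
    (lam gam thm psi fp fm : R * R -> R) : Prop :=
  forall p, O p ->
    du gam p = - du thm p + jac2 fp psi p / jac2 fp fm p * du fm p
      - (coefA' fp fm p)^-1 *
          (2 * du fp p * du fm p * du lam p + coefA fp fm p * dv lam p) /\
    dv gam p = - dv thm p + jac2 fp psi p / jac2 fp fm p * dv fm p
      - (coefA' fp fm p)^-1 *
          (coefA fp fm p * du lam p + 2 * dv fp p * dv fm p * dv lam p).

Definition conditions (R : realType) (L0 : R) (O : set (R * R))
    (lam gam thm psi fp fm : R * R -> R) : Prop :=
  [/\ cond_i L0 O lam, cond_ii O thm, cond_iii O fp fm,
      cond_iv O psi fp fm & cond_v O lam gam thm psi fp fm].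

(* numerator and denominator of k+ = (B k- - A) / (A k- + B), k- = tan theta- *)
Definition kp_num (R : realType) (thm fp fm : R * R -> R) (p : R * R) : R :=
  coefB fp fm p * tan (thm p) - coefA fp fm p.
Definition kp_den (R : realType) (thm fp fm : R * R -> R) (p : R * R) : R :=
  coefA fp fm p * tan (thm p) + coefB fp fm p.

(* F is an immersion obtained from the data lam, gam, thm, fp, fm.
   The relations W+ + W- = X+ + X- and Y+ + Y- = Z+ + Z- that are needed to
   recover al_k, be_k hold exactly when A k- + B < 0.  When A k- + B > 0 one
   has to use -f+ (i.e. the opposite sign of sqrt (1 + k+^2)); this changes
   neither k+ nor the conditions, up to replacing psi by psi + pi. *)
Definition obtained_from (R : realType) (L0 : R) (O : set (R * R))
    (lam gam thm fp fm : R * R -> R) (F : R * R -> 'rV[R]_(adim L0)) : Prop :=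
  exists (e : R) (N1 N2 : R * R -> 'rV[R]_(adim L0)) (s : sff R),
    [/\ e = 1 \/ e = -1,
        forall p, O p -> e * kp_den thm fp fm p < 0 &
        attached O F N1 N2 s lam gam
          (fun p => kp_num thm fp fm p / kp_den thm fp fm p)
          (fun p => tan (thm p)) thm (fun p => e * fp p) fm].

(* Main.v *)
Require Import Defs.
From mathcomp Require Import all_boot all_order all_algebra.
From mathcomp Require Import all_classical all_reals all_analysis.
From mathcomp Require Import ring lra.
Set Implicit Arguments.
Unset Strict Implicit.
Unset Printing Implicit Defensive.
Import Order.TTheory GRing.Theory Num.Theory.
Import numFieldNormedType.Exports.
Local Open Scope classical_set_scope.
Local Open Scope ring_scope.

(** The moving frame E = (T1, T2, N1, N2, F) of a conformal immersion solves a
    linear system E_u = Om_u E, E_v = Om_v E ([structure_equations]), whose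
    coefficients are made of the metric, the second fundamental form and the
    normal connection.  The system is integrable exactly when Om is flat, that
    is, when the equations of Gauss, Ricci and Codazzi hold
    ([structure_integrable], [curvature_entries]).  Everything therefore reduces
    to writing these equations in terms of the functions attached to F.

    Put a = arctan k+ and b = theta-.  The relations between W, X, Y, Z and f+,
    f- say that the second fundamental form is a combination of the gradients of
    f+ and f- with coefficients the cosines and sines of a and b ([sff_of]).
    They give two expressions for al2 and for be2; these agree when
    ((f-)_u, (f-)_v) is ((f+)_v, (f+)_u) rotated by psi = b - a + pi / 2, which
    is relation (iv) ([rotation_compat], [compat_rotation]).  In this form the
    Ricci equation and the algebraic part of the Gauss equation are identities
    ([gauss_ricci]), K = L0 is the equation (i) by Liouville's formula
    ([curvature_conformal]), and the four Codazzi equations collapse to two, one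
    for f+ and one for f- ([codazzi_defects], [codazzi_split]).  These are linear
    in (gamma_u, gamma_v) with determinant A' up to sign, and (v) is their
    solution by Cramer's rule ([codazzi_cramer]).  Up to nonzero cosines,
    X+^2 Y-^2 - X-^2 Y+^2 is A A', and k- is theta- up to the tangent, whence
    (ii) and (iii) ([neq0_iff_conditions]).

    Conversely, data with (i)-(v) give a flat connection.  The system is solved
    near each point ([frobenius_local]), and the local solutions are patched on a
    simply connected domain by transport along paths ([monodromy],
    [total_system]).  The pairing of two solutions through the inverse metric is
    constant ([pairing_constant]).  Applied to a solution and itself, this keeps
    the frame orthogonal, so that its last vector is an immersion into N with the
    prescribed invariants ([exists_surface]); applied to the frames of two
    immersions with the same data, it is the isometry between them ([rigidity]).
    If the second fundamental form were linearly dependent, the Gauss equation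
    would force cos a cos b A' = sin a sin b A' = 0, against (ii) and (iii)
    ([sff_of_independent]). *)

(** * Partial derivatives as derivatives along slices *)
Section Slices.
Context {R : realType}.
Implicit Types (O : set (R * R)) (p q : R * R) (x y t : R).

Lemma ball_square p (r : R) q :
  ball p r q <-> `|p.1 - q.1| < r /\ `|p.2 - q.2| < r.
Proof. by []. Qed.

Lemma square_le p (r r' : R) q : r <= r' -> ball p r q -> ball p r' q.
Proof. by move=> rr /ball_square[h1 h2]; apply/ball_square; split; exact: lt_le_trans rr. Qed.

Lemma quotient_u (V : normedModType R) (f : R * R -> V) p :
  (fun h : R => h^-1 *: ((f \o shift p) (h *: (1, 0)) - f p)) =
  (fun h : R => h^-1 *: (((fun t => f (t, p.2)) \o shift p.1) (h *: 1) - f p)).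
Proof.
apply/funext => h; case: p => a b /=.
suff -> : h *: (1, 0) + (a, b) = (h *: 1 + a, b) :> R * R by [].
by rewrite -{2}[b]add0r -{2}[0](scaler0 _ h).
Qed.

Lemma quotient_v (V : normedModType R) (f : R * R -> V) p :
  (fun h : R => h^-1 *: ((f \o shift p) (h *: (0, 1)) - f p)) =
  (fun h : R => h^-1 *: (((fun t => f (p.1, t)) \o shift p.2) (h *: 1) - f p)).
Proof.
apply/funext => h; case: p => a b /=.
suff -> : h *: (0, 1) + (a, b) = (a, h *: 1 + b) :> R * R by [].
by rewrite -{2}[a]add0r -{2}[0](scaler0 _ h).
Qed.

Lemma is_derive_u (V : normedModType R) (f : R * R -> V) p d :
  is_derive p (1, 0) f d <-> is_derive p.1 1 (fun t => f (t, p.2)) d.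
Proof.
split=> -[]; rewrite /derivable /derive.
  by rewrite quotient_u; case: p => a b /= h1 h2; exact: DeriveDef.
by move=> h1 h2; apply: DeriveDef; rewrite /derivable /derive quotient_u; move: h1 h2; case: p.
Qed.

Lemma is_derive_v (V : normedModType R) (f : R * R -> V) p d :
  is_derive p (0, 1) f d <-> is_derive p.2 1 (fun t => f (p.1, t)) d.
Proof.
split=> -[]; rewrite /derivable /derive.
  by rewrite quotient_v; case: p => a b /= h1 h2; exact: DeriveDef.
by move=> h1 h2; apply: DeriveDef; rewrite /derivable /derive quotient_v; move: h1 h2; case: p.
Qed.

(** The mean value theorem for endpoints in either order, so that increments of
    both signs are treated at once. *)
Lemma mvt_between (g dg : R -> R) (a b : R) :
  (forall t, Num.min a b <= t <= Num.max a b -> is_derive t 1 g (dg t)) ->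
  exists2 c, Num.min a b <= c <= Num.max a b & g b - g a = dg c * (b - a).
Proof.
move=> gd.
have cont x y : x <= y -> (forall t, x <= t <= y -> is_derive t 1 g (dg t)) ->
    {within `[x, y], continuous g}.
  move=> xy h; apply: derivable_within_continuous => t.
  by rewrite in_itv /= => /h[].
case: (leP a b) => ab in gd *.
  have [c] := MVT_segment ab (fun t (tab : t \in `]a, b[) =>
    gd t (subset_itv_oo_cc tab)) (cont _ _ ab gd).
  by rewrite in_itv /= => cab e; exists c.
have [c] := MVT_segment (ltW ab) (fun t (tab : t \in `]b, a[) =>
    gd t (subset_itv_oo_cc tab)) (cont _ _ (ltW ab) gd).
rewrite in_itv /= => cab e; exists c => //.
by rewrite -opprB e -mulrN opprB.
Qed.

Lemma lipschitz_between (g dg : R -> R) (a b M : R) :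
  (forall t, Num.min a b <= t <= Num.max a b ->
     is_derive t 1 g (dg t) /\ `|dg t| <= M) ->
  `|g b - g a| <= M * `|b - a|.
Proof.
move=> H; have [c cab ->] := mvt_between (fun t h => (H t h).1).
by rewrite normrM ler_wpM2r //; exact: (H c cab).2.
Qed.

Lemma between_ball (c r a b t : R) : `|c - a| < r -> `|c - b| < r ->
  Num.min a b <= t <= Num.max a b -> `|c - t| < r.
Proof.
rewrite !ltr_norml => /andP[h1 h2] /andP[h3 h4].
by case: (leP a b) => ab /andP[h5 h6]; apply/andP; split; lra.
Qed.

Lemma near_open O p (P : R * R -> Prop) :
  open O -> O p -> (forall q, O q -> P q) -> \near p, P p.
Proof. by move=> oO Op h; apply: filterS h _; exact: open_nbhs_nbhs. Qed.

Lemma is_derive_ext_open (V : normedModType R) O (f g : R * R -> V) p v d :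
  open O -> O p -> (forall q, O q -> f q = g q) ->
  is_derive p v f d -> is_derive p v g d.
Proof. by move=> oO Op fg; apply: near_eq_is_derive; exact: near_open Op _. Qed.

Lemma derivable_ext_open (V : normedModType R) O (f g : R * R -> V) p v :
  open O -> O p -> (forall q, O q -> f q = g q) ->
  derivable f p v -> derivable g p v.
Proof. by move=> oO Op fg; apply: near_eq_derivable; exact: near_open Op _. Qed.

Lemma derive_ext_open (V : normedModType R) O (f g : R * R -> V) p v :
  open O -> O p -> (forall q, O q -> f q = g q) -> 'D_v f p = 'D_v g p.
Proof. by move=> oO Op fg; apply: near_eq_derive; exact: near_open Op _. Qed.

End Slices.

(** * Functions of class C^k *)
Section CkAlgebra.
Context {R : realType}.
Variable O : set (R * R).
Hypothesis oO : open O.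
Implicit Types (p q : R * R).

Lemma Ck_continuous (V : normedModType R) k (f : R * R -> V) p :
  Ck k O f -> O p -> {for p, continuous f}.
Proof. by case: k => [|k] [+ _]; exact. Qed.

Lemma Ck_pred (V : normedModType R) k (f : R * R -> V) :
  Ck k.+1 O f -> Ck k O f.
Proof.
elim: k f => [|k IH] f; first by case.
by case=> fc [fd fu fv]; split; [exact: fc|split; [exact: fd|exact: IH fu|exact: IH fv]].
Qed.

Lemma continuous_ext_open (T : topologicalType) (f g : R * R -> T) :
  (forall q, O q -> f q = g q) -> (forall p, O p -> {for p, continuous f}) ->
  forall p, O p -> {for p, continuous g}.
Proof.
move=> fg fc p Op; suff : g x @[x --> p] --> f p by rewrite (fg p Op).
apply: cvg_trans (fc p Op).
by apply: near_eq_cvg; apply: near_open Op _ => // q Oq; rewrite fg.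
Qed.

Lemma Ck_ext (V : normedModType R) k (f g : R * R -> V) :
  (forall q, O q -> f q = g q) -> Ck k O f -> Ck k O g.
Proof.
elim: k f g => [|k IH] f g fg [fc fd]; split.
- exact: continuous_ext_open fg fc.
- by [].
- exact: continuous_ext_open fg fc.
case: fd => fd fu fv; split.
- by move=> p Op; case: (fd p Op) => d1 d2; split;
    exact: (derivable_ext_open oO Op fg).
- by apply: IH fu => q Oq; exact: (derive_ext_open _ oO Oq fg).
- by apply: IH fv => q Oq; exact: (derive_ext_open _ oO Oq fg).
Qed.

Lemma CkS_is_derive (V : normedModType R) k (f : R * R -> V) p : Ck k.+1 O f -> O p ->
  is_derive p (1, 0) f (du f p) /\ is_derive p (0, 1) f (dv f p).
Proof. by case=> _ [fd _ _] Op; case: (fd p Op) => *; split; exact: DeriveDef. Qed.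

(** Class C^(k+1) from candidates for the partial derivatives: this is how
    regularity is propagated by induction on k below. *)
Lemma Ck_step (V : normedModType R) k (f fu fv : R * R -> V) :
  (forall p, O p -> {for p, continuous f}) ->
  (forall p, O p -> is_derive p (1, 0) f (fu p)) ->
  (forall p, O p -> is_derive p (0, 1) f (fv p)) ->
  Ck k O fu -> Ck k O fv -> Ck k.+1 O f.
Proof.
move=> fc du_ dv_ Cu Cv; split => //; split.
- by move=> p Op; case: (du_ p Op) => ? _; case: (dv_ p Op).
- by apply: Ck_ext Cu => q Oq; case: (du_ q Oq).
- by apply: Ck_ext Cv => q Oq; case: (dv_ q Oq).
Qed.

Lemma Ck_cst (V : normedModType R) k (c : V) : Ck k O (fun=> c).
Proof.
elim: k c => [|k IH] c; first by split => // p _; exact: cvg_cst.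
by apply: (@Ck_step _ _ _ (fun=> 0) (fun=> 0)) => // p _; exact: cvg_cst.
Qed.

Lemma CkD (V : normedModType R) k (f g : R * R -> V) :
  Ck k O f -> Ck k O g -> Ck k O (fun p => f p + g p).
Proof.
elim: k f g => [|k IH] f g Cf Cg; have fc := Ck_continuous Cf; have gc := Ck_continuous Cg.
  by split=> // p Op; apply: cvgD; [exact: fc|exact: gc].
apply: (@Ck_step _ _ _ (fun p => du f p + du g p) (fun p => dv f p + dv g p)).
- by move=> p Op; apply: cvgD; [exact: fc|exact: gc].
- by move=> p Op; have [? _] := CkS_is_derive Cf Op; have [? _] := CkS_is_derive Cg Op;
    exact: is_deriveD.
- by move=> p Op; have [_ ?] := CkS_is_derive Cf Op; have [_ ?] := CkS_is_derive Cg Op;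
    exact: is_deriveD.
- by case: Cf Cg => _ [_ Cu Cv] [_ [_ Du Dv]]; exact: (IH _ _ Cu Du).
- by case: Cf Cg => _ [_ Cu Cv] [_ [_ Du Dv]]; exact: (IH _ _ Cv Dv).
Qed.

Lemma CkN (V : normedModType R) k (f : R * R -> V) : Ck k O f -> Ck k O (fun p => - f p).
Proof.
elim: k f => [|k IH] f Cf; have fc := Ck_continuous Cf.
  by split=> // p Op; apply: cvgN; exact: fc.
apply: (@Ck_step _ _ _ (fun p => - du f p) (fun p => - dv f p)).
- by move=> p Op; apply: cvgN; exact: fc.
- by move=> p Op; have [? _] := CkS_is_derive Cf Op; exact: is_deriveN.
- by move=> p Op; have [_ ?] := CkS_is_derive Cf Op; exact: is_deriveN.
- by case: Cf => _ [_ Cu Cv]; exact: IH.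
- by case: Cf => _ [_ Cu Cv]; exact: IH.
Qed.

Lemma CkM k (f g : R * R -> R) :
  Ck k O f -> Ck k O g -> Ck k O (fun p => f p * g p).
Proof.
elim: k f g => [|k IH] f g Cf Cg; have fc := Ck_continuous Cf; have gc := Ck_continuous Cg.
  by split=> // p Op; apply: cvgM; [exact: fc|exact: gc].
apply: (@Ck_step _ _ _ (fun p => f p * du g p + g p * du f p)
                       (fun p => f p * dv g p + g p * dv f p)).
- by move=> p Op; apply: cvgM; [exact: fc|exact: gc].
- by move=> p Op; have [? _] := CkS_is_derive Cf Op; have [? _] := CkS_is_derive Cg Op;
    exact: is_deriveM.
- by move=> p Op; have [_ ?] := CkS_is_derive Cf Op; have [_ ?] := CkS_is_derive Cg Op;
    exact: is_deriveM.
- have Cf' := Ck_pred Cf; have Cg' := Ck_pred Cg.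
  by case: Cf Cg => _ [_ Cu Cv] [_ [_ Du Dv]]; apply: (CkD (IH _ _ Cf' Du) (IH _ _ Cg' Cu)).
- have Cf' := Ck_pred Cf; have Cg' := Ck_pred Cg.
  by case: Cf Cg => _ [_ Cu Cv] [_ [_ Du Dv]]; apply: (CkD (IH _ _ Cf' Dv) (IH _ _ Cg' Cv)).
Qed.

Lemma Ck_sum k n (F : 'I_n -> R * R -> R) :
  (forall i, Ck k O (F i)) -> Ck k O (fun p => \sum_(i < n) F i p).
Proof.
elim: n F => [|n IH] F CF.
  by apply: (@Ck_ext _ _ (fun=> 0)) (Ck_cst _ _) => p _; rewrite big_ord0.
apply: (@Ck_ext _ _ (fun p => \sum_(i < n) F (widen_ord (leqnSn n) i) p + F ord_max p)).
  by move=> p _; rewrite big_ord_recr.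
by apply: CkD => //; apply: IH.
Qed.

(** The directional derivative only sees the restriction of [f] to the line
    through [x], where the chain rule in one variable applies. *)
Lemma is_derive_comp1 (V : normedModType R) (f : V -> R) (g : R -> R) (x v : V) (df dg : R) :
  is_derive x v f df -> is_derive (f x) 1 g dg ->
  is_derive x v (fun y => g (f y)) (dg * df).
Proof.
move=> [fd fE] gd.
have quot (h : V -> R) : (fun t : R => t^-1 *: ((h \o shift x) (t *: v) - h x)) =
    (fun t : R => t^-1 *: (((fun t : R => h (t *: v + x)) \o shift 0) (t *: 1) - h (0 *: v + x))).
  by apply/funext => t /=; rewrite addr0 scale0r add0r [_ *: 1]mulr1.
have fl : is_derive (0 : R) 1 (fun t : R => f (t *: v + x)) df.
  by apply: DeriveDef; rewrite /derivable /derive -quot.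
have := @is_derive1_comp R g (fun t : R => f (t *: v + x)) 0 dg df.
rewrite /= scale0r add0r => /(_ gd fl)[h1 h2].
by apply: DeriveDef; rewrite /derivable /derive (quot (fun y => g (f y))).
Qed.

(** [G n] is the n-th derivative of [G 0]; letting the induction on k run over
    the whole sequence avoids any reference to iterated derivatives. *)
Lemma Ck_comp (G : nat -> R -> R) (D : set R) k n (f : R * R -> R) :
  (forall n x, D x -> is_derive x 1 (G n) (G n.+1 x)) ->
  (forall p, O p -> D (f p)) -> Ck k O f -> Ck k O (fun p => G n (f p)).
Proof.
move=> GD fD; elim: k n f fD => [|k IH] n f fD Cf; have fc := Ck_continuous Cf.
  split => // p Op; apply: continuous_comp; first exact: fc.
  apply/differentiable_continuous/derivable1_diffP.
  by have [] := GD n _ (fD p Op).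
apply: (@Ck_step _ _ _ (fun p => G n.+1 (f p) * du f p)
                       (fun p => G n.+1 (f p) * dv f p)).
- move=> p Op; apply: continuous_comp; first exact: fc.
  apply/differentiable_continuous/derivable1_diffP.
  by have [] := GD n _ (fD p Op).
- by move=> p Op; have [? _] := CkS_is_derive Cf Op; apply: is_derive_comp1;
    exact: GD (fD p Op).
- by move=> p Op; have [_ ?] := CkS_is_derive Cf Op; apply: is_derive_comp1;
    exact: GD (fD p Op).
- by apply: CkM; [apply: IH => //; exact: Ck_pred|case: Cf => _ []].
- by apply: CkM; [apply: IH => //; exact: Ck_pred|case: Cf => _ []].
Qed.

End CkAlgebra.

Section SmoothAlgebra.
Context {R : realType}.
Variable O : set (R * R).
Hypothesis oO : open O.
Implicit Types (p q : R * R) (f g : R * R -> R).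

Lemma smooth_continuous (V : normedModType R) (f : R * R -> V) p :
  smooth O f -> O p -> {for p, continuous f}.
Proof. by move=> /(_ 0%N)[+ _] Op; exact. Qed.

Lemma smooth_is_derive (V : normedModType R) (f : R * R -> V) i p :
  smooth O f -> O p ->
  is_derive p (if i == 0 :> 'I_2 then (1, 0) else (0, 1)) f (pd i f p).
Proof.
move=> /(_ 1%N) sf Op; have [? ?] := CkS_is_derive sf Op.
by rewrite /pd; case: ifP => _; exact: DeriveDef.
Qed.

Lemma smooth_pd (V : normedModType R) (f : R * R -> V) i : smooth O f -> smooth O (pd i f).
Proof.
move=> sf k; have [_ [_ Cu Cv]] := sf k.+1; move: Cu Cv; rewrite /du /dv /pd.
by case: ifP.
Qed.

Lemma smooth_ext (V : normedModType R) (f g : R * R -> V) :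
  (forall q, O q -> f q = g q) -> smooth O f -> smooth O g.
Proof. by move=> fg sf k; exact: (Ck_ext oO fg). Qed.

Lemma smooth_cst (V : normedModType R) (c : V) : smooth O (fun=> c).
Proof. by move=> k; exact: Ck_cst. Qed.

Lemma smoothD (V : normedModType R) (f g : R * R -> V) :
  smooth O f -> smooth O g -> smooth O (fun p => f p + g p).
Proof. by move=> sf sg k; exact: CkD. Qed.

Lemma smoothN (V : normedModType R) (f : R * R -> V) : smooth O f -> smooth O (fun p => - f p).
Proof. by move=> sf k; exact: CkN. Qed.

Lemma smoothM f g : smooth O f -> smooth O g -> smooth O (fun p => f p * g p).
Proof. by move=> sf sg k; exact: CkM. Qed.

Lemma smooth_sum n (F : 'I_n -> R * R -> R) :
  (forall i, smooth O (F i)) -> smooth O (fun p => \sum_(i < n) F i p).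
Proof. by move=> sF k; apply: Ck_sum => // i; exact: sF. Qed.

Lemma smooth_expR f : smooth O f -> smooth O (fun p => expR (f p)).
Proof.
move=> sf k; apply: (@Ck_comp _ _ oO (fun=> @expR R) setT k 0) => // n x _.
Qed.

(* the n-th derivative of cos; the shift by pi / 2 gives - sin as the first derivative *)
Let trig (n : nat) (x : R) := cos (x + n%:R * (pi / 2)).

Let trigD (n : nat) (x : R) : is_derive x 1 (trig n) (trig n.+1 x).
Proof.
have -> : trig n.+1 x = - sin (x + n%:R * (pi / 2)).
  by rewrite -cosDpihalf /trig -[(n.+1)%:R]natr1 mulrDl mul1r addrA.
have -> : - sin (x + n%:R * (pi / 2)) = - sin (x + n%:R * (pi / 2)) * (1 + 0).
  by rewrite addr0 mulr1.
by apply: (@is_derive_comp1 _ _ (fun y : R => y + n%:R * (pi / 2)) cos).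
Qed.

Lemma smooth_cos f : smooth O f -> smooth O (fun p => cos (f p)).
Proof.
move=> sf k.
have := @Ck_comp _ _ oO trig setT k 0%N f (fun n x _ => trigD n x) (fun _ _ => I) (sf k).
by apply: Ck_ext => // q _; rewrite /trig mul0r addr0.
Qed.

Lemma smooth_sin f : smooth O f -> smooth O (fun p => sin (f p)).
Proof.
move=> sf k.
have := @Ck_comp _ _ oO trig setT k 1%N f (fun n x _ => trigD n x) (fun _ _ => I) (sf k).
move=> /(CkN oO); apply: Ck_ext => // q _.
by rewrite /trig mul1r cosDpihalf opprK.
Qed.

Lemma smoothV f : (forall p, O p -> f p != 0) -> smooth O f -> smooth O (fun p => (f p)^-1).
Proof.
move=> f0 sf; elim=> [|k IH].
  by split => // p Op; apply: cvgV; [exact: f0|exact: smooth_continuous sf Op].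
have sqV x : x^-1 * x^-1 = x ^- 2 :> R by rewrite -invfM -expr2.
apply: (@Ck_step _ _ oO _ _ _ (fun p => - ((f p)^-1 * (f p)^-1) * du f p)
                       (fun p => - ((f p)^-1 * (f p)^-1) * dv f p)).
- by move=> p Op; apply: cvgV; [exact: f0|exact: smooth_continuous sf Op].
- move=> p Op; have [[df _] _] := CkS_is_derive (sf 1%N) Op.
  apply: DeriveDef; first by apply: derivableV => //; exact: f0.
  exact: (etrans (deriveV (f0 p Op) df) (congr1 (fun c => - c * du f p) (esym (sqV _)))).
- move=> p Op; have [_ [df _]] := CkS_is_derive (sf 1%N) Op.
  apply: DeriveDef; first by apply: derivableV => //; exact: f0.
  exact: (etrans (deriveV (f0 p Op) df) (congr1 (fun c => - c * dv f p) (esym (sqV _)))).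
- by apply: CkM => //; [apply: CkN => //; exact: CkM|case: (sf k.+1) => _ []].
- by apply: CkM => //; [apply: CkN => //; exact: CkM|case: (sf k.+1) => _ []].
Qed.

Lemma smooth_atan f : smooth O f -> smooth O (fun p => atan (f p)).
Proof.
move=> sf.
have c p : O p -> {for p, continuous (fun p => atan (f p))}.
  by move=> Op; apply: continuous_comp; [exact: smooth_continuous sf Op|exact: continuous_atan].
have sV : smooth O (fun p => (1 + f p * f p)^-1).
  apply: smoothV; last by apply: smoothD; [exact: smooth_cst|exact: smoothM].
  by move=> p _; rewrite lt0r_neq0 // ltr_wpDr // -expr2 sqr_ge0.
case=> [|k]; first by split.
apply: (@Ck_step _ _ oO _ _ _ (fun p => (1 + f p * f p)^-1 * du f p)
                       (fun p => (1 + f p * f p)^-1 * dv f p)) => //.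
- by move=> p Op; have [? _] := CkS_is_derive (sf 1%N) Op; apply: is_derive_comp1; rewrite -expr2.
- by move=> p Op; have [_ ?] := CkS_is_derive (sf 1%N) Op; apply: is_derive_comp1; rewrite -expr2.
- exact: (smoothM sV (@smooth_pd _ f 0 sf)).
- exact: (smoothM sV (@smooth_pd _ f 1 sf)).
Qed.

Lemma smooth_tan f : (forall p, O p -> cos (f p) != 0) -> smooth O f ->
  smooth O (fun p => tan (f p)).
Proof.
move=> c0 sf; apply: smoothM; first exact: smooth_sin.
by apply: smoothV => //; exact: smooth_cos.
Qed.

End SmoothAlgebra.

(** * Matrix-valued functions *)
Section MatrixValued.
Context {R : realType}.
Variable O : set (R * R).
Hypothesis oO : open O.
Implicit Types (p q : R * R).

Lemma continuous_mx (T : topologicalType) m n (F : T -> 'M[R]_(m, n)) x :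
  {for x, continuous F} <-> forall i j, {for x, continuous (fun y => F y i j)}.
Proof.
split=> [Fc i j|Fc].
  by apply: (@continuous_comp _ _ _ F (fun M : 'M[R]_(m, n) => M i j)) => //;
    exact: coord_continuous.
suff : F y @[y --> x] --> F x by [].
apply/cvgrPdist_le => /= e e0; near=> y.
rewrite /Num.Def.normr /= mx_normrE (bigmax_le _ (ltW e0))//= => i _.
rewrite !mxE; move: i; near: y; apply: filter_forall => /= i.
by have /cvgrPdist_le := Fc i.1 i.2; apply.
Unshelve. all: by end_near. Qed.

Lemma is_derive_mx (V : normedModType R) m n (F : V -> 'M[R]_(m, n)) x v D :
  is_derive x v F D <-> forall i j, is_derive x v (fun y => F y i j) (D i j).
Proof.
split=> [[Fd <-] i j|Fd].
  rewrite derive_mx // mxE; apply: DeriveDef => //.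
  by move/derivable_mxP : Fd.
have Fd' : derivable F x v by apply/derivable_mxP => i j; have [] := Fd i j.
apply: DeriveDef => //; rewrite derive_mx //; apply/matrixP => i j; rewrite mxE.
by have [] := Fd i j.
Qed.

Lemma Ck_mx k m n (F : R * R -> 'M[R]_(m, n)) :
  Ck k O F <-> forall i j, Ck k O (fun p => F p i j).
Proof.
elim: k F => [|k IH] F.
  split=> [[Fc _] i j|Fc]; split => // p Op; first exact: (continuous_mx _ _).1 (Fc p Op) i j.
  by apply/continuous_mx => i j; have [+ _] := Fc i j; exact.
split=> [CF i j|CF].
  apply: (@Ck_step _ _ oO _ _ _ (fun p => du F p i j) (fun p => dv F p i j)).
  - by move=> p Op; apply: (continuous_mx _ _).1; exact: Ck_continuous CF Op.
  - by move=> p Op; apply: (is_derive_mx _ _ _ _).1; have [] := CkS_is_derive CF Op.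
  - by move=> p Op; apply: (is_derive_mx _ _ _ _).1; have [] := CkS_is_derive CF Op.
  - by move: CF => [_ [_ /IH ]] .
  - by move: CF => [_ [_ _ /IH ]].
have FE v p : O p -> v = (1, 0) \/ v = (0, 1) ->
    is_derive p v F (\matrix_(i, j) 'D_v (fun p => F p i j) p).
  move=> Op ve; apply/is_derive_mx => i j; rewrite mxE.
  by have := CkS_is_derive (CF i j) Op; case: ve => -> [].
apply: (@Ck_step _ _ oO _ _ _ (fun p => \matrix_(i, j) 'D_(1, 0) (fun p => F p i j) p)
   (fun p => \matrix_(i, j) 'D_(0, 1) (fun p => F p i j) p)).
- by move=> p Op; apply/continuous_mx => i j; exact: Ck_continuous (CF i j) Op.
- by move=> p Op; apply: FE => //; left.
- by move=> p Op; apply: FE => //; right.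
- apply/IH => i j; have [_ [_ + _]] := CF i j.
  by apply: Ck_ext => // q _; rewrite mxE.
- apply/IH => i j; have [_ [_ _]] := CF i j.
  by apply: Ck_ext => // q _; rewrite mxE.
Qed.

Lemma smooth_mx m n (F : R * R -> 'M[R]_(m, n)) :
  smooth O F <-> forall i j, smooth O (fun p => F p i j).
Proof.
by split=> [sF i j k|sF k]; [exact: (Ck_mx _ _).1|apply/Ck_mx => i j; exact: sF].
Qed.

Lemma pd_mx m n (F : R * R -> 'M[R]_(m, n)) i p a b : smooth O F -> O p ->
  pd i F p a b = pd i (fun q => F q a b) p.
Proof.
move=> sF Op; have := smooth_is_derive i sF Op => /is_derive_mx/(_ a b)[_].
by rewrite /pd => ->.
Qed.

End MatrixValued.

(** * Open subsets of the plane *)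
Section Plane.
Context {R : realType}.
Variable O : set (R * R).
Hypothesis oO : open O.
Implicit Types (p q : R * R) (f g : R * R -> R).

Lemma open_square p : O p -> exists2 r, 0 < r & ball p r `<=` O.
Proof.
move=> Op; have /nbhs_ballP[r r0 rO] : nbhs p O by exact: open_nbhs_nbhs.
by exists r.
Qed.

Lemma halves_dist (a b c e : R) : `|a - c| <= e / 2 -> `|b - c| <= e / 2 -> `|a - b| <= e.
Proof. by rewrite !ler_norml => /andP[? ?] /andP[? ?]; apply/andP; split; lra. Qed.

(** The second difference of [f] over a small square equals, by two applications
    of the mean value theorem in either order, a value of each mixed derivative
    times the area; both derivatives being continuous, they agree at [p]. *)
Lemma schwarz f p : smooth O f -> O p -> du (dv f) p = dv (du f) p.
Proof.
move=> sf Op; have su := @smooth_pd _ _ _ _ 0 sf; have sv := @smooth_pd _ _ _ _ 1 sf.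
apply/eqP; rewrite -subr_eq0 -normr_le0; apply/ler_addgt0Pr => e e0.
rewrite add0r.
have e2 : 0 < e / 2 by rewrite divr_gt0.
have cuv : {for p, continuous (du (dv f))}.
  exact: smooth_continuous (@smooth_pd _ _ _ _ 0 sv) Op.
have cvu : {for p, continuous (dv (du f))}.
  exact: smooth_continuous (@smooth_pd _ _ _ _ 1 su) Op.
have /cvgrPdist_le/(_ _ e2)/nbhs_ballP[r1 /= r10 B1] := cuv.
have /cvgrPdist_le/(_ _ e2)/nbhs_ballP[r2 /= r20 B2] := cvu.
have [r3 r30 B3] := open_square Op.
pose r := Num.min r1 (Num.min r2 r3).
have r0 : 0 < r by rewrite !lt_min r10 r20 r30.
have [rr1 rr2 rr3] : [/\ r <= r1, r <= r2 & r <= r3].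
  by rewrite /r !ge_min !lexx !orbT.
case: p Op @r r0 rr1 rr2 rr3 B1 B2 B3 {cuv cvu} => a b Op r r0 rr1 rr2 rr3 B1 B2 B3.
clearbody r; pose h := r / 2; have h0 : 0 < h by rewrite divr_gt0.
have hr : h < r by rewrite /h; lra.
clearbody h.
have inb x y : Num.min a (a + h) <= x <= Num.max a (a + h) ->
    Num.min b (b + h) <= y <= Num.max b (b + h) -> ball (a, b) r (x, y).
  move=> xh yh; split.
  - by apply: (@between_ball _ a r a (a + h)); rewrite ?subrr ?normr0 // opprD addrA subrr sub0r normrN gtr0_norm.
  - by apply: (@between_ball _ b r b (b + h)); rewrite ?subrr ?normr0 // opprD addrA subrr sub0r normrN gtr0_norm.
have inO x y : Num.min a (a + h) <= x <= Num.max a (a + h) ->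
    Num.min b (b + h) <= y <= Num.max b (b + h) -> O (x, y).
  by move=> xh yh; apply: B3; apply: (@square_le R (a, b) r r3 _ rr3); exact: inb.
have [Ia Iah Ib Ibh] : [/\ Num.min a (a + h) <= a <= Num.max a (a + h),
    Num.min a (a + h) <= a + h <= Num.max a (a + h),
    Num.min b (b + h) <= b <= Num.max b (b + h) &
    Num.min b (b + h) <= b + h <= Num.max b (b + h)].
  by rewrite !ge_min !le_max !lexx !orbT.
have du_at x y : O (x, y) -> is_derive x 1 (fun t => f (t, y)) (du f (x, y)).
  by move=> /(smooth_is_derive 0 sf)/is_derive_u.
have dv_at x y : O (x, y) -> is_derive y 1 (fun t => f (x, t)) (dv f (x, y)).
  by move=> /(smooth_is_derive 1 sf)/is_derive_v.
have duv_at x y : O (x, y) -> is_derive x 1 (fun t => dv f (t, y)) (du (dv f) (x, y)).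
  by move=> /(smooth_is_derive 0 sv)/is_derive_u.
have dvu_at x y : O (x, y) -> is_derive y 1 (fun t => du f (x, t)) (dv (du f) (x, y)).
  by move=> /(smooth_is_derive 1 su)/is_derive_v.
have [x1 x1I E1] := @mvt_between _ (fun t => f (t, b + h) - f (t, b))
  (fun t => du f (t, b + h) - du f (t, b)) a (a + h)
  (fun t tI => is_deriveB (du_at _ _ (inO _ _ tI Ibh)) (du_at _ _ (inO _ _ tI Ib))).
have [y1 y1I E1'] := @mvt_between _ (fun t => du f (x1, t)) _ b (b + h)
  (fun t tI => dvu_at _ _ (inO _ _ x1I tI)).
have [y2 y2I E2] := @mvt_between _ (fun t => f (a + h, t) - f (a, t))
  (fun t => dv f (a + h, t) - dv f (a, t)) b (b + h)
  (fun t tI => is_deriveB (dv_at _ _ (inO _ _ Iah tI)) (dv_at _ _ (inO _ _ Ia tI))).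
have [x2 x2I E2'] := @mvt_between _ (fun t => dv f (t, y2)) _ a (a + h)
  (fun t tI => duv_at _ _ (inO _ _ tI y2I)).
have ah x : x + h - x = h by ring.
rewrite !ah in E1 E1' E2 E2'.
have E : dv (du f) (x1, y1) = du (dv f) (x2, y2).
  have gen (A B C D U1 U2 V1 V2 X Y : R) :
      A - B - (C - D) = (U1 - U2) * h -> U1 - U2 = X * h ->
      A - C - (B - D) = (V1 - V2) * h -> V1 - V2 = Y * h -> X = Y.
    move=> H1 H2 H3 H4; apply: (@mulIf _ (h * h)); first by rewrite mulf_neq0 // gt_eqF.
    by rewrite !mulrA -H2 -H4 -H1 -H3; ring.
  exact: gen E1 E1' E2 E2'.
have l1 : `|du (dv f) (a, b) - du (dv f) (x2, y2)| <= e / 2.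
  apply: B1.
  by apply: (@square_le R (a, b) r r1 _ rr1); exact: inb.
have l2 : `|dv (du f) (a, b) - dv (du f) (x1, y1)| <= e / 2.
  apply: B2.
  by apply: (@square_le R (a, b) r r2 _ rr2); exact: inb.
rewrite -E in l1.
exact: halves_dist l1 l2.
Qed.

Lemma locally_constant f p r : 
  (forall q, ball p r q -> is_derive q (1, 0) f 0 /\ is_derive q (0, 1) f 0) ->
  forall q, ball p r q -> f q = f p.
Proof.
case: p => a b fd [x y] [/= xr yr].
have r0 : 0 < r by apply: le_lt_trans xr.
have aa : `|a - a| < r by rewrite subrr normr0.
have bb : `|b - b| < r by rewrite subrr normr0.
have [c _] := @mvt_between _ (fun t => f (t, y)) (fun=> 0) a x
  (fun t tI => (is_derive_u f (t, y) 0).1 (fd (t, y) (conj (between_ball aa xr tI) yr)).1).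
have [d _] := @mvt_between _ (fun t => f (a, t)) (fun=> 0) b y
  (fun t tI => (is_derive_v f (a, t) 0).1 (fd (a, t) (conj aa (between_ball bb yr tI))).2).
rewrite !mul0r => /eqP; rewrite subr_eq0 => /eqP <- /eqP.
by rewrite subr_eq0 => /eqP.
Qed.

(** [P] and its negation define open subsets of [O], by local constancy. *)
Lemma clopen_connected (P : R * R -> Prop) p0 : connected O -> O p0 -> P p0 ->
  (forall p, O p -> exists2 r, 0 < r & ball p r `<=` O /\
     forall q, ball p r q -> (P p <-> P q)) ->
  forall p, O p -> P p.
Proof.
move=> cO Op0 Pp0 H.
have oP (Q : R * R -> Prop) : (forall p, O p -> exists2 r, 0 < r & ball p r `<=` O /\
     forall q, ball p r q -> (Q p -> Q q)) -> open (O `&` [set p | Q p]).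
  move=> h; rewrite openE => p [Op Qp]; have [r r0 [rO rQ]] := h p Op.
  apply/nbhs_ballP; exists r => // q pq; split; [exact: rO|exact: rQ Qp].
have o1 : open (O `&` [set p | P p]).
  by apply: oP => p /H[r r0 [rO rP]]; exists r => //; split => // q /rP[].
have o2 : open (O `&` [set p | ~ P p]).
  by apply: oP => p /H[r r0 [rO rP]]; exists r => //; split => // q /rP[? ?]; tauto.
have E : O `&` [set p | P p] = O.
  apply: cO; first by exists p0.
    by exists (O `&` [set p | P p]) => //; rewrite setIA setIid.
  exists (~` (O `&` [set p | ~ P p])); first exact: open_closedC.
  apply/seteqP; split => p /= [Op]; first by move=> Pp; split => // -[].
  by move=> nP; split => //; apply: contrapT => nPp; exact: nP.
by move=> p; rewrite -{1}E => -[].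
Qed.

Lemma derive0_constant f p0 : connected O -> O p0 ->
  (forall q, O q -> is_derive q (1, 0) f 0 /\ is_derive q (0, 1) f 0) ->
  forall p, O p -> f p = f p0.
Proof.
move=> cO Op0 fd; apply: (@clopen_connected (fun p => f p = f p0) p0 cO Op0 (erefl _)) => p /open_square[r r0 rO].
exists r => //; split=> // q pq.
by have -> : f q = f p by apply: (@locally_constant f p r) pq => z /rO/fd.
Qed.

(** Bounded partial derivatives make [f] Lipschitz for the sup distance, by
    moving along one coordinate at a time. *)
Lemma lipschitz_continuous f fu fv p r M : 0 < r ->
  (forall q, ball p r q -> is_derive q (1, 0) f (fu q) /\ is_derive q (0, 1) f (fv q)) ->
  (forall q, ball p r q -> `|fu q| <= M /\ `|fv q| <= M) ->
  {for p, continuous f}.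
Proof.
move=> r0 fd fM; suff : f y @[y --> p] --> f p by [].
have M0 : 0 <= M by case: (fM p (ballxx p r0)) => /(le_trans (normr_ge0 _)).
apply/cvgrPdist_le => /= e e0.
suff : nbhs p [set y | `|f p - f y| <= e] by [].
apply/nbhs_ballP.
pose d := Num.min r (e / (2 * (M + 1))).
have M1 : 0 < 2 * (M + 1) by lra.
have d0 : 0 < d by rewrite lt_min r0 divr_gt0.
exists d => //= -[x y] dq; have [/= dx dy] := dq.
have [/= xr yr] : ball p r (x, y) by apply: (@square_le R p d r) dq; rewrite ge_min lexx.
case: p fd fM xr yr dx dy {dq} => a b /= fd fM xr yr dx dy.
have aa : `|a - a| < r by rewrite subrr normr0.
have bb : `|b - b| < r by rewrite subrr normr0.
have h1 := @lipschitz_between _ (fun t => f (t, y)) (fun t => fu (t, y)) a x M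
  (fun t tI => let B : ball (a, b) r (t, y) := conj (between_ball aa xr tI) yr in
   conj ((is_derive_u f (t, y) _).1 (fd _ B).1) (fM _ B).1).
have h2 := @lipschitz_between _ (fun t => f (a, t)) (fun t => fv (a, t)) b y M
  (fun t tI => let B : ball (a, b) r (a, t) := conj aa (between_ball bb yr tI) in
   conj ((is_derive_v f (a, t) _).1 (fd _ B).2) (fM _ B).2).
rewrite distrC -(subrKA (f (a, y))) (le_trans (ler_normD _ _)) //.
have de : d <= e / (2 * (M + 1)) by rewrite /d ge_min lexx orbT.
have : M * `|x - a| <= M * d by apply: ler_wpM2l => //; rewrite distrC ltW.
have : M * `|y - b| <= M * d by apply: ler_wpM2l => //; rewrite distrC ltW.
have : d * (2 * (M + 1)) <= e by rewrite -ler_pdivlMr.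
nra.
Qed.

End Plane.

(** * Rules for partial derivatives *)
Section PartialRules.
Context {R : realType}.
Variable O : set (R * R).
Hypothesis oO : open O.
Implicit Types (p q : R * R) (f g : R * R -> R).

Lemma pd_val (V : normedModType R) (i : 'I_2) (f : R * R -> V) p d :
  is_derive p (if i == 0 then (1, 0) else (0, 1)) f d -> pd i f p = d.
Proof. by case. Qed.

Lemma pd_ext (V : normedModType R) (i : 'I_2) (f g : R * R -> V) p :
  O p -> (forall q, O q -> f q = g q) -> pd i f p = pd i g p.
Proof. by move=> Op fg; exact: derive_ext_open oO Op fg. Qed.

Lemma pd_cst (V : normedModType R) (i : 'I_2) (c : V) p : pd i (fun=> c) p = 0.
Proof. by apply: pd_val; exact: is_derive_cst. Qed.

Lemma pdD (V : normedModType R) (i : 'I_2) (f g : R * R -> V) p :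
  smooth O f -> smooth O g -> O p ->
  pd i (fun q => f q + g q) p = pd i f p + pd i g p.
Proof.
by move=> sf sg Op; apply: pd_val; apply: is_deriveD; exact: smooth_is_derive Op.
Qed.

Lemma pdN (V : normedModType R) (i : 'I_2) (f : R * R -> V) p :
  smooth O f -> O p -> pd i (fun q => - f q) p = - pd i f p.
Proof.
by move=> sf Op; apply: pd_val; apply: is_deriveN; exact: smooth_is_derive Op.
Qed.

Lemma pdB (V : normedModType R) (i : 'I_2) (f g : R * R -> V) p :
  smooth O f -> smooth O g -> O p ->
  pd i (fun q => f q - g q) p = pd i f p - pd i g p.
Proof.
by move=> sf sg Op; apply: pd_val; apply: is_deriveB; exact: smooth_is_derive Op.
Qed.

Lemma pdM (i : 'I_2) f g p : smooth O f -> smooth O g -> O p ->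
  pd i (fun q => f q * g q) p = pd i f p * g p + f p * pd i g p.
Proof.
move=> sf sg Op; apply: pd_val.
have := is_deriveM (smooth_is_derive i sf Op) (smooth_is_derive i sg Op).
by move=> /is_derive_eq; apply; rewrite /GRing.scale /= addrC [pd i f p * _]mulrC.
Qed.

Lemma pd_sum n (i : 'I_2) (F : 'I_n -> R * R -> R) p :
  (forall k, smooth O (F k)) -> O p ->
  pd i (fun q => \sum_(k < n) F k q) p = \sum_(k < n) pd i (F k) p.
Proof.
move=> sF Op; apply: pd_val.
rewrite (_ : (fun q => \sum_k F k q) = \sum_k F k); last first.
  by apply/funext => q; rewrite fct_sumE.
by apply: is_derive_sum => k; exact: smooth_is_derive Op.
Qed.

Lemma pd_comp (i : 'I_2) f (h : R -> R) p dh : smooth O f -> O p ->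
  is_derive (f p) 1 h dh -> pd i (fun q => h (f q)) p = dh * pd i f p.
Proof.
by move=> sf Op hd; apply: pd_val; apply: is_derive_comp1 => //; exact: smooth_is_derive Op.
Qed.

Lemma pd_expR (i : 'I_2) f p : smooth O f -> O p ->
  pd i (fun q => expR (f q)) p = expR (f p) * pd i f p.
Proof. by move=> sf Op; apply: pd_comp. Qed.

Lemma pd_cos (i : 'I_2) f p : smooth O f -> O p ->
  pd i (fun q => cos (f q)) p = - sin (f p) * pd i f p.
Proof. by move=> sf Op; apply: pd_comp. Qed.

Lemma pd_sin (i : 'I_2) f p : smooth O f -> O p ->
  pd i (fun q => sin (f q)) p = cos (f p) * pd i f p.
Proof. by move=> sf Op; apply: pd_comp. Qed.

End PartialRules.

(** * Linear differential equations in one variable *)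
Section Primitive.
Context {R : realType}.
Variables (a rho : R).
Hypothesis rho0 : 0 < rho.
Implicit Types (f g : R -> R) (s t : R).

(** Functions on the interval of radius [rho] about [a] are replaced by total
    continuous functions through this retraction. *)
Definition clamp t : R := Num.max (a - rho) (Num.min (a + rho) t).

Lemma clamp_itv t : `|a - clamp t| <= rho.
Proof.
rewrite /clamp ler_norml; have r0 := rho0.
case: (leP (a + rho) t) => h1; case: (leP (a - rho) _) => h2; apply/andP; split; lra.
Qed.

Lemma clamp_id t : `|a - t| <= rho -> clamp t = t.
Proof.
rewrite ler_norml => /andP[h1 h2].
by rewrite /clamp min_r ?max_r //; lra.
Qed.

Lemma clampa : clamp a = a.
Proof. by apply: clamp_id; rewrite subrr normr0 ltW. Qed.

Lemma continuous_clamp : continuous clamp.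
Proof.
move=> t; apply: (@continuous_max R R (cst (a - rho)) (fun t => Num.min (a + rho) t)).
  exact: cvg_cst.
by apply: (@continuous_min R R (cst (a + rho)) id); [exact: cvg_cst|exact: cvg_id].
Qed.

Let I f x : R := (\int[@lebesgue_measure R]_(t in `[(a - 3 * rho), x]) f t)%R.

(** The integral of [f] from [a]; the integral starts at a - 3 rho only
    to keep the points near [a] in the interior of the interval of integration. *)
Definition primitive f t : R := I f (clamp t) - I f a.

Lemma primitive_a f : primitive f a = 0.
Proof. by rewrite /primitive clampa subrr. Qed.

Let I_derive f x : continuous f -> `|a - x| < 2 * rho -> is_derive x 1 (I f) (f x).
Proof.
move=> fc; rewrite ltr_norml => /andP[h1 h2]; have r0 := rho0.
have xu : x < a + 3 * rho by lra.
have ax : a - 3 * rho < x by lra.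
have intf : (@lebesgue_measure R).-integrable `[(a - 3 * rho), (a + 3 * rho)] (EFin \o f).
  apply: continuous_compact_integrable; first exact: segment_compact.
  exact: continuous_subspaceT.
have [d dE] := continuous_FTC1_closed xu intf ax (fc x).
by apply: DeriveDef; [exact: d|rewrite -derive1E; exact: dE].
Qed.

Lemma primitive_derive f t : continuous f -> `|a - t| < rho ->
  is_derive t 1 (primitive f) (f t).
Proof.
move=> fc ht; have r0 := rho0.
have d : is_derive t 1 (fun x => I f x - I f a) (f t).
  rewrite -[f t]subr0; apply: is_deriveB; apply: I_derive => //.
  by apply: lt_trans ht _; lra.
apply: near_eq_is_derive d.
have : nbhs t (ball a rho) by apply: open_nbhs_nbhs; split => //; exact: ball_open.
by apply: filterS => s hs; rewrite /primitive clamp_id //; exact: ltW.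
Qed.

Lemma primitive_continuous f : continuous f -> continuous (primitive f).
Proof.
move=> fc t; apply: cvgB; last exact: cvg_cst.
apply: (@continuous_comp _ _ _ clamp (I f)); first exact: continuous_clamp.
apply/differentiable_continuous/derivable1_diffP.
have r0 := rho0; have ct := clamp_itv t.
by have [] : is_derive (clamp t) 1 (I f) (f (clamp t)) by apply: I_derive => //; lra.
Qed.

Lemma primitive_le f K : continuous f -> (forall t, `|f t| <= K) ->
  forall t, `|primitive f t| <= K * rho.
Proof.
move=> fc fK t; have r0 := rho0; have ct := clamp_itv t.
have aa : `|a - a| < 2 * rho by rewrite subrr normr0; lra.
have at2 : `|a - clamp t| < 2 * rho by lra.
have K0 : 0 <= K by apply: le_trans (fK a); exact: normr_ge0.
have h := @lipschitz_between R (I f) f a (clamp t) K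
  (fun x xI => conj (I_derive fc (between_ball aa at2 xI)) (fK x)).
by apply: le_trans h _; apply: ler_wpM2l => //; rewrite distrC.
Qed.

Lemma primitive_dist f g K : continuous f -> continuous g ->
  (forall t, `|f t - g t| <= K) ->
  forall t, `|primitive f t - primitive g t| <= K * rho.
Proof.
move=> fc gc fgK t; have r0 := rho0; have ct := clamp_itv t.
have aa : `|a - a| < 2 * rho by rewrite subrr normr0; lra.
have at2 : `|a - clamp t| < 2 * rho by lra.
have K0 : 0 <= K by apply: le_trans (fgK a); exact: normr_ge0.
have := @lipschitz_between R (fun x => I f x - I g x) (fun x => f x - g x) a (clamp t) K
  (fun x xI => conj (is_deriveB (I_derive fc (between_ball aa at2 xI))
                                (I_derive gc (between_ball aa at2 xI))) (fgK x)).
cbv beta; rewrite (_ : primitive f t - primitive g t =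
  I f (clamp t) - I g (clamp t) - (I f a - I g a)); last by rewrite /primitive; ring.
by move=> h; apply: le_trans h _; apply: ler_wpM2l => //; rewrite distrC.
Qed.

End Primitive.

Section GeometricLimit.
Context {R : realType}.

Lemma half_expn_small (c e : R) : 0 < e -> exists k, c * 2^-1 ^+ k < e.
Proof.
move=> e0; have h : `|2^-1 : R| < 1 by rewrite ger0_norm ?invr_ge0 // invf_lt1 ?ltr1n.
have /cvgrPdist_lt/(_ _ e0)[k _ /(_ k (leqnn k))] := @cvg_geometric R c _ h.
rewrite sub0r normrN => hk; exists k.
by apply: le_lt_trans hk; exact: ler_norm.
Qed.

(** The intervals of radius c / 2^k about y_k are nested, hence have a common
    point. *)
Lemma geometric_limit (y : nat -> R) (c : R) :
  (forall k, `|y k.+1 - y k| <= c * 2^-1 ^+ k.+1) ->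
  exists l, forall k, `|y k - l| <= c * 2^-1 ^+ k.
Proof.
move=> yc.
have e k : c * 2^-1 ^+ k = c * 2^-1 ^+ k.+1 + c * 2^-1 ^+ k.+1 by rewrite exprS; field.
pose lo k := y k - c * 2^-1 ^+ k; pose hi k := y k + c * 2^-1 ^+ k.
have loS k : lo k <= lo k.+1.
  by rewrite /lo; have := yc k; have := e k; rewrite ler_norml => h1 /andP[h2 h3]; lra.
have hiS k : hi k.+1 <= hi k.
  by rewrite /hi; have := yc k; have := e k; rewrite ler_norml => h1 /andP[h2 h3]; lra.
have lohi k : lo k <= hi k.
  have : 0 <= c * 2^-1 ^+ k.+1 by apply: le_trans (yc k); exact: normr_ge0.
  by rewrite /lo /hi; have := e k; lra.
have lom j k : (j <= k)%N -> lo j <= lo k.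
  by move=> /subnK <-; elim: (k - j)%N => // n IH; rewrite addSn (le_trans IH).
have him j k : (j <= k)%N -> hi k <= hi j.
  by move=> /subnK <-; elim: (k - j)%N => // n IH; rewrite addSn (le_trans _ IH).
have LH j k : lo j <= hi k.
  case: (leqP j k) => [/lom h|/ltnW /him h]; first exact: le_trans h _.
  exact: le_trans (lohi _) h.
exists (sup (range lo)) => k.
have hs : has_sup (range lo).
  by split; [exists (lo 0%N), 0%N|exists (hi 0%N) => _ [j _ <-]].
have h1 : lo k <= sup (range lo) by apply: ub_le_sup; [exact: hs.2|exists k].
have h2 : sup (range lo) <= hi k.
  by apply: ge_sup; [exact: hs.1|move=> _ [j _ <-]].
by rewrite ler_norml; move: h1 h2; rewrite /lo /hi => h1 h2; apply/andP; split; lra.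
Qed.

End GeometricLimit.

Section Distances.
Context {R : realType}.

Lemma limit_dist (e d y z y' z' : R) : `|y - z| <= d -> `|y' - z'| <= d ->
  `|y - y'| <= e - 2 * d -> `|z - z'| <= e.
Proof.
by rewrite !ler_norml => /andP[? ?] /andP[? ?] /andP[? ?]; apply/andP; split; lra.
Qed.

Lemma fixpoint_dist (e d y z s : R) : `|y - z| <= d / 2 -> `|y - s| <= d / 2 -> d <= e ->
  `|z - s| <= e.
Proof.
by rewrite !ler_norml => /andP[? ?] /andP[? ?] ?; apply/andP; split; lra.
Qed.

Lemma bound_from_dist (c y z : R) : `|y| <= c -> `|y - z| <= c -> `|z| <= 2 * c.
Proof. by rewrite !ler_norml => /andP[? ?] /andP[? ?]; apply/andP; split; lra. Qed.

Lemma gronwall_step (d e rho x y z B K w : R) : 0 <= B -> 0 <= e ->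
  B = 2 * (d + e * rho) + K -> w <= rho -> 0 <= w -> z * rho <= 2^-1 -> 0 <= z ->
  `|x| <= d -> `|y - x| <= (z * B + e) * w -> `|y| <= 2 * (d + e * rho) + K * 2^-1.
Proof.
move=> B0 e0 BE wr w0 zr z0 xd h.
have h1 : (z * B + e) * w <= (z * B + e) * rho.
  by apply: ler_wpM2l => //; rewrite addr_ge0 // mulr_ge0.
have h2 : z * rho * B <= 2^-1 * B by exact: ler_wpM2r.
have h3 : (z * B + e) * rho = z * rho * B + e * rho by ring.
have : `|y| <= `|x| + `|y - x| by rewrite -{1}[y](subrKC x) ler_normD.
by lra.
Qed.

End Distances.

Section LinearODE.
Context {R : realType}.
Variables (n m : nat).
Implicit Types (a rho M K : R).

Lemma mulmx_entry_le (A : 'M[R]_n) (B : 'M[R]_(n, m)) M K :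
  (forall i j, `|A i j| <= M) -> (forall i j, `|B i j| <= K) ->
  forall i j, `|(A *m B) i j| <= n%:R * M * K.
Proof.
move=> AM BK i j; rewrite mxE (le_trans (ler_norm_sum _ _ _)) //.
apply: (@le_trans _ _ (\sum_(k < n) (M * K))).
  by apply: ler_sum => k _; rewrite normrM ler_pM.
by rewrite sumr_const card_ord -[leLHS]mulr_natl mulrA.
Qed.

Lemma continuous_mulmx_entry (A : R -> 'M[R]_n) (B : R -> 'M[R]_(n, m)) :
  (forall i j, continuous (fun t => A t i j)) ->
  (forall i j, continuous (fun t => B t i j)) ->
  forall i j, continuous (fun t => (A t *m B t) i j).
Proof.
move=> Ac Bc i j.
rewrite (_ : (fun t => _) = (fun t => \sum_k A t i k * B t k j)); last first.
  by apply/funext => t; rewrite mxE.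
rewrite -(fct_sumE _ _ (fun k t => A t i k * B t k j)).
elim/big_ind : _ => [t|f g fc gc t|k _ t]; first exact: cvg_cst.
  by apply: cvgD; [exact: fc|exact: gc].
by apply: cvgM; [exact: Ac|exact: Bc].
Qed.

Section Picard.
Variables (a rho M c : R) (A : R -> 'M[R]_n) (C : 'M[R]_(n, m)).
Hypothesis rho0 : 0 < rho.
Hypothesis M0 : 0 <= M.
Hypothesis c0 : 0 <= c.
Hypothesis Ac : forall i j, continuous (fun t => A t i j).
Hypothesis AM : forall t i j, `|A t i j| <= M.
Hypothesis small : n%:R * M * rho <= 2^-1.
Hypothesis Cc : forall i j, `|C i j| <= c.

Let step (Y : R -> 'M[R]_(n, m)) (t : R) : 'M[R]_(n, m) :=
  \matrix_(i, j) (C i j + primitive a rho (fun s => (A s *m Y s) i j) t).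

Let Y k := iter k step (fun=> C).

Let cont (Z : R -> 'M[R]_(n, m)) := forall i j, continuous (fun t => Z t i j).

Let step_cont Z : cont Z -> cont (step Z).
Proof.
move=> Zc i j; rewrite (_ : (fun t => _) = (fun t => C i j +
    primitive a rho (fun s => (A s *m Z s) i j) t)); last first.
  by apply/funext => t; rewrite mxE.
move=> t; apply: cvgD; first exact: cvg_cst.
by apply: primitive_continuous => //; exact: continuous_mulmx_entry.
Qed.

Let step_dist Z Z' K : cont Z -> cont Z' ->
  (forall t i j, `|Z t i j - Z' t i j| <= K) ->
  forall t i j, `|step Z t i j - step Z' t i j| <= K / 2.
Proof.
move=> Zc Zc' ZK t i j.
have K0 : 0 <= K by apply: le_trans (ZK a i j); exact: normr_ge0.
have := @primitive_dist R a rho rho0 (fun s => (A s *m Z s) i j)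
  (fun s => (A s *m Z' s) i j) (n%:R * M * K)
  (continuous_mulmx_entry Ac Zc (i := i) (j := j))
  (continuous_mulmx_entry Ac Zc' (i := i) (j := j)).
move=> /(_ _ t) h; rewrite !mxE opprD addrACA subrr add0r; apply: le_trans (h _) _.
  move=> s; rewrite -[X in `|X|](_ : (A s *m (Z s - Z' s)) i j = _); last first.
    by rewrite mulmxBr !mxE.
  by apply: mulmx_entry_le => // k l; rewrite !mxE.
by rewrite mulrAC [K / 2]mulrC ler_wpM2r.
Qed.

Let Ycont k : cont (Y k).
Proof. by elim: k => [|k IH]; [move=> i j t; exact: cvg_cst|exact: step_cont]. Qed.

Let Ydist k t i j : `|Y k.+1 t i j - Y k t i j| <= c * 2^-1 ^+ k.+1.
Proof.
elim: k t i j => [|k IH] t i j.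
  rewrite expr1 /= mxE addrAC subrr add0r.
  have := @primitive_le R a rho rho0 (fun s => (A s *m C) i j) (n%:R * M * c).
  move=> /(_ _ _ t) h; apply: le_trans (h _ _) _.
  - apply: continuous_mulmx_entry => // k l s; exact: cvg_cst.
  - by move=> s; exact: mulmx_entry_le.
  - by rewrite mulrAC [leRHS]mulrC; apply: ler_wpM2r.
rewrite (exprSr _ k.+1) mulrA; exact: (step_dist (@Ycont k.+1) (@Ycont k) IH).
Qed.

(** On an interval so short that n M rho is at most 1/2, the integral operator
    halves distances, so its iterates converge geometrically and the limit is the
    fixed point. *)
Lemma picard : exists Y : R -> 'M[R]_(n, m),
  [/\ Y a = C, forall t i j, `|Y t i j| <= 2 * c,
      forall i j, continuous (fun t => Y t i j) &
      forall t, `|a - t| < rho -> forall i j,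
        is_derive t 1 (fun s => Y s i j) ((A t *m Y t) i j)].
Proof.
have lim_ex t i j : exists l, forall k, `|Y k t i j - l| <= c * 2^-1 ^+ k.
  by apply: geometric_limit => k; exact: Ydist.
pose Z t := \matrix_(i < n, j < m) sval (cid (lim_ex t i j)).
have ZY k t i j : `|Y k t i j - Z t i j| <= c * 2^-1 ^+ k.
  by rewrite mxE; case: cid.
have Zc : cont Z.
  move=> i j t; apply/cvgrPdist_le => /= e e0.
  have [k hk] := half_expn_small (2 * c) e0.
  have e' : 0 < e - 2 * c * 2^-1 ^+ k by rewrite subr_gt0.
  have /cvgrPdist_le/(_ _ e') := @Ycont k i j t.
  apply: filterS => s hs; have h1 := ZY k t i j; have h2 := ZY k s i j.
  by apply: limit_dist h1 h2 _; rewrite mulrA.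
have Zfix t i j : Z t i j = step Z t i j.
  apply/eqP; rewrite -subr_eq0 -normr_le0; apply/ler_addgt0Pr => e e0; rewrite add0r.
  have [k hk] := half_expn_small c e0.
  have h1 := ZY k.+1 t i j.
  have h2 : `|step (Y k) t i j - step Z t i j| <= c * 2^-1 ^+ k / 2.
    by apply: step_dist => // *; exact: ZY.
  rewrite exprSr mulrA in h1.
  exact: fixpoint_dist h1 h2 (ltW hk).
exists Z; split => //.
- by apply/matrixP => i j; rewrite Zfix mxE primitive_a // addr0.
- move=> t i j; have := ZY 0%N t i j; rewrite expr0 mulr1 /=.
  exact: bound_from_dist.
- move=> t ht i j.
  rewrite (_ : (fun s => Z s i j) = (fun s => C i j +
      primitive a rho (fun s => (A s *m Z s) i j) s)); last first.
    by apply/funext => s; rewrite Zfix mxE.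
  rewrite -[(A t *m Z t) i j]add0r; apply: is_deriveD.
  by apply: primitive_derive => //; exact: continuous_mulmx_entry.
Qed.

End Picard.

(** On an interval so short that n M rho is at most 1/2, a bound on D improves by
    half its excess over 2 (d + e rho); starting from the a priori bound [K] and
    iterating gives a Gronwall inequality without exponentials. *)
Lemma short_gronwall a rho M d e K (A : R -> 'M[R]_n) (D S : R -> 'M[R]_(n, m)) :
  0 < rho -> 0 <= M -> n%:R * M * rho <= 2^-1 ->
  (forall t, `|a - t| < rho -> forall i j, `|A t i j| <= M) ->
  (forall t, `|a - t| < rho -> forall i j,
     is_derive t 1 (fun s => D s i j) ((A t *m D t + S t) i j)) ->
  (forall t, `|a - t| < rho -> forall i j, `|S t i j| <= e) ->
  (forall t, `|a - t| < rho -> forall i j, `|D t i j| <= K) ->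
  (forall i j, `|D a i j| <= d) ->
  forall t, `|a - t| < rho -> forall i j, `|D t i j| <= 2 * (d + e * rho).
Proof.
move=> rho0 M0 small AM D' Se DK Dd t ht i j.
have aa : `|a - a| < rho by rewrite subrr normr0.
have d0 : 0 <= d by apply: le_trans (Dd i j); exact: normr_ge0.
have e0 : 0 <= e by apply: le_trans (Se a aa i j); exact: normr_ge0.
have K0 : 0 <= K by apply: le_trans (DK a aa i j); exact: normr_ge0.
have iter_bound k : forall t, `|a - t| < rho -> forall i j,
    `|D t i j| <= 2 * (d + e * rho) + K * 2^-1 ^+ k.
  elim: k => [|k IH] s hs i' j'.
    rewrite expr0 mulr1 (le_trans (DK s hs i' j')) // lerDr.
    by rewrite mulr_ge0 // addr_ge0 // mulr_ge0 // ltW.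
  set B := 2 * (d + e * rho) + K * 2^-1 ^+ k in IH.
  have B0 : 0 <= B by apply: le_trans (IH a aa i' j'); exact: normr_ge0.
  have h : `|D s i' j' - D a i' j'| <= (n%:R * M * B + e) * `|s - a|.
    apply: (@lipschitz_between R (fun x => D x i' j')
      (fun x => (A x *m D x + S x) i' j')) => x xI.
    have hx := between_ball aa hs xI.
    split; first exact: D'.
    rewrite mxE (le_trans (ler_normD _ _)) // lerD ?Se //.
    by apply: mulmx_entry_le; [exact: AM|exact: IH].
  rewrite exprSr mulrA; apply: gronwall_step (Dd i' j') h => //.
  - by rewrite distrC ltW.
  - by rewrite mulr_ge0.
apply/ler_addgt0Pr => z z0; have [k hk] := half_expn_small K z0.
by rewrite (le_trans (iter_bound k t ht i j)) // lerD2l ltW.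
Qed.

End LinearODE.

(** * Local solutions of integrable linear systems *)
Section DerivativeEpsilon.
Context {R : realType}.
Implicit Types (f : R -> R) (x d : R).

Lemma is_derive_epsilon f x d :
  is_derive x 1 f d <-> forall e, 0 < e -> exists2 del, 0 < del &
    forall h, `|h| < del -> `|f (x + h) - f x - h * d| <= e * `|h|.
Proof.
have key (h : R) : h != 0 ->
    `|d - h^-1 *: ((f \o shift x) (h *: 1) - f x)| = `|h|^-1 * `|f (x + h) - f x - h * d|.
  move=> h0; rewrite -normfV -normrM distrC /= [h *: 1]mulr1 [h + x]addrC mulrBr mulrA mulVf //.
  by rewrite mul1r.
split=> [[fd fE] e e0|H].
  have : h^-1 *: ((f \o shift x) (h *: 1) - f x) @[h --> 0^'] --> d.
    by rewrite -fE; exact: fd.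
  move=> /cvgrPdist_le/(_ _ e0)/nbhs_ballP[del /= del0 B].
  exists del => // h hdel; have [->|h0] := eqVneq h 0.
    by rewrite addr0 subrr mul0r subrr normr0 mulr0.
  have /B/(_ h0) : ball (0 : R) del h by rewrite -ball_normE /= sub0r normrN.
  by rewrite /= key // ler_pdivrMl ?normr_gt0 // [e * _]mulrC.
have L : h^-1 *: ((f \o shift x) (h *: 1) - f x) @[h --> 0^'] --> d.
  apply/cvgrPdist_le => /= e e0; have [del del0 B] := H e e0.
  suff : nbhs 0 [set h : R | h != 0 -> `|d - h^-1 *: ((f \o shift x) (h *: 1) - f x)| <= e] by [].
  apply/nbhs_ballP; exists del => // h; rewrite -ball_normE /= sub0r normrN => hdel h0.
  by rewrite key // ler_pdivrMl ?normr_gt0 // [_ * e]mulrC; exact: B.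
by apply: DeriveDef; [apply/cvg_ex; exists d|exact: cvg_lim L].
Qed.

Lemma taylor1 (f df ddf : R -> R) (a b K : R) :
  (forall t, Num.min a b <= t <= Num.max a b -> is_derive t 1 f (df t)) ->
  (forall t, Num.min a b <= t <= Num.max a b -> is_derive t 1 df (ddf t)) ->
  (forall t, Num.min a b <= t <= Num.max a b -> `|ddf t| <= K) ->
  `|f b - f a - (b - a) * df a| <= K * `|b - a| * `|b - a|.
Proof.
move=> f' df' K'; have [c cab ->] := mvt_between f'.
rewrite mulrC -mulrBr normrM mulrC; apply: ler_wpM2r => //.
have sub t : Num.min a c <= t <= Num.max a c -> Num.min a b <= t <= Num.max a b.
  move: cab; case: (leP a b) => ab; case: (leP a c) => ac /andP[h1 h2] /andP[h3 h4];
  by apply/andP; split; lra.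
apply: (@le_trans _ _ (K * `|c - a|)).
  by apply: (@lipschitz_between _ df ddf) => t /sub ht; split; [exact: df'|exact: K'].
have K0 : 0 <= K.
  by apply: le_trans (K' a _); [exact: normr_ge0|rewrite ge_min le_max !lexx].
apply: ler_wpM2l => //; move: cab.
by case: (leP a b) => ab /andP[h1 h2]; [rewrite !ger0_norm|rewrite !ler0_norm]; lra.
Qed.

End DerivativeEpsilon.

Section MatrixDerivatives.
Context {R : realType}.
Variables (V : normedModType R) (n m k : nat).

Lemma is_derive_mulmx (A : V -> 'M[R]_(n, m)) (B : V -> 'M[R]_(m, k)) x v dA dB :
  is_derive x v A dA -> is_derive x v B dB ->
  is_derive x v (fun y => A y *m B y) (dA *m B x + A x *m dB).
Proof.
move=> /is_derive_mx dA' /is_derive_mx dB'; apply/is_derive_mx => i j.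
rewrite (_ : (fun y => _) = (\sum_(l < m) (fun y => A y i l * B y l j))); last first.
  by apply/funext => y; rewrite mxE fct_sumE.
have := @is_derive_sum R V R m (fun l y => A y i l * B y l j) x v
  (fun l => A x i l * dB l j + B x l j * dA i l)
  (fun l => is_deriveM (dA' i l) (dB' l j)).
move=> /is_derive_eq; apply; rewrite !mxE -big_split /=; apply: eq_bigr => l _.
by rewrite addrC [B x l j * _]mulrC.
Qed.

Lemma is_derive_scalemx (A : V -> 'M[R]_(n, m)) x v dA (c : R) :
  is_derive x v A dA -> is_derive x v (fun y => c *: A y) (c *: dA).
Proof. exact: is_deriveZ. Qed.

End MatrixDerivatives.

Section LocalBounds.
Context {R : realType}.
Variable O : set (R * R).
Hypothesis oO : open O.

Lemma locally_bounded m k (G : R * R -> 'M[R]_(m, k)) p : smooth O G -> O p ->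
  exists r K, [/\ 0 < r, 0 <= K, ball p r `<=` O &
    forall q, ball p r q -> forall i j, `|G q i j| <= K].
Proof.
move=> sG Op; have [r1 r10 B1] := open_square oO Op.
have /cvgrPdist_le/(_ _ ltr01)/nbhs_ballP[r2 /= r20 B2] := smooth_continuous sG Op.
exists (Num.min r1 r2), (`|G p| + 1); split.
- by rewrite lt_min r10 r20.
- by rewrite addr_ge0.
- by move=> q hq; apply: B1; apply: square_le hq; rewrite ge_min lexx.
move=> q hq i j; have {}hq : ball p r2 q.
  by apply: square_le hq; rewrite ge_min lexx orbT.
apply: (@le_trans _ _ `|G q|).
  by rewrite {2}/Num.Def.normr /= mx_normrE; exact: (le_bigmax _ _ (i, j)).
rewrite -[G q](subrK (G p)) addrC (le_trans (ler_normD _ _)) // lerD2l.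
by rewrite distrC; exact: B2.
Qed.

End LocalBounds.

(** Algebraic core of the Frobenius theorem: by integrability, the defect
    Y(u + h, t) - Y(u, t) - h C Y(u, t), with C the connection along u, solves in t
    the equation of Y itself up to a source of order h^2. *)
Lemma frobenius_defect n (R : realType) (A A' dA C Y Y' dC : 'M[R]_n) (h : R) :
  dC + C *m A = dA + A *m C ->
  A' *m Y' - (A *m Y) - h *: (dC *m Y + C *m (A *m Y)) =
  A' *m (Y' - Y - h *: (C *m Y)) +
  (((A' - A) - h *: dA) + h *: ((A' - A) *m C)) *m Y.
Proof.
move=> eq.
have -> : dC = dA + A *m C - C *m A by rewrite -eq addrK.
rewrite !(mulmxDl, mulmxDr, mulNmx, mulmxN) -?scalemxAl -?scalemxAr.
rewrite !(mulmxDl, mulmxDr, mulNmx, mulmxN, scalerDr, scalerN, mulmxA) -?scalemxAl -?scalemxAr.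
apply/matrixP => i j; rewrite !mxE; ring.
Qed.

Lemma continuous_pairing (T U V : topologicalType) (f : T -> U) (g : T -> V) :
  continuous f -> continuous g -> continuous (fun x => (f x, g x)).
Proof.
move=> fc gc x; apply: (@cvg_pair _ _ _ _ (nbhs (f x)) (nbhs (g x))); [exact: fc|exact: gc].
Qed.

Lemma frobenius_epsilon (R : realType) (e K h rho : R) : 0 < e -> 0 <= K * rho -> 0 <= h ->
  h < e / (4 * (K * rho + 1)) -> 2 * (e / 4 * h + K * h * h * rho) <= e * h.
Proof.
move=> e0 Kr0 h0; rewrite ltr_pdivlMr; last lra.
move=> hh; have -> : 2 * (e / 4 * h + K * h * h * rho) = (e / 2 + 2 * (K * rho * h)) * h by field.
apply: ler_wpM2r => //; nra.
Qed.

Section FrobeniusLocal.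
Context {R : realType}.
Variables (O : set (R * R)) (n : nat).
Hypothesis oO : open O.
Variables (Om1 Om2 : R * R -> 'M[R]_n).
Hypotheses (s1 : smooth O Om1) (s2 : smooth O Om2).
Hypothesis integrable : forall p, O p ->
  dv Om1 p + Om1 p *m Om2 p = du Om2 p + Om2 p *m Om1 p.

(** The solution is built along the horizontal line through [p0] and then along
    every vertical line.  It satisfies the vertical equation by construction; for
    the horizontal one, the defect of [frobenius_defect] is o(h) on the
    horizontal line, and [short_gronwall] propagates this bound vertically. *)
Lemma frobenius_local p0 : O p0 -> exists rho (Y : R * R -> 'M[R]_n),
  [/\ 0 < rho, ball p0 rho `<=` O, Y p0 = 1%:M,
   forall p, ball p0 rho p -> forall i j, `|Y p i j| <= 4 &
   forall p, ball p0 rho p ->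
     is_derive p (1, 0) Y (Om1 p *m Y p) /\ is_derive p (0, 1) Y (Om2 p *m Y p)].
Proof.
move=> Op0.
have sdu := @smooth_pd _ _ _ _ 0 s2; have sduu := @smooth_pd _ _ _ _ 0 sdu.
have [r1 [M1 [r10 M10 B1 b1]]] := locally_bounded oO s1 Op0.
have [r2 [M2 [r20 M20 _ b2]]] := locally_bounded oO s2 Op0.
have [r3 [M3 [r30 M30 _ b3]]] := locally_bounded oO sdu Op0.
have [r4 [M4 [r40 M40 _ b4]]] := locally_bounded oO sduu Op0.
pose M := M1 + M2 + M3 + M4.
have M0 : 0 <= M by rewrite !addr_ge0.
pose r := Num.min (Num.min r1 r2) (Num.min r3 r4).
have r0 : 0 < r by rewrite !lt_min r10 r20 r30 r40.
have bO p : ball p0 r p -> O p.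
  by move=> hp; apply: B1; apply: square_le hp; rewrite /r !ge_min lexx.
have bM1 p i j : ball p0 r p -> `|Om1 p i j| <= M.
  move=> hp; apply: le_trans (b1 p _ i j) _; last by rewrite /M; lra.
  by apply: square_le hp; rewrite /r !ge_min lexx.
have bM2 p i j : ball p0 r p -> `|Om2 p i j| <= M.
  move=> hp; apply: le_trans (b2 p _ i j) _; last by rewrite /M; lra.
  by apply: square_le hp; rewrite /r !ge_min lexx orbT.
have bM3 p i j : ball p0 r p -> `|du Om2 p i j| <= M.
  move=> hp; apply: le_trans (b3 p _ i j) _; last by rewrite /M; lra.
  by apply: square_le hp; rewrite /r !ge_min lexx !orbT.
have bM4 p i j : ball p0 r p -> `|du (du Om2) p i j| <= M.
  move=> hp; apply: le_trans (b4 p _ i j) _; last by rewrite /M; lra.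
  by apply: square_le hp; rewrite /r !ge_min lexx !orbT.
clearbody M r; clear b1 b2 b3 b4 B1.
pose rho := Num.min (r / 2) (2 * (n%:R * M + 1))^-1.
have nM0 : 0 <= n%:R * M by rewrite mulr_ge0.
have rho0 : 0 < rho by rewrite lt_min divr_gt0 //= invr_gt0; lra.
have rhor : rho < r by apply: (@le_lt_trans _ _ (r / 2)); [rewrite ge_min lexx|lra].
have small : n%:R * M * rho <= 2^-1.
  apply: (@le_trans _ _ ((n%:R * M + 1) * rho)); first by rewrite ler_wpM2r //; lra.
  have h : rho <= (2 * (n%:R * M + 1))^-1 by rewrite ge_min lexx orbT.
  rewrite -ler_pdivlMl; last lra.
  by rewrite -invfM mulrC.
clearbody rho.
case: p0 Op0 bO bM1 bM2 bM3 bM4 => a b Op0 bO bM1 bM2 bM3 bM4.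
have aa : `|a - a| < r by rewrite subrr normr0.
have bb : `|b - b| < r by rewrite subrr normr0.
have bb' : `|b - b| < rho by rewrite subrr normr0.
have clr c t : `|c - clamp c rho t| < r by apply: le_lt_trans rhor; exact: clamp_itv.
have ltr (t c : R) : `|c - t| < rho -> `|c - t| < r by move=> h; exact: lt_trans rhor.
have one_le (i j : 'I_n) : `|(1%:M : 'M[R]_n) i j| <= 1.
  by rewrite mxE; case: (i == j); rewrite ?normr1 ?normr0.
have cOm (G : R * R -> 'M[R]_n) (c : R -> R * R) i j : smooth O G -> continuous c ->
    (forall t, O (c t)) -> continuous (fun t => G (c t) i j).
  move=> sG cc cO t; apply: (@continuous_comp _ _ _ c (fun p => G p i j)); first exact: cc.
  by have := smooth_continuous sG (cO t) => /continuous_mx; apply.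
have cu : continuous (fun s : R => (clamp a rho s, b)).
  by apply: (@continuous_pairing R R R (clamp a rho) (fun=> b)); [exact: continuous_clamp|move=> s; exact: cvg_cst].
have cv (u : R) : continuous (fun t : R => (u, clamp b rho t)).
  by apply: (@continuous_pairing R R R (fun=> u) (clamp b rho)); [move=> s; exact: cvg_cst|exact: continuous_clamp].
have Ou s : O (clamp a rho s, b) by apply: bO; split; [exact: clr|exact: bb].
have [y [ya y2 _ y']] := @picard R n n a rho M 1 (fun s => Om1 (clamp a rho s, b)) 1%:M
  rho0 ler01 (fun i j => cOm Om1 _ i j s1 cu Ou)
  (fun s i j => bM1 (clamp a rho s, b) i j (conj (clr a s) bb)) small one_le.
rewrite mulr1 in y2.
have ex_Y (u : R) : exists Yu : R -> 'M[R]_n, `|a - u| < rho ->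
   [/\ Yu b = y u, forall t i j, `|Yu t i j| <= 2 * 2 &
      forall t, `|b - t| < rho -> forall i j,
        is_derive t 1 (fun s => Yu s i j) ((Om2 (u, t) *m Yu t) i j)].
  have [hu|] := boolP (`|a - u| < rho); last by exists (fun=> 1%:M).
  have hur := ltr _ _ hu.
  have Ov t : O (u, clamp b rho t) by apply: bO; split; [exact: hur|exact: clr].
  have [Yu [Yb Y2 _ Y']] := @picard R n n b rho M 2 (fun t => Om2 (u, clamp b rho t)) (y u)
    rho0 (ler0n R 2) (fun i j => cOm Om2 _ i j s2 (cv u) Ov)
    (fun t i j => bM2 (u, clamp b rho t) i j (conj hur (clr b t))) small (y2 u).
  exists Yu => _; split => // t ht i j.
  by have := Y' t ht i j; rewrite clamp_id // ltW.
have [Yf HY] := choice ex_Y.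
pose Y (p : R * R) := Yf p.1 p.2.
have Y4 u t i j : `|a - u| < rho -> `|Y (u, t) i j| <= 4.
  by move=> /HY[_ + _] => /(_ t i j); rewrite /Y /= -natrM.
have Yv u t : `|a - u| < rho -> `|b - t| < rho ->
    is_derive t 1 (fun s => Y (u, s)) (Om2 (u, t) *m Y (u, t)).
  by move=> hu ht; have [_ _ H] := HY u hu; apply/is_derive_mx => i j; exact: H.
have om1v u t : ball (a, b) r (u, t) ->
    is_derive t 1 (fun s => Om1 (u, s)) (dv Om1 (u, t)).
  by move=> /bO /(smooth_is_derive 1 s1) /is_derive_v.
have om2u u t i j : ball (a, b) r (u, t) ->
    is_derive u 1 (fun s => Om2 (s, t) i j) (du Om2 (u, t) i j).
  by move=> /bO /(smooth_is_derive 0 s2) /is_derive_u /is_derive_mx.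
have om2uu u t i j : ball (a, b) r (u, t) ->
    is_derive u 1 (fun s => du Om2 (s, t) i j) (du (du Om2) (u, t) i j).
  by move=> /bO /(smooth_is_derive 0 sdu) /is_derive_u /is_derive_mx.
exists rho, Y; split => //.
- by move=> p hp; apply: bO; apply: square_le hp; exact: ltW.
- by rewrite /Y /=; have [] := HY a _; rewrite ?subrr ?normr0 // ya.
- by move=> [u v] [/= hu hv] i j; exact: Y4.
move=> [u v] [/= hu hv]; split; last first.
  by apply/is_derive_v => /=; exact: Yv.
apply/is_derive_u => /=; apply/is_derive_mx => i j; apply/is_derive_epsilon => e e0.
(* the defect of the horizontal equation *)
pose D h t := Y (u + h, t) - Y (u, t) - h *: (Om1 (u, t) *m Y (u, t)).
pose K := n%:R * (M + n%:R * M * M) * 4.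
have K0 : 0 <= K by rewrite !mulr_ge0 // addr_ge0 // !mulr_ge0.
have e4 : 0 < e / 4 by rewrite divr_gt0.
have [d2 d20 hd2] : exists2 d2, 0 < d2 & forall h, `|h| < d2 -> `|a - (u + h)| < rho.
  exists (rho - `|a - u|); first by rewrite subr_gt0.
  move=> h hh; rewrite opprD addrA; apply: le_lt_trans (ler_normB _ _) _.
  by rewrite -ltrBrDl.
have [d1 d10 yd] : exists2 d1, 0 < d1 & forall h, `|h| < d1 -> forall i j,
    `|D h b i j| <= e / 4 * `|h|.
  have : \forall h \near (0 : R), forall i j, `|h| < d2 -> `|D h b i j| <= e / 4 * `|h|.
    apply: (@filter_forall _ 'I_n (fun k h => forall l, `|h| < d2 -> `|D h b k l| <= e / 4 * `|h|) (nbhs (0 : R))) => k.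
    apply: (@filter_forall _ 'I_n (fun l h => `|h| < d2 -> `|D h b k l| <= e / 4 * `|h|) (nbhs (0 : R))) => l.
    have := y' u hu k l; rewrite clamp_id ?(ltW hu) // => /is_derive_epsilon/(_ _ e4)[d d0 yd].
    suff : nbhs (0 : R) [set h | `|h| < d2 -> `|D h b k l| <= e / 4 * `|h|] by [].
    apply/nbhs_ballP; exists d => // h; rewrite -ball_normE /= sub0r normrN => /yd + hh.
    have [E1 _ _] := HY u hu; have [E2 _ _] := HY (u + h) (hd2 h hh).
    by rewrite /D /Y /= E1 E2 !mxE.
  move=> /nbhs_ballP[d /= d0 yd]; exists (Num.min d d2); first by rewrite lt_min d0.
  move=> h; rewrite lt_min => /andP[h1 h2] k l; apply: yd => //.
  by rewrite -ball_normE /= sub0r normrN.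
pose d3 := e / (4 * (K * rho + 1)).
have Kr0 : 0 <= K * rho by rewrite mulr_ge0 // ltW.
have d30 : 0 < d3 by rewrite divr_gt0 //; lra.
exists (Num.min d1 (Num.min d2 d3)); first by rewrite !lt_min d10 d20 d30.
move=> h; rewrite !lt_min => /and3P[h1 h2 h3].
have hu' := hd2 h h2.
have Dbound : `|D h v i j| <= 2 * (e / 4 * `|h| + K * `|h| * `|h| * rho).
  have sq t : `|b - t| < rho -> ball (a, b) r (u, t) /\ ball (a, b) r (u + h, t).
    by move=> /ltr ht; split; split => //=; exact: ltr.
  have uh : u + h - u = h by rewrite addrAC subrr add0r.
  pose dA t := (Om2 (u + h, t) - Om2 (u, t)).
  pose S t := ((dA t - h *: du Om2 (u, t)) + h *: (dA t *m Om1 (u, t))) *m Y (u, t).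
  have sq_u t s : `|b - t| < rho -> Num.min u (u + h) <= s <= Num.max u (u + h) ->
      ball (a, b) r (s, t).
    by move=> /ltr ht hs; split => //=; exact: between_ball (ltr _ _ hu) (ltr _ _ hu') hs.
  apply: (@short_gronwall R n n b rho M (e / 4 * `|h|) (K * `|h| * `|h|)
    (4 + 4 + `|h| * (n%:R * M * 4)) (fun t => Om2 (u + h, t)) (D h) S) => //.
  - by move=> t /sq[_ ht] k l; exact: bM2.
  - move=> t ht; have [h4 h5] := sq t ht; apply/is_derive_mx.
    rewrite -(frobenius_defect _ _ _ _ (integrable (bO _ h4))).
    apply: is_deriveB; first by apply: is_deriveB; exact: Yv.
    apply: is_derive_scalemx; apply: is_derive_mulmx; [exact: om1v|exact: Yv].
  - move=> t ht k l; have [h4 h5] := sq t ht.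
    have e2 k' l' : `|(dA t - h *: du Om2 (u, t)) k' l'| <= M * `|h| * `|h|.
      have := @taylor1 R (fun s => Om2 (s, t) k' l') (fun s => du Om2 (s, t) k' l')
        (fun s => du (du Om2) (s, t) k' l') u (u + h) M
        (fun s hs => om2u s t k' l' (sq_u t s ht hs))
        (fun s hs => om2uu s t k' l' (sq_u t s ht hs))
        (fun s hs => bM4 (s, t) k' l' (sq_u t s ht hs)).
      by rewrite uh /dA !mxE.
    have e1 k' l' : `|dA t k' l'| <= M * `|h|.
      have := @lipschitz_between R (fun s => Om2 (s, t) k' l') (fun s => du Om2 (s, t) k' l')
        u (u + h) M (fun s hs => conj (om2u s t k' l' (sq_u t s ht hs))
                                     (bM3 (s, t) k' l' (sq_u t s ht hs))).
      by rewrite uh /dA !mxE.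
    have e3 k' l' : `|(dA t *m Om1 (u, t)) k' l'| <= n%:R * (M * `|h|) * M.
      by apply: mulmx_entry_le => // *; exact: bM1.
    have -> : K * `|h| * `|h| = n%:R * ((M + n%:R * M * M) * `|h| * `|h|) * 4.
      by rewrite /K; ring.
    apply: mulmx_entry_le => k' l'; last exact: Y4.
    rewrite mxE (le_trans (ler_normD _ _)) //.
    rewrite (_ : (M + _) * _ * _ = M * `|h| * `|h| + `|h| * (n%:R * (M * `|h|) * M)); last by ring.
    by rewrite lerD ?e2 // mxE normrM ler_wpM2l.
  - move=> t ht k l; have [h4 h5] := sq t ht.
    have -> : D h t k l = Y (u + h, t) k l - Y (u, t) k l - h * (Om1 (u, t) *m Y (u, t)) k l.
      by rewrite /D !mxE.
    apply: le_trans (ler_normB _ _) _; apply: lerD.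
      by apply: le_trans (ler_normB _ _) _; apply: lerD; exact: Y4.
    rewrite normrM ler_wpM2l //.
    by apply: mulmx_entry_le => *; [exact: bM1|exact: Y4].
  - exact: yd.
rewrite (_ : Y (u + h, v) i j - _ - _ = D h v i j); last by rewrite /D !mxE.
by apply: le_trans Dbound _; exact: frobenius_epsilon.
Qed.
End FrobeniusLocal.

(** * Monodromy *)
Section Subdivision.
Context {R : realType}.

Lemma near_small (del : R) : 0 < del -> \forall N \near \oo, (N.+1%:R)^-1 < del :> R.
Proof.
move=> d0; have /cvgrPdist_lt/(_ _ d0) := @cvg_harmonic R.
apply: filterS => N; rewrite sub0r normrN ger0_norm ?invr_ge0 //.
Qed.

(** Compactness makes the radius uniform; the form 1 / (N + 1) suits subdivisions
    into equal parts. *)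
Lemma lebesgue_number (T : normedModType R) (K : set T) (S : topologicalType)
    (f : T -> S) (U : set S -> Prop) :
  compact K -> {within K, continuous f} ->
  (forall x, K x -> exists2 B, U B & nbhs (f x) B) ->
  exists N : nat, forall x, K x -> exists2 B, U B &
    forall y, K y -> `|x - y| <= (N.+1%:R)^-1 -> B (f y).
Proof.
move=> /compact_near_coveringP cK fc fU.
have H : forall x, K x -> \forall x' \near x & N \near \oo,
    exists2 B, U B & forall y, K y -> `|x' - y| <= (N.+1%:R)^-1 -> B (f y).
  move=> x Kx; have [B UB fB] := fU x Kx.
  have /subspace_continuousP/(_ x Kx)/(_ B fB) := fc.
  move=> /nbhs_ballP[del /= del0 hB].
  have d2 : 0 < del / 2 by rewrite divr_gt0.
  have n1 : \forall x' \near x, `|x - x'| < del / 2.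
    suff : nbhs x [set x' | `|x - x'| < del / 2] by [].
    by apply/nbhs_ballP; exists (del / 2) => // z; rewrite -ball_normE.
  near=> x' N.
  have hx' : `|x - x'| < del / 2 by near: x'.
  have hN : (N.+1%:R)^-1 < del / 2 by near: N; exact: near_small.
  exists B => // y Ky hy; apply: hB => //.
  rewrite -ball_normE /=.
  rewrite -(subrKA x') (le_lt_trans (ler_normD _ _)) // [ltRHS]splitr ltrD //.
  exact: le_lt_trans hy hN.
have [N _ /(_ N (leqnn N)) HN] := cK nat \oo
  (fun N x => exists2 B, U B & forall y, K y -> `|x - y| <= (N.+1%:R)^-1 -> B (f y)) _ H.
by exists N => x Kx; exact: HN.
Unshelve. all: by end_near. Qed.

Lemma frac_itv (N k : nat) : (0 < N)%N -> (k <= N)%N -> 0 <= (k%:R / N%:R : R) <= 1.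
Proof.
move=> N0 kN; rewrite divr_ge0 //= ler_pdivrMr ?ltr0n // mul1r ler_nat //.
Qed.

Lemma frac_refine (N M k : nat) : (0 < M)%N -> (k * M)%:R / (N * M)%:R = k%:R / N%:R :> R.
Proof.
by move=> M0; rewrite !natrM -mulf_div divff ?mulr1 // pnatr_eq0 -lt0n.
Qed.

Lemma frac_refine_itv (N M k j : nat) : (0 < N)%N -> (0 < M)%N -> (j <= M)%N ->
  k%:R / N%:R <= ((k * M + j)%:R / (N * M)%:R : R) <= k.+1%:R / N%:R.
Proof.
move=> N0 M0 jM; rewrite -(frac_refine N k M0) -(frac_refine N k.+1 M0).
have p : 0 < (N * M)%:R :> R by rewrite ltr0n muln_gt0 N0.
by rewrite !ler_pM2r ?invr_gt0 // !ler_nat leq_addr mulSn [(M + _)%N]addnC leq_add2l.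
Qed.

End Subdivision.

Section Monodromy.
Context {R : realType}.
Variables (O : set (R * R)) (n : nat).
Hypothesis oO : open O.
Variable good : set (R * R) -> Prop.
Variable P : R * R -> R * R -> 'M[R]_n.
Hypothesis good_cover : forall x, O x -> exists2 r, 0 < r & good (ball x r) /\ ball x r `<=` O.
Hypothesis good_convex : forall B x y t, good B -> B x -> B y -> 0 <= t <= 1 ->
  B (x + t *: (y - x)).
Hypothesis good_sub : forall B, good B -> B `<=` O.
Hypothesis P_cocycle : forall B x y z, good B -> B x -> B y -> B z ->
  P y z *m P x y = P x z.
Hypothesis P_id : forall x, O x -> P x x = 1%:M.

(** The local transport [P] is only meaningful between points of one good set, so
    paths are cut into pieces that stay in good sets. *)
Definition good_path N (c : R -> R * R) := forall i, (i < N)%N ->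
  exists2 B, good B & forall t, i%:R / N%:R <= t <= i.+1%:R / N%:R -> B (c t).

Fixpoint transport (c : R -> R * R) N k : 'M[R]_n :=
  if k is k'.+1 then
    P (c (k'%:R / N%:R)) (c (k'.+1%:R / N%:R)) *m transport c N k'
  else 1%:M.

Lemma transport_eq c c' N N' k :
  (forall i, (i <= k)%N -> c (i%:R / N%:R) = c' (i%:R / N'%:R)) ->
  transport c N k = transport c' N' k.
Proof.
elim: k => //= k IH E; rewrite IH; last by move=> i ik; apply: E; exact: leqW.
by rewrite !E.
Qed.

Lemma good_path_step N c i : (0 < N)%N -> good_path N c -> (i < N)%N ->
  exists2 B, good B & B (c (i%:R / N%:R)) /\ B (c (i.+1%:R / N%:R)).
Proof.
move=> N0 gN iN; have [B gB BB] := gN i iN; exists B => //.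
by split; apply: BB; rewrite ?lexx ?andbT ?andTb ler_pM2r ?invr_gt0 ?ltr0n ?ler_nat.
Qed.

Lemma transport_refine N M c k : (0 < N)%N -> (0 < M)%N -> good_path N c -> (k <= N)%N ->
  transport c (N * M) (k * M) = transport c N k.
Proof.
move=> N0 M0 gN; elim: k => [|k IH] kN; first by rewrite mul0n.
have [B gB BB] := gN k kN.
have inB j : (j <= M)%N -> B (c ((k * M + j)%:R / (N * M)%:R)).
  by move=> jM; apply: BB; exact: frac_refine_itv.
have Bk : B (c (k%:R / N%:R)) by have := inB 0%N (leq0n _); rewrite addn0 frac_refine.
have part j : (j <= M)%N -> transport c (N * M) (k * M + j) =
    P (c (k%:R / N%:R)) (c ((k * M + j)%:R / (N * M)%:R)) *m transport c N k.
  elim: j => [|j IHj] jM.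
    by rewrite addn0 IH 1?ltnW // frac_refine // P_id ?mul1mx //; exact: good_sub Bk.
  rewrite addnS /= IHj 1?ltnW // mulmxA -addnS.
  by rewrite (P_cocycle gB) //; apply: inB => //; exact: ltnW.
by rewrite mulSn addnC part //= -mulSnr frac_refine.
Qed.

Lemma good_path_refine N M c : (0 < N)%N -> (0 < M)%N -> good_path N c ->
  good_path (N * M) c.
Proof.
move=> N0 M0 gN i iNM; have kN : (i %/ M < N)%N by rewrite ltn_divLR.
have [B gB BB] := gN _ kN; exists B => // t /andP[t1 t2]; apply: BB.
have h j : (j <= M)%N -> (i %/ M)%:R / N%:R <= (((i %/ M) * M + j)%:R / (N * M)%:R : R)
    <= ((i %/ M).+1)%:R / N%:R by move=> jM; exact: frac_refine_itv.
have /andP[h1 _] := h (i %% M)%N (ltnW (ltn_pmod i M0)).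
have /andP[_ h2] := h (i %% M).+1 (ltn_pmod i M0).
rewrite -divn_eq in h1; rewrite addnS -divn_eq in h2.
by rewrite (le_trans h1 t1) (le_trans t2 h2).
Qed.

(** Each cell of the grid lies in a good set, where the cocycle relation lets the
    transport along its lower and right sides be traded for the transport along
    its left and upper sides; the sides s = 0 and s = 1 are linked row by row. *)
Lemma transport_homotopy (H : R * R -> R * R) N : (0 < N)%N ->
  (forall i j, (i < N)%N -> (j < N)%N -> exists2 B, good B &
     forall s t, i%:R / N%:R <= s <= i.+1%:R / N%:R ->
       j%:R / N%:R <= t <= j.+1%:R / N%:R -> B (H (s, t))) ->
  (forall s, 0 <= s <= 1 -> H (s, 0) = H (0, 0)) ->
  (forall s, 0 <= s <= 1 -> H (s, 1) = H (0, 1)) ->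
  transport (fun t => H (0, t)) N N = transport (fun t => H (1, t)) N N.
Proof.
move=> N0 HB H0 H1.
have N0' : 0 < N%:R :> R by rewrite ltr0n.
have le1 (i : nat) : i%:R / N%:R <= i.+1%:R / N%:R :> R.
  by rewrite ler_pM2r ?invr_gt0 // ler_nat.
have HO i : (i < N)%N -> O (H (0, 0)).
  move=> iN; have [B gB BB] := HB 0%N 0%N N0 N0; apply: (good_sub gB).
  by apply: BB; rewrite mul0r lexx /= divr_ge0.
have HO1 : O (H (0, 1)).
  have p : (N.-1 < N)%N by rewrite prednK.
  have [B gB BB] := HB 0%N N.-1 N0 p; apply: (good_sub gB).
  have e1 : N.-1.+1%:R / N%:R = 1 :> R by rewrite prednK // divff // gt_eqF.
  apply: BB; first by rewrite mul0r lexx divr_ge0.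
  by rewrite e1 lexx andbT -[leRHS]e1 le1.
have row i : (i <= N)%N -> transport (fun t => H (0, t)) N N =
    transport (fun t => H (i%:R / N%:R, t)) N N.
  elim: i => [_|i IH iN]; first by rewrite mul0r.
  rewrite IH 1?ltnW //.
  have key k : (k <= N)%N ->
      P (H (i%:R / N%:R, k%:R / N%:R)) (H (i.+1%:R / N%:R, k%:R / N%:R)) *m
        transport (fun t => H (i%:R / N%:R, t)) N k =
      transport (fun t => H (i.+1%:R / N%:R, t)) N k.
    elim: k => [_|k IHk kN] /=.
      by rewrite mulmx1 mul0r !H0 ?P_id ?frac_itv // 1?ltnW //; exact: HO iN.
    rewrite -(IHk (ltnW kN)) !mulmxA; congr (_ *m _).
    have [B gB BB] := HB i k iN kN.
    by rewrite !(P_cocycle gB) //; apply: BB; rewrite ?lexx ?le1.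
  have := key N (leqnn N); rewrite divff ?gt_eqF // !H1 ?frac_itv // 1?ltnW //.
  by rewrite P_id // mul1mx.
by rewrite (row N) // divff // gt_eqF.
Qed.

Lemma transport_const x N k : O x -> transport (fun=> x) N k = 1%:M.
Proof. by move=> Ox; elim: k => //= k ->; rewrite P_id // mulmx1. Qed.

Lemma loop_transport (c : R -> R * R) : simply_connected O ->
  {within `[0, 1], continuous c} -> (forall t, 0 <= t <= 1 -> O (c t)) -> c 0 = c 1 ->
  exists N, [/\ (0 < N)%N, good_path N c & transport c N N = 1%:M].
Proof.
move=> [_ _ sc] cc cO c01; have [H [Hc HO H0 H1 Hs]] := sc c cc cO c01.
have cK : compact (`[0, 1]%classic `*` `[0, 1]%classic : set (R * R)).
  by apply: compact_setX; exact: segment_compact.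
have mem (s t : R) : 0 <= s <= 1 -> 0 <= t <= 1 ->
    (`[0, 1]%classic `*` `[0, 1]%classic) (s, t).
  by move=> hs ht; split; rewrite /= in_itv.
have cover z : (`[0, 1]%classic `*` `[0, 1]%classic) z -> exists2 B, good B & nbhs (H z) B.
  case: z => s t [/=]; rewrite !in_itv /= => hs ht.
  have [r r0 [gr _]] := good_cover (HO s t hs ht).
  by exists (ball (H (s, t)) r) => //; exact: nbhsx_ballx.
have [N HN] := lebesgue_number cK Hc cover.
have HB i j : (i < N.+1)%N -> (j < N.+1)%N -> exists2 B, good B &
     forall s t, i%:R / N.+1%:R <= s <= i.+1%:R / N.+1%:R ->
       j%:R / N.+1%:R <= t <= j.+1%:R / N.+1%:R -> B (H (s, t)).
  move=> iN jN.
  have fi := @frac_itv R _ _ (ltn0Sn N) (ltnW iN); have fi1 := @frac_itv R _ _ (ltn0Sn N) iN.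
  have fj := @frac_itv R _ _ (ltn0Sn N) (ltnW jN); have fj1 := @frac_itv R _ _ (ltn0Sn N) jN.
  have [B gB BB] := HN (i%:R / N.+1%:R, j%:R / N.+1%:R) (mem _ _ fi fj).
  exists B => // s t hs ht; apply: BB.
    apply: mem; apply/andP; split.
    - by case/andP: fi => a _; case/andP: hs => b _; exact: le_trans a b.
    - by case/andP: fi1 => _ a; case/andP: hs => _ b; exact: le_trans b a.
    - by case/andP: fj => a _; case/andP: ht => b _; exact: le_trans a b.
    - by case/andP: fj1 => _ a; case/andP: ht => _ b; exact: le_trans b a.
  have d (k : nat) (x : R) : k%:R / N.+1%:R <= x <= k.+1%:R / N.+1%:R ->
      `|k%:R / N.+1%:R - x| <= N.+1%:R^-1.
    move=> /andP[h1 h2]; rewrite distrC ger0_norm ?subr_ge0 // lerBlDl.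
    by apply: le_trans h2 _; rewrite -natr1 mulrDl mul1r addrC.
  by rewrite prod_normE ge_max /= !d.
have I0 : 0 <= (0 : R) <= 1 by rewrite lexx ler01.
have I1 : 0 <= (1 : R) <= 1 by rewrite lexx ler01.
have ends s : 0 <= s <= 1 -> H (s, 0) = H (0, 0) /\ H (s, 1) = H (0, 1).
  by move=> /Hs[-> ->]; have [-> ->] := Hs 0 I0.
have tH := transport_homotopy (ltn0Sn N) HB (fun s hs => (ends s hs).1)
  (fun s hs => (ends s hs).2).
have fr i : (i <= N.+1)%N -> 0 <= (i%:R / N.+1%:R : R) <= 1 by exact: frac_itv.
exists N.+1; split => //.
  move=> i iN; have [B gB BB] := HB 0%N i (ltn0Sn N) iN; exists B => // t ht.
  rewrite -H0; first by apply: BB; rewrite // mul0r lexx divr_ge0.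
  case/andP: ht => a b; case/andP: (fr i (ltnW iN)) => a' _; case/andP: (fr i.+1 iN) => _ b'.
  by rewrite (le_trans a' a) (le_trans b b').
rewrite (@transport_eq c (fun t => H (0, t)) N.+1 N.+1); last by move=> i /fr hi; rewrite H0.
rewrite tH (@transport_eq _ (fun=> c 0) N.+1 N.+1); last by move=> i /fr hi; rewrite H1.
by apply: transport_const; exact: cO.
Qed.

Variable p0 : R * R.
Hypothesis Op0 : O p0.
Hypothesis sc : simply_connected O.

(** The path is defined on the whole line, so that concatenations of paths are
    continuous without gluing arguments. *)
Definition continuation p (X : 'M[R]_n) := exists (c : R -> R * R) (N : nat),
  [/\ continuous c, forall t : R, 0 <= t <= 1 -> O (c t), c 0 = p0, c 1 = p &
   [/\ (0 < N)%N, good_path N c & X = transport c N N]].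

Lemma frac_half (N i : nat) : i%:R / (N * 2)%:R = (i%:R / N%:R) / 2 :> R.
Proof. by rewrite natrM invfM mulrA. Qed.

Lemma frac_half2 (N i : nat) : (0 < N)%N ->
  (N + i)%:R / (N * 2)%:R = 2^-1 + (i%:R / N%:R) / 2 :> R.
Proof.
move=> N0; rewrite frac_half natrD mulrDl divff; last by rewrite pnatr_eq0 -lt0n.
by rewrite mulrDl mul1r.
Qed.

Lemma continuous_affine_max (a b : R) : continuous (fun t : R => Num.max (a * t + b) 0).
Proof.
move=> t; apply: (@continuous_max R R (fun t => a * t + b) (cst 0)); last exact: cvg_cst.
apply: cvgD; last exact: cvg_cst.
by apply: cvgM; [exact: cvg_cst|exact: cvg_id].
Qed.

Lemma continuous_affine_min (a b : R) : continuous (fun t : R => Num.min (a * t + b) 1).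
Proof.
move=> t; apply: (@continuous_min R R (fun t => a * t + b) (cst 1)); last exact: cvg_cst.
apply: cvgD; last exact: cvg_cst.
by apply: cvgM; [exact: cvg_cst|exact: cvg_id].
Qed.

(** The loop made of one path and the reverse of the other has trivial transport
    by simple connectedness. *)
Lemma continuation_unique p X Y : continuation p X -> continuation p Y -> X = Y.
Proof.
move=> [c1 [N1 [cc1 cO1 c10 c11 [N10 g1 ->]]]] [c2 [N2 [cc2 cO2 c20 c21 [N20 g2 ->]]]].
(* the loop c1 followed by the reverse of c2 *)
pose c t := c1 (Num.min (2 * t + 0) 1) + c2 (Num.min (- 2 * t + 2) 1) - p.
have cl t : t <= 2^-1 -> c t = c1 (2 * t).
  move=> ht; rewrite /c addr0 min_l; last lra.
  by rewrite min_r; [rewrite c21 addrK|lra].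
have cr t : 2^-1 <= t -> c t = c2 (2 - 2 * t).
  move=> ht; rewrite /c addr0 min_r; last lra.
  rewrite min_l; last lra.
  by rewrite c11 addrC addrA addNr add0r mulNr addrC.
have cc : continuous c.
  move=> t; apply: cvgB; last exact: cvg_cst.
  apply: cvgD.
    by apply: (@continuous_comp _ _ _ (fun t : R => Num.min (2 * t + 0) 1) c1);
      [exact: continuous_affine_min|exact: cc1].
  by apply: (@continuous_comp _ _ _ (fun t : R => Num.min (- 2 * t + 2) 1) c2);
      [exact: continuous_affine_min|exact: cc2].
have cO t : 0 <= t <= 1 -> O (c t).
  move=> /andP[h1 h2]; case: (leP t 2^-1) => h.
    by rewrite cl //; apply: cO1; lra.
  by rewrite cr ?ltW //; apply: cO2; lra.
have c01 : c 0 = c 1.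
  rewrite cl ?invr_ge0 // cr; last by rewrite invf_le1 ?ler1n.
  by rewrite mulr0 mulr1 subrr c10 c20.
have [N [N0 gN tN]] := loop_transport sc (continuous_subspaceT cc) cO c01.
have gN2 := good_path_refine N0 (isT : (0 < 2)%N) gN.
have tN2 : transport c (N * 2) (N * 2) = 1%:M by rewrite transport_refine.
have N20' : (0 < N * 2)%N by rewrite muln_gt0 N0.
have NN : (N * 2 = N + N)%N by rewrite muln2 addnn.
have fr i : (i <= N)%N -> 0 <= (i%:R / N%:R : R) <= 1 by exact: frac_itv.
have first_half i : (i <= N)%N -> c (i%:R / (N * 2)%:R) = c1 (i%:R / N%:R).
  move=> /fr/andP[_ hi]; rewrite frac_half cl; last lra.
  by rewrite mulrC divfK // pnatr_eq0.
have second_half i : (i <= N)%N ->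
    c ((N + i)%:R / (N * 2)%:R) = c2 ((N - i)%:R / N%:R).
  move=> iN; have /andP[hi _] := fr i iN; rewrite frac_half2 // cr; last lra.
  congr c2; rewrite natrB // mulrBl divff; last by rewrite pnatr_eq0 -lt0n.
  by move: (i%:R / N%:R) => x; field.
have gc1 : good_path N c1.
  move=> i iN; have [B gB BB] := gN2 i (leq_trans iN (leq_pmulr _ (isT : (0 < 2)%N))).
  exists B => // t /andP[h1 h2].
  have t1 : t <= 1 by apply: le_trans h2 _; have /andP[] := fr _ iN.
  have -> : c1 t = c (t / 2) by rewrite cl; [rewrite mulrC divfK // pnatr_eq0|lra].
  by apply: BB; rewrite !frac_half; apply/andP; split; lra.
have gc2 : good_path N c2.
  move=> i iN.
  have jN : (N - i.+1 < N)%N by rewrite ltn_subrL N0.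
  have [B gB BB] := gN2 (N + (N - i.+1))%N (ltac:(by rewrite NN ltn_add2l)).
  exists B => // t /andP[h1 h2].
  have t1 : t <= 1 by apply: le_trans h2 _; have /andP[] := fr _ iN.
  have t0 : 0 <= t by apply: le_trans h1; have /andP[] := fr _ (ltnW iN).
  have -> : c2 t = c (1 - t / 2) by rewrite cr; [congr c2; field|lra].
  apply: BB; rewrite -addnS !frac_half2 // -subSn // subSS !natrB // ?(ltnW iN) //.
  rewrite !mulrBl divff; last by rewrite pnatr_eq0 -lt0n.
  by apply/andP; split; lra.
have back j : (j <= N)%N -> transport c (N * 2) (N + (N - j)) = transport c2 N j.
  elim: j => [_|j IH jN]; first by rewrite subn0 -NN tN2.
  have e : (N - j = (N - j.+1).+1)%N by rewrite -subSn.
  have := IH (ltnW jN); rewrite e addnS /= -addnS -e !second_half ?leq_subr // !subKn // 1?ltnW //.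
  move=> <-; rewrite mulmxA.
  have [B gB [B1 B2]] := good_path_step N0 gc2 jN.
  by rewrite (P_cocycle gB) // P_id ?mul1mx //; exact: good_sub B2.
have := back N (leqnn N); rewrite subnn addn0.
rewrite (@transport_eq c c1 (N * 2) N) //.
rewrite -(transport_refine N0 N10 gc1 (leqnn N)) -(transport_refine N0 N20 gc2 (leqnn N)).
by rewrite ![(N * _)%N]mulnC !transport_refine.
Qed.

Lemma continuation_step p q X B : good B -> B p -> B q -> continuation p X ->
  continuation q (P p q *m X).
Proof.
move=> gB Bp Bq [c [N [cc cO c0 c1 [N0 gN ->]]]].
pose c' t := c (Num.min (2 * t + 0) 1) + Num.max (2 * t + - 1) 0 *: (q - p).
have cl t : t <= 2^-1 -> c' t = c (2 * t).
  move=> ht; rewrite /c' addr0 min_l; last lra.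
  by rewrite max_r; [rewrite scale0r addr0|lra].
have cr t : 2^-1 <= t -> c' t = p + (2 * t - 1) *: (q - p).
  move=> ht; rewrite /c' addr0 min_r; last lra.
  by rewrite max_l ?c1 //; lra.
have crB t : 2^-1 <= t -> t <= 1 -> B (c' t).
  by move=> h1 h2; rewrite cr //; apply: good_convex => //; apply/andP; split; lra.
have NN : (N * 2 = N + N)%N by rewrite muln2 addnn.
have fr i : (i <= N)%N -> 0 <= (i%:R / N%:R : R) <= 1 by exact: frac_itv.
have rB i : (i <= N)%N -> B (c' ((N + i)%:R / (N * 2)%:R)).
  by move=> /fr/andP[h1 h2]; rewrite frac_half2 //; apply: crB; lra.
exists c', (N * 2)%N; split.
- move=> t; apply: cvgD.
    by apply: (@continuous_comp _ _ _ (fun t : R => Num.min (2 * t + 0) 1) c);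
      [exact: continuous_affine_min|exact: cc].
  by apply: cvgZl; exact: continuous_affine_max.
- move=> t /andP[h1 h2]; case: (leP t 2^-1) => h.
    by rewrite cl //; apply: cO; lra.
  by apply: (good_sub gB); apply: crB => //; exact: ltW.
- by rewrite cl ?invr_ge0 // mulr0.
- by rewrite cr ?invf_le1 ?ler1n // mulr1 -[2]/(1 + 1) addrK scale1r addrC subrK.
split; first by rewrite muln_gt0 N0.
  move=> i; rewrite NN; case: (ltnP i N) => iN iNN.
    have [D gD DD] := gN i iN; exists D => // t /andP[]; rewrite -NN !frac_half => h1 h2.
    have /andP[_ h3] := fr _ iN.
    by rewrite cl; [apply: DD; apply/andP; split; lra|lra].
  have jN : (i - N < N)%N by rewrite ltn_subLR.
  exists B => // t /andP[]; rewrite -NN -(subnKC iN) -addnS !frac_half2 // => h1 h2.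
  have /andP[f1 _] := fr _ (ltnW jN); have /andP[_ f2] := fr _ jN.
  by apply: crB; lra.
suff E j : (j <= N)%N -> transport c' (N * 2) (N + j) =
    P p (c' ((N + j)%:R / (N * 2)%:R)) *m transport c N N.
  rewrite {2}NN E // frac_half2 // divff; last by rewrite pnatr_eq0 -lt0n.
  have -> : 2^-1 + 1 / 2 = 1 :> R by field.
  rewrite cr ?invf_le1 ?ler1n // mulr1 -[2]/(1 + 1) addrK scale1r.
  by rewrite [p + _]addrC subrK.
elim: j => [_|j IH jN].
  rewrite addn0 (@transport_eq c' c (N * 2) N); last first.
    move=> i /fr/andP[_ hi]; rewrite frac_half cl; last lra.
    by rewrite mulrC divfK // pnatr_eq0.
  have -> : c' (N%:R / (N * 2)%:R) = p.
    rewrite (_ : N%:R / (N * 2)%:R = 2^-1); first by rewrite cl // divff.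
    by have := frac_half2 0 N0; rewrite addn0 !mul0r addr0.
  by rewrite P_id ?mul1mx //; exact: (good_sub gB).
rewrite addnS /= IH 1?ltnW // mulmxA -addnS.
by rewrite (P_cocycle gB) //; apply: rB => //; exact: ltnW.
Qed.

Lemma segment_in_square (x : R * R) r y z t : ball x r y -> ball x r z -> 0 <= t <= 1 ->
  ball x r (y + t *: (z - y)).
Proof.
have key (a b c : R) : `|a - b| < r -> `|a - c| < r -> 0 <= t <= 1 ->
    `|a - (b + t * (c - b))| < r.
  move=> h1 h2 /andP[t0 t1].
  have -> : a - (b + t * (c - b)) = (1 - t) * (a - b) + t * (a - c) by ring.
  apply: le_lt_trans (ler_normD _ _) _; rewrite !normrM.
  have t1' : 0 <= 1 - t by rewrite subr_ge0.
  rewrite (ger0_norm t1') (ger0_norm t0).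
  pose m := Num.max `|a - b| `|a - c|.
  have m1 : `|a - b| <= m by rewrite le_max lexx.
  have m2 : `|a - c| <= m by rewrite le_max lexx orbT.
  have mr : m < r by rewrite gt_max h1.
  apply: le_lt_trans mr.
  apply: (@le_trans _ _ ((1 - t) * m + t * m)); last by rewrite -mulrDl subrK mul1r.
  exact: lerD (ler_wpM2l t1' m1) (ler_wpM2l t0 m2).
by move=> [h1 h2] [h3 h4] ht; split; exact: key.
Qed.

(** The set of points reached by a continuation is open and closed, because good
    sets are convex. *)
Lemma continuation_exists p : O p -> exists X, continuation p X.
Proof.
have [_ cO _] := sc.
move: p; apply: (@clopen_connected R O (fun p => exists X, continuation p X) p0) => //.
  exists 1%:M, (fun=> p0), 1%N; split => //; first by move=> t; exact: cvg_cst.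
  split => //.
    have [r r0 [gr _]] := good_cover Op0.
    by move=> i _; exists (ball p0 r) => // t _; exact: ballxx.
  by rewrite /= P_id // mulmx1.
move=> p Op; have [r r0 [gr rO]] := good_cover Op.
exists r => //; split => // q pq; split => -[X hX].
  by exists (P p q *m X); exact: continuation_step gr (ballxx p r0) pq hX.
by exists (P q p *m X); exact: continuation_step gr pq (ballxx p r0) hX.
Qed.

(** The value at p is the transport along any path from [p0] to p, which is well
    defined by [continuation_unique]. *)
Theorem monodromy : exists Y : R * R -> 'M[R]_n, Y p0 = 1%:M /\
  forall B p q, good B -> B p -> B q -> Y q = P p q *m Y p.
Proof.
have ex p : exists X, O p -> continuation p X.
  have [Op|nOp] := pselect (O p); last by exists 0.
  by have [X hX] := continuation_exists Op; exists X.
have [Y HY] := choice ex.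
exists Y; split; last first.
  move=> B p q gB Bp Bq; have Op := good_sub gB Bp; have Oq := good_sub gB Bq.
  exact: continuation_unique (HY q Oq) (continuation_step gB Bp Bq (HY p Op)).
apply: continuation_unique (HY p0 Op0) _.
exists (fun=> p0), 1%N; split => //; first by move=> t; exact: cvg_cst.
split => //.
  have [r r0 [gr _]] := good_cover Op0.
  by move=> i _; exists (ball p0 r) => // t _; exact: ballxx.
by rewrite /= P_id // mulmx1.
Qed.

End Monodromy.

(** * Global solutions of integrable linear systems *)
Section TotalSystem.
Context {R : realType}.
Implicit Types (p q x y : R * R).

Lemma constant_on_box (f : R * R -> R) x y :
  (forall q, Num.min x.1 y.1 <= q.1 <= Num.max x.1 y.1 ->
             Num.min x.2 y.2 <= q.2 <= Num.max x.2 y.2 ->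
     is_derive q (1, 0) f 0 /\ is_derive q (0, 1) f 0) -> f x = f y.
Proof.
case: x y => a b [a' b'] /= fd.
have e (u v : R) : Num.min u v <= v <= Num.max u v by rewrite ge_min le_max !lexx !orbT.
have e' (u v : R) : Num.min u v <= u <= Num.max u v by rewrite ge_min le_max !lexx.
have [c _] := @mvt_between _ (fun t => f (t, b')) (fun=> 0) a a'
  (fun t tI => (is_derive_u f (t, b') 0).1 (fd (t, b') tI (e b b')).1).
have [d _] := @mvt_between _ (fun t => f (a, t)) (fun=> 0) b b'
  (fun t tI => (is_derive_v f (a, t) 0).1 (fd (a, t) (e' a a') tI).2).
rewrite !mul0r => /eqP; rewrite subr_eq0 => /eqP <- /eqP.
by rewrite subr_eq0 => /eqP.
Qed.

Variables (O : set (R * R)) (n : nat).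
Hypothesis oO : open O.

Lemma Ck_mulmx k m l (A : R * R -> 'M[R]_(n, m)) (B : R * R -> 'M[R]_(m, l)) :
  Ck k O A -> Ck k O B -> Ck k O (fun p => A p *m B p).
Proof.
move=> /(Ck_mx oO) CA /(Ck_mx oO) CB; apply/(Ck_mx oO) => i j.
apply: (@Ck_ext _ _ oO _ _ (fun p => \sum_h A p i h * B p h j)).
  by move=> p _; rewrite mxE.
by apply: Ck_sum => // h; exact: CkM.
Qed.

Variables Om1 Om2 : R * R -> 'M[R]_n.
Hypotheses (s1 : smooth O Om1) (s2 : smooth O Om2).

Definition solves (B : set (R * R)) (Y : R * R -> 'M[R]_n) := forall p, B p ->
  is_derive p (1, 0) Y (Om1 p *m Y p) /\ is_derive p (0, 1) Y (Om2 p *m Y p).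

(** The inverse of a solution satisfies this equation; solving it directly
    provides the inverse without discussing determinants. *)
Definition cosolves (B : set (R * R)) (Z : R * R -> 'M[R]_n) := forall p, B p ->
  is_derive p (1, 0) Z (- (Z p *m Om1 p)) /\ is_derive p (0, 1) Z (- (Z p *m Om2 p)).

Lemma solution_continuous B Y p r K : 0 < r -> ball p r `<=` B -> B `<=` O -> solves B Y ->
  (forall q, ball p r q -> forall i j, `|Y q i j| <= K) ->
  {for p, continuous Y}.
Proof.
move=> r0 pB BO sY YK.
have Op : O p by apply: BO; apply: pB; exact: ballxx.
have [r1 [M1 [r10 M10 _ b1]]] := locally_bounded oO s1 Op.
have [r2 [M2 [r20 M20 _ b2]]] := locally_bounded oO s2 Op.
pose d := Num.min r (Num.min r1 r2).
have d0 : 0 < d by rewrite !lt_min r0 r10 r20.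
have sq q : ball p d q -> [/\ ball p r q, ball p r1 q & ball p r2 q].
  by move=> hq; split; apply: square_le hq; rewrite !ge_min lexx ?orbT.
apply/continuous_mx => i j.
apply: (@lipschitz_continuous R (fun q => Y q i j) (fun q => (Om1 q *m Y q) i j)
  (fun q => (Om2 q *m Y q) i j) p d (n%:R * (M1 + M2) * K)) => // q /sq[h h1 h2].
  have [/is_derive_mx d1 /is_derive_mx d2] := sY q (pB q h).
  by split; [exact: d1|exact: d2].
split; apply: mulmx_entry_le => [k l|k l]; try exact: YK.
  by apply: le_trans (b1 q h1 k l) _; rewrite lerDl.
by apply: le_trans (b2 q h2 k l) _; rewrite lerDr.
Qed.

Lemma solution_smooth Y : solves O Y -> (forall p, O p -> {for p, continuous Y}) -> smooth O Y.
Proof.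
move=> sY cY; elim=> [|k IH]; first by split.
apply: (Ck_step oO cY (fu := fun p => Om1 p *m Y p) (fv := fun p => Om2 p *m Y p)).
- by move=> p /sY[].
- by move=> p /sY[].
- exact: Ck_mulmx (s1 k) IH.
- exact: Ck_mulmx (s2 k) IH.
Qed.

Lemma cosolve_mul B Z Y p : cosolves B Z -> solves B Y -> B p ->
  is_derive p (1, 0) (fun q => Z q *m Y q) 0 /\ is_derive p (0, 1) (fun q => Z q *m Y q) 0.
Proof.
move=> cZ sY Bp; have [z1 z2] := cZ p Bp; have [y1 y2] := sY p Bp.
have e (A : 'M[R]_n) : - (Z p *m A) *m Y p + Z p *m (A *m Y p) = 0.
  by rewrite mulNmx mulmxA addNr.
by split; [have := is_derive_mulmx z1 y1|have := is_derive_mulmx z2 y2]; rewrite e.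
Qed.

Hypothesis integrable : forall p, O p ->
  dv Om1 p + Om1 p *m Om2 p = du Om2 p + Om2 p *m Om1 p.

Definition chart B (YZ : (R * R -> 'M[R]_n) * (R * R -> 'M[R]_n)) :=
  [/\ exists x r, [/\ 0 < r, B = ball x r & B `<=` O],
      solves B YZ.1, cosolves B YZ.2, forall q, B q -> YZ.2 q *m YZ.1 q = 1%:M &
      forall q, B q -> {for q, continuous YZ.1}].

(** The inverse [Z] comes from the transposed dual system, which is integrable
    too; Z Y is then constant. *)
Lemma chart_at p : O p -> exists2 r, 0 < r & exists YZ, chart (ball p r) YZ.
Proof.
move=> Op; have [r1 [Y [r10 r1O Y1 Yb Y']]] := frobenius_local oO s1 s2 integrable Op.
pose tr (Om : R * R -> 'M[R]_n) q := - (Om q)^T.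
have str Om : smooth O Om -> smooth O (tr Om).
  move=> /(smooth_mx oO) sOm; apply/(smooth_mx oO) => i j.
  apply: (@smooth_ext _ _ oO _ (fun q => - Om q j i)); last by apply: smoothN => //; exact: sOm.
  by move=> q _; rewrite !mxE.
have pdtr Om i q : smooth O Om -> O q -> pd i (tr Om) q = - (pd i Om q)^T.
  move=> sOm Oq; apply/matrixP => k l; rewrite (pd_mx _ _ _ (str _ sOm)) //.
  rewrite !mxE (pd_mx _ _ _ sOm) //.
  rewrite (_ : (fun _ => _) = (fun z => - Om z l k)); last first.
    by apply/funext => z; rewrite !mxE.
  by rewrite (pdN _ _ Oq) // ; exact: (smooth_mx oO _).1 sOm l k.
have int' q : O q -> dv (tr Om1) q + tr Om1 q *m tr Om2 q = du (tr Om2) q + tr Om2 q *m tr Om1 q.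
  move=> Oq; rewrite /dv /du !pdtr // /tr !(mulNmx, mulmxN) !opprK -!trmx_mul -!linearN -!linearD.
  congr (_^T); have := integrable Oq; rewrite /dv /du => /eqP; rewrite -subr_eq0 => /eqP e.
  apply/eqP; rewrite -subr_eq0 -oppr_eq0 -[X in _ == X]e; apply/eqP.
  by apply/matrixP => i j; rewrite !mxE; ring.
have [r2 [W [r20 r2O W1 _ W']]] := frobenius_local oO (str _ s1) (str _ s2) int' Op.
pose r := Num.min r1 r2; have r0 : 0 < r by rewrite lt_min r10.
have sq q : ball p r q -> ball p r1 q /\ ball p r2 q.
  by move=> hq; split; apply: square_le hq; rewrite ge_min lexx ?orbT.
have rO : ball p r `<=` O by move=> q /sq[/r1O].
pose Z q := (W q)^T.
have sY : solves (ball p r) Y by move=> q /sq[/Y'].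
have cZ : cosolves (ball p r) Z.
  move=> q /sq[_ /W'[/is_derive_mx w1 /is_derive_mx w2]]; split; apply/is_derive_mx => i j.
    have := w1 j i; rewrite (_ : (fun y => W y j i) = (fun y => Z y i j)); last first.
      by apply/funext => y; rewrite mxE.
    by move=> /is_derive_eq; apply; rewrite /tr mulNmx !mxE; congr (- _); apply: eq_bigr => k _;
      rewrite !mxE mulrC.
  have := w2 j i; rewrite (_ : (fun y => W y j i) = (fun y => Z y i j)); last first.
    by apply/funext => y; rewrite mxE.
  by move=> /is_derive_eq; apply; rewrite /tr mulNmx !mxE; congr (- _); apply: eq_bigr => k _;
    rewrite !mxE mulrC.
exists r => //; exists (Y, Z); split => //.
- by exists p, r.
- move=> q hq; apply/matrixP => i j /=.
  rewrite (@locally_constant R (fun q => (Z q *m Y q) i j) p r) //.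
    by rewrite /Z W1 Y1 trmx1 mulmx1.
  move=> z hz; have [/is_derive_mx d1 /is_derive_mx d2] := cosolve_mul cZ sY hz.
  by split; [have := d1 i j|have := d2 i j]; rewrite mxE.
- move=> q hq /=.
  have [d d0 dq] : exists2 d, 0 < d & ball q d `<=` ball p r.
    have : nbhs q (ball p r) by apply: open_nbhs_nbhs; split => //; exact: ball_open.
    by move=> /nbhs_ballP[d d0 hd]; exists d.
  apply: (@solution_continuous _ Y q d 4 d0 dq rO sY).
  by move=> z /dq/sq[/Yb].
Qed.

Lemma chart_inv B YZ q : chart B YZ -> B q -> YZ.1 q *m YZ.2 q = 1%:M.
Proof. by move=> [_ _ _ H _] Bq; apply: mulmx1C; exact: H. Qed.

(** Z Y' is constant on the intersection of two squares because a box spanned by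
    two of its points stays inside. *)
Lemma chart_compat B B' YZ YZ' x y : chart B YZ -> chart B' YZ' ->
  B x -> B y -> B' x -> B' y ->
  YZ.1 y *m YZ.2 x = YZ'.1 y *m YZ'.2 x.
Proof.
move=> cB cB' Bx By Bx' By'.
have [[c [r [r0 BE _]]] _ cZ Z1 _] := cB; have [[c' [r' [r0' BE' _]]] sY' _ _ _] := cB'.
have E : YZ.2 x *m YZ'.1 x = YZ.2 y *m YZ'.1 y.
  apply/matrixP => i j.
  apply: (@constant_on_box (fun q => (YZ.2 q *m YZ'.1 q) i j)) => q h1 h2.
  have Bq : B q.
    move: Bx By; rewrite BE => -[/= u1 u2] [/= v1 v2].
    by split; [exact: between_ball u1 v1 h1|exact: between_ball u2 v2 h2].
  have Bq' : B' q.
    move: Bx' By'; rewrite BE' => -[/= u1 u2] [/= v1 v2].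
    by split; [exact: between_ball u1 v1 h1|exact: between_ball u2 v2 h2].
  have [] := @cosolve_mul (B `&` B') YZ.2 YZ'.1 q (fun z h => cZ z h.1) (fun z h => sY' z h.2) (conj Bq Bq').
  move=> /is_derive_mx d1 /is_derive_mx d2.
  by split; [have := d1 i j|have := d2 i j]; rewrite mxE.
rewrite -[LHS]mulmx1 -(chart_inv cB' Bx') -mulmxA (mulmxA (YZ.2 x)) E.
by rewrite !mulmxA (chart_inv cB By) mul1mx.
Qed.

Definition linked x y (PQ : set (R * R) * ((R * R -> 'M[R]_n) * (R * R -> 'M[R]_n))) :=
  [/\ chart PQ.1 PQ.2, PQ.1 x & PQ.1 y].

(** Any chart containing both points gives the same value, see
    [local_transportE]. *)
Definition local_transport x y : 'M[R]_n :=
  let PQ := xget (set0, (fun=> 0, fun=> 0)) (linked x y) in PQ.2.1 y *m PQ.2.2 x.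

Lemma local_transportE B YZ x y : chart B YZ -> B x -> B y ->
  local_transport x y = YZ.1 y *m YZ.2 x.
Proof.
move=> cB Bx By; rewrite /local_transport.
have [] : linked x y (xget (set0, (fun=> 0, fun=> 0)) (linked x y)).
  by apply: (@xgetPex _ _ (linked x y)); exists (B, YZ); split.
by move=> cB' Bx' By'; exact: (chart_compat cB' cB Bx' By' Bx By).
Qed.

(** The local fundamental solutions define a cocycle, which [monodromy]
    integrates. *)
Theorem total_system p0 : simply_connected O -> O p0 ->
  exists Y, [/\ Y p0 = 1%:M, smooth O Y & solves O Y].
Proof.
move=> sc Op0; pose good B := exists YZ, chart B YZ.
have [] := @monodromy R O n good local_transport _ _ _ _ _ p0 Op0 sc.
- move=> x Ox; have [r r0 [YZ cYZ]] := chart_at Ox; exists r => //; split; first by exists YZ.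
  by have [[_ [_ [_ _ +]]] _ _ _ _] := cYZ.
- move=> B x y t [YZ [[c [r [r0 -> _]]] _ _ _ _]]; exact: segment_in_square.
- by move=> B [YZ [[c [r [r0 _ BO]]] _ _ _ _]]; exact: BO.
- move=> B x y z [YZ cB] Bx By Bz; rewrite !(local_transportE cB) //.
  by rewrite -mulmxA (mulmxA (YZ.2 y)); have [_ _ _ -> //] := cB; rewrite mul1mx.
- move=> x Ox; have [r r0 [YZ cB]] := chart_at Ox.
  by rewrite (local_transportE cB (ballxx _ r0) (ballxx _ r0)) (chart_inv cB (ballxx _ r0)).
move=> Y [Y0 HY].
have loc p : O p -> exists2 r, 0 < r & exists YZ, [/\ ball p r `<=` O, chart (ball p r) YZ &
    forall q, ball p r q -> YZ.1 q *m (YZ.2 p *m Y p) = Y q].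
  move=> Op; have [r r0 [YZ cB]] := chart_at Op; exists r => //; exists YZ; split => //.
    by have [[_ [_ [_ _ +]]] _ _ _ _] := cB.
  move=> q hq; rewrite (HY (ball p r) p q) //; [|by exists YZ|exact: ballxx].
  by rewrite (local_transportE cB (ballxx _ r0) hq) mulmxA.
have sY : solves O Y.
  move=> p Op; have [r r0 [YZ [rO cB E]]] := loc p Op.
  have [_ sB _ _ _] := cB; have [d1 d2] := sB p (ballxx _ r0).
  have c v : is_derive p v (fun=> YZ.2 p *m Y p : 'M[R]_n) 0 by exact: is_derive_cst.
  have e (A : 'M[R]_n) : A *m YZ.1 p *m (YZ.2 p *m Y p) + YZ.1 p *m 0 = A *m Y p.
    by rewrite mulmx0 addr0 -mulmxA E //; exact: ballxx.
  have oB : open (ball p r : set (R * R)) by exact: ball_open.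
  have Bp : (ball p r : set (R * R)) p by exact: ballxx.
  split; rewrite -e; apply: (is_derive_ext_open oB Bp E).
    exact: is_derive_mulmx d1 (c _).
  exact: is_derive_mulmx d2 (c _).
exists Y; split => //; apply: solution_smooth => // p Op.
have [r r0 [YZ [rO cB E]]] := loc p Op.
have oB : open (ball p r : set (R * R)) by exact: ball_open.
apply: (@continuous_ext_open R (ball p r) oB _ _ _ E) => [q hq|]; last exact: ballxx.
have [_ _ _ _ cY] := cB.
apply/continuous_mx => i j.
rewrite (_ : (fun y => _) = (fun y => \sum_k YZ.1 y i k * (YZ.2 p *m Y p) k j)); last first.
  by apply/funext => y; rewrite mxE.
rewrite -(fct_sumE _ _ (fun k y => YZ.1 y i k * (YZ.2 p *m Y p) k j)).
elim/big_ind : _ => [|f g fc gc|k _]; first exact: cvg_cst.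
  by apply: cvgD; [exact: fc|exact: gc].
apply: cvgM; last exact: cvg_cst.
by have /continuous_mx := cY q hq; apply.
Qed.

End TotalSystem.

(** * Frames of the ambient space *)
Section InnerProduct.
Context {R : realType} {L0 : R}.
Notation vec := 'rV[R]_(adim L0).
Implicit Types (x y z : vec) (c : R).

Definition eps (i : nat) : R := if (L0 < 0) && (i == 4%N) then -1 else 1.

Lemma eps_sq i : eps i * eps i = 1.
Proof. by rewrite /eps; case: ifP; rewrite ?mulrNN mul1r. Qed.

Lemma ipE x y : ip x y = \sum_(i < adim L0) eps i * x 0 i * y 0 i.
Proof. by []. Qed.

Lemma ipC x y : ip x y = ip y x.
Proof. by rewrite !ipE; apply: eq_bigr => i _; rewrite -!mulrA [x _ _ * _]mulrC. Qed.

Lemma ipDl x y z : ip (x + y) z = ip x z + ip y z.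
Proof. by rewrite !ipE -big_split; apply: eq_bigr => i _; rewrite !mxE mulrDr mulrDl. Qed.

Lemma ipZl c x z : ip (c *: x) z = c * ip x z.
Proof. by rewrite !ipE mulr_sumr; apply: eq_bigr => i _; rewrite !mxE; ring. Qed.

Lemma ipNl x z : ip (- x) z = - ip x z.
Proof. by rewrite -scaleN1r ipZl mulN1r. Qed.

Lemma ipBl x y z : ip (x - y) z = ip x z - ip y z.
Proof. by rewrite ipDl ipNl. Qed.

Lemma ip0l z : ip 0 z = 0.
Proof. by rewrite -(scale0r 0) ipZl mul0r. Qed.

Lemma ipDr x y z : ip z (x + y) = ip z x + ip z y.
Proof. by rewrite ipC ipDl !(ipC z). Qed.

Lemma ipZr c x z : ip z (c *: x) = c * ip z x.
Proof. by rewrite ipC ipZl ipC. Qed.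

Lemma ip_suml n (f : 'I_n -> vec) z : ip (\sum_k f k) z = \sum_k ip (f k) z.
Proof. by elim/big_rec2 : _ => [|k _ w _ <-]; rewrite ?ip0l // ipDl. Qed.

Section Smooth.
Variable O : set (R * R).
Hypothesis oO : open O.

Lemma smooth_coord (f : R * R -> vec) i : smooth O f -> smooth O (fun p => f p 0 i).
Proof. by move=> /(smooth_mx oO)/(_ 0 i). Qed.

Lemma smooth_ip (f g : R * R -> vec) : smooth O f -> smooth O g ->
  smooth O (fun p => ip (f p) (g p)).
Proof.
move=> sf sg; apply: (smooth_sum oO) => i.
apply: (smoothM oO); last exact: smooth_coord.
by apply: (smoothM oO); [exact: smooth_cst|exact: smooth_coord].
Qed.

Lemma pd_ip i (f g : R * R -> vec) p : smooth O f -> smooth O g -> O p ->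
  pd i (fun q => ip (f q) (g q)) p = ip (pd i f p) (g p) + ip (f p) (pd i g p).
Proof.
move=> sf sg Op.
have se (k : 'I_(adim L0)) : smooth O (fun q => eps k * f q 0 k).
  by apply: (smoothM oO); [exact: smooth_cst|exact: smooth_coord].
rewrite (@pd_sum _ O _ i (fun k q => eps k * f q 0 k * g q 0 k)) //; last first.
  by move=> k; apply: (smoothM oO) => //; exact: smooth_coord.
rewrite !ipE -big_split; apply: eq_bigr => k _ /=.
have sc := smooth_cst (O := O) oO (eps k).
rewrite (pdM i (se k) (smooth_coord k sg) Op) (pdM i sc (smooth_coord k sf) Op).
by rewrite pd_cst mul0r add0r !(@pd_mx _ O).
Qed.
End Smooth.

(** The flat case has one coordinate less; weights that vanish for L0 = 0 allow
    all sums to run over five indices in both cases. *)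
Lemma sum_adim (f : nat -> R) : (L0 = 0 -> f 4%N = 0) ->
  \sum_(k < adim L0) f k = \sum_(k < 5) f k.
Proof.
rewrite /adim; case: eqP => // L00 /(_ L00) f4.
by rewrite [RHS]big_ord_recr /= f4 addr0.
Qed.

(** Coefficients of the metric of the ambient space dual to a frame
    (T1, T2, N1, N2, F); the last one vanishes in the flat case, where F is not
    part of the frame. *)
Definition weight (w : R) (k : nat) : R := if (k < 4)%N then w^-1 else L0.

(** Resolution of the inverse ambient metric by the frame formed by the rows of
    [E]; in this form the condition is a pairing that the structure equations
    keep constant. *)
Definition complete (w : R) (E : 'M[R]_(5, adim L0)) := forall i j,
  \sum_(k < 5) weight w k * E k i * E k j = (i == j)%:R * eps i.

Definition gram (w : R) (E : 'M[R]_(5, adim L0)) := forall k l : 'I_5,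
  (k < adim L0)%N -> (l < adim L0)%N ->
  ip (row k E) (row l E) * weight w l = (k == l)%:R.

Lemma adim_le5 : (adim L0 <= 5)%N. Proof. by rewrite /adim; case: ifP. Qed.

Let top (E : 'M[R]_(5, adim L0)) : 'M[R]_(adim L0) :=
  \matrix_(k, i) E (widen_ord adim_le5 k) i.
Let dual w (E : 'M[R]_(5, adim L0)) : 'M[R]_(adim L0) :=
  \matrix_(i, k) (eps i * E (widen_ord adim_le5 k) i * weight w k).

Let gramE w E : gram w E <-> top E *m dual w E = 1%:M.
Proof.
have entry k l : (top E *m dual w E) k l =
    ip (row (widen_ord adim_le5 k) E) (row (widen_ord adim_le5 l) E) * weight w l.
  by rewrite mxE ipE mulr_suml; apply: eq_bigr => i _; rewrite /top /dual !mxE; ring.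
split=> [G|G k l kd ld].
  by apply/matrixP => k l; rewrite entry (G (widen_ord _ k) (widen_ord _ l) (ltn_ord k) (ltn_ord l)) mxE.
have := congr1 (fun M : 'M[R]_(adim L0) => M (Ordinal kd) (Ordinal ld)) G.
rewrite entry [X in _ = X]mxE.
have -> : widen_ord adim_le5 (Ordinal kd) = k by exact: val_inj.
by have -> : widen_ord adim_le5 (Ordinal ld) = l by exact: val_inj.
Qed.

Let completeE w E : complete w E <-> dual w E *m top E = 1%:M.
Proof.
have entry i j : (dual w E *m top E) i j =
    eps i * \sum_(k < 5) weight w k * E k i * E k j.
  rewrite mxE mulr_sumr.
  pose h (k : nat) := eps i * (weight w k * E (inord k) i * E (inord k) j).
  transitivity (\sum_(k < adim L0) h k).
    apply: eq_bigr => k _; rewrite /top /dual !mxE /h.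
    have -> : inord k = widen_ord adim_le5 k.
      by apply: val_inj; rewrite /= inordK // (leq_trans (ltn_ord k) adim_le5).
    by rewrite /=; ring.
  rewrite sum_adim; first by apply: eq_bigr => k _; rewrite /h inord_val.
  move=> L00; have w0 : weight w 4 = 0 by [].
  by rewrite /h w0 !mul0r mulr0.
split=> C.
  apply/matrixP => i j; rewrite entry C mxE.
  by case: eqP => _; rewrite ?mul1r ?eps_sq // !mul0r mulr0.
move=> i j; have := congr1 (fun M : 'M[R]_(adim L0) => M i j) C.
rewrite entry [X in _ = X]mxE => /(congr1 (fun c => eps i * c)).
by rewrite mulrA eps_sq mul1r [X in _ = X]mulrC.
Qed.

(** A square matrix has the same left and right inverses, so the orthogonality
    of the frame and the resolution of the ambient metric are equivalent. *)
Lemma gram_complete w E : gram w E <-> complete w E.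
Proof. by split=> [/gramE/mulmx1C/completeE|/completeE/mulmx1C/gramE]. Qed.

(** For L0 = 0 the position vector is not orthogonal to the frame, so its
    coefficient has to vanish. *)
Lemma gram_coord w E n (A : 'M[R]_(n, 5)) (k : 'I_n) (l : 'I_5) : gram w E ->
  (L0 = 0 -> A k 4 = 0) -> (l < 4)%N ->
  ip (row k (A *m E)) (row l E) * weight w l = A k l.
Proof.
move=> gE A4 l4; have a4 : (4 <= adim L0)%N by rewrite /adim; case: ifP.
have la : (l < adim L0)%N := leq_trans l4 a4.
rewrite row_mul mulmx_sum_row ip_suml mulr_suml (bigD1 l) //= big1 => [|j jl].
  by rewrite mxE ipZl -mulrA (gE l l la la) eqxx mulr1 addr0.
rewrite mxE ipZl -mulrA; have [ja|ja] := ltnP j (adim L0).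
  by rewrite (gE j l ja la) (negPf jl) mulr0.
have j4 : j = 4 by apply: val_inj; apply/eqP; rewrite eqn_leq -ltnS ltn_ord (leq_trans a4 ja).
suff L00 : L0 = 0 by rewrite j4 (A4 L00) mul0r.
move: ja; rewrite j4 /adim; by case: eqP.
Qed.

Lemma resolution w E x : complete w E ->
  x = \sum_(k < 5) (weight w k * ip x (row k E)) *: row k E.
Proof.
move=> C; apply/rowP => j; rewrite summxE.
transitivity (\sum_(i < adim L0) eps i * x 0 i *
    \sum_(k < 5) weight w k * E k i * E k j); last first.
  under eq_bigr => i _ do rewrite mulr_sumr.
  rewrite exchange_big; apply: eq_bigr => k _ /=.
  rewrite !mxE ipE mulr_sumr mulr_suml; apply: eq_bigr => i _.
  by rewrite !mxE; ring.
rewrite (bigD1 j) //= C eqxx mul1r big1 => [|i ij].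
  by rewrite addr0 mulrC mulrA eps_sq mul1r.
by rewrite C (negPf ij) mul0r mulr0.
Qed.

End InnerProduct.

(** * Connection matrices *)
Section ConnectionAlgebra.
Context {R : realType}.

Definition mx5 (s : seq (seq R)) : 'M[R]_5 := \matrix_(i, j) nth 0 (nth [::] s i) j.

(** Derivatives along the coordinate curves of the frame (T1, T2, N1, N2, F) by
    the Gauss and Weingarten formulas, with z = L0 e^(2 lambda).  For t = 0 the
    matrices depend linearly on the other arguments, so that the same formulas
    give the derivatives of the connection. *)
Definition conn_u (t z lu lv a1 a2 b1 b2 m : R) : 'M[R]_5 := mx5
  [:: [:: lu; - lv; a1; b1; - z];
      [:: lv; lu; a2; b2; 0];
      [:: - a1; - a2; lu; m; 0];
      [:: - b1; - b2; - m; lu; 0];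
      [:: t; 0; 0; 0; 0]].
Definition conn_v (t z lu lv a2 a3 b2 b3 m : R) : 'M[R]_5 := mx5
  [:: [:: lv; lu; a2; b2; 0];
      [:: - lu; lv; a3; b3; - z];
      [:: - a2; - a3; lv; m; 0];
      [:: - b2; - b3; - m; lv; 0];
      [:: 0; t; 0; 0; 0]].

Section Algebra.
Variables (z lu lv luu luv lvv a1 a2 a3 b1 b2 b3 m1 m2 : R).
Variables (a1v a2v b1v b2v m1v a2u a3u b2u b3u m2u : R).

Let curv := conn_u 0 (2 * lv * z) luv lvv a1v a2v b1v b2v m1v
    + conn_u 1 z lu lv a1 a2 b1 b2 m1 *m conn_v 1 z lu lv a2 a3 b2 b3 m2
  - (conn_v 0 (2 * lu * z) luu luv a2u a3u b2u b3u m2u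
    + conn_v 1 z lu lv a2 a3 b2 b3 m2 *m conn_u 1 z lu lv a1 a2 b1 b2 m1).

(** The flatness of the connection matrices splits into the equations of Gauss,
    Ricci and Codazzi. *)
Lemma structure_integrable :
  luu + lvv + z = 0 -> a1 * a3 + b1 * b3 = a2 ^+ 2 + b2 ^+ 2 ->
  a1 * b2 + a2 * b3 = a2 * b1 + a3 * b2 -> m1v = m2u ->
  a1v - a2u = lu * a2 + lv * a3 + b1 * m2 - b2 * m1 ->
  b1v - b2u = lu * b2 + lv * b3 - a1 * m2 + a2 * m1 ->
  a2v - a3u = - lu * a1 - lv * a2 + b2 * m2 - b3 * m1 ->
  b2v - b3u = - lu * b1 - lv * b2 - a2 * m2 + a3 * m1 -> curv = 0.
Proof.
move=> e1 e2 e3 e4 c1 c2 c3 c4.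
apply/matrixP => -[[|[|[|[|[|//]]]]] ?] [[|[|[|[|[|//]]]]] ?];
  rewrite !mxE !big_ord_recl !big_ord0 !mxE /=; try ring.
all: try (move: e1 e2 e3 e4 c1 c2 c3 c4; rewrite !expr2 => e1 e2 e3 e4 c1 c2 c3 c4; lra).
Qed.

Lemma curvature_entries :
  [/\ curv 0 2 = a1v - a2u - (lu * a2 + lv * a3 + b1 * m2 - b2 * m1),
      curv 0 3 = b1v - b2u - (lu * b2 + lv * b3 - a1 * m2 + a2 * m1),
      curv 1 2 = a2v - a3u - (- lu * a1 - lv * a2 + b2 * m2 - b3 * m1),
      curv 1 3 = b2v - b3u - (- lu * b1 - lv * b2 - a2 * m2 + a3 * m1) &
      curv 0 4 = 0 /\ curv 1 4 = 0].
Proof.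
by split=> [||||]; try split; rewrite !mxE !big_ord_recl !big_ord0 !mxE /=; ring.
Qed.
End Algebra.

Lemma is_derive_mx5 (V : normedModType R) (s : V -> seq (seq R)) (ds : seq (seq R)) (x v : V) :
  (forall i j, (i < 5)%N -> (j < 5)%N ->
     is_derive x v (fun y => nth 0 (nth [::] (s y) i) j) (nth 0 (nth [::] ds i) j)) ->
  is_derive x v (fun y => mx5 (s y)) (mx5 ds).
Proof.
move=> H; apply/is_derive_mx => i j; rewrite mxE.
rewrite (_ : (fun y => _) = (fun y => nth 0 (nth [::] (s y) i) j)); last first.
  by apply/funext => y; rewrite mxE.
by apply: H; exact: ltn_ord.
Qed.

Section Derive.
Variables (V : normedModType R) (x d : V).
Variables (z lu lv a1 a2 b1 b2 m : V -> R) (dz dlu dlv da1 da2 db1 db2 dm : R).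
Hypotheses (hz : is_derive x d z dz) (hlu : is_derive x d lu dlu)
  (hlv : is_derive x d lv dlv) (ha1 : is_derive x d a1 da1)
  (ha2 : is_derive x d a2 da2) (hb1 : is_derive x d b1 db1)
  (hb2 : is_derive x d b2 db2) (hm : is_derive x d m dm).

Lemma is_derive_conn_u : is_derive x d
  (fun y => conn_u 1 (z y) (lu y) (lv y) (a1 y) (a2 y) (b1 y) (b2 y) (m y))
  (conn_u 0 dz dlu dlv da1 da2 db1 db2 dm).
Proof.
apply: is_derive_mx5 => -[|[|[|[|[|//]]]]] [|[|[|[|[|//]]]]] _ _ /=;
  first [done|exact: is_deriveN|exact: is_derive_cst].
Qed.

Lemma is_derive_conn_v : is_derive x d
  (fun y => conn_v 1 (z y) (lu y) (lv y) (a1 y) (a2 y) (b1 y) (b2 y) (m y))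
  (conn_v 0 dz dlu dlv da1 da2 db1 db2 dm).
Proof.
apply: is_derive_mx5 => -[|[|[|[|[|//]]]]] [|[|[|[|[|//]]]]] _ _ /=;
  first [done|exact: is_deriveN|exact: is_derive_cst].
Qed.
End Derive.

Section SmoothConn.
Variable O : set (R * R).
Hypothesis oO : open O.
Variables (z lu lv a1 a2 b1 b2 m : R * R -> R).
Hypotheses (hz : smooth O z) (hlu : smooth O lu)
  (hlv : smooth O lv) (ha1 : smooth O a1)
  (ha2 : smooth O a2) (hb1 : smooth O b1)
  (hb2 : smooth O b2) (hm : smooth O m).

Lemma smooth_mx5 (s : R * R -> seq (seq R)) :
  (forall i j, (i < 5)%N -> (j < 5)%N -> smooth O (fun y => nth 0 (nth [::] (s y) i) j)) ->
  smooth O (fun y => mx5 (s y)).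
Proof.
move=> H; apply/(smooth_mx oO) => i j.
apply: (@smooth_ext _ _ oO _ (fun y => nth 0 (nth [::] (s y) i) j)) => [q _|].
  by rewrite mxE.
by apply: H; exact: ltn_ord.
Qed.

Lemma smooth_conn_u : smooth O
  (fun y => conn_u 1 (z y) (lu y) (lv y) (a1 y) (a2 y) (b1 y) (b2 y) (m y)).
Proof.
apply: smooth_mx5 => -[|[|[|[|[|//]]]]] [|[|[|[|[|//]]]]] _ _ /=;
  first [done|exact: (smoothN oO)|exact: (smooth_cst oO)].
Qed.

Lemma smooth_conn_v : smooth O
  (fun y => conn_v 1 (z y) (lu y) (lv y) (a1 y) (a2 y) (b1 y) (b2 y) (m y)).
Proof.
apply: smooth_mx5 => -[|[|[|[|[|//]]]]] [|[|[|[|[|//]]]]] _ _ /=;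
  first [done|exact: (smoothN oO)|exact: (smooth_cst oO)].
Qed.
End SmoothConn.

End ConnectionAlgebra.

Section ConstantPairing.
Context {R : realType} {L0 : R}.
Notation wt := (@weight R L0).

(** A connection is metric for the dual metric [wt w], which grows at the rate
    [dw] along the direction of differentiation. *)
Definition metric_conn (w : R) (dw : nat -> R) (Om : 'M[R]_5) := forall k l : 'I_5,
  wt w l * Om l k + wt w k * Om k l + dw k * (k == l)%:R = 0.

Definition dweight (w l : R) (k : nat) : R := if (k < 4)%N then - (2 * l * w^-1) else 0.

Lemma metric_conn_u w lu lv a1 a2 b1 b2 m : w != 0 ->
  metric_conn w (dweight w lu) (conn_u 1 (L0 * w) lu lv a1 a2 b1 b2 m).
Proof.
move=> w0 -[[|[|[|[|[|//]]]]] ?] [[|[|[|[|[|//]]]]] ?];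
  rewrite !mxE /weight /dweight /= ?mulr0n ?mulr1n; by [ring|field].
Qed.

Lemma metric_conn_v w lu lv a2 a3 b2 b3 m : w != 0 ->
  metric_conn w (dweight w lv) (conn_v 1 (L0 * w) lu lv a2 a3 b2 b3 m).
Proof.
move=> w0 -[[|[|[|[|[|//]]]]] ?] [[|[|[|[|[|//]]]]] ?];
  rewrite !mxE /weight /dweight /= ?mulr0n ?mulr1n; by [ring|field].
Qed.

Lemma is_derive_weight (V : normedModType R) (W : V -> R) (x d : V) l k : W x != 0 ->
  is_derive x d W (2 * l * W x) ->
  is_derive x d (fun y => wt (W y) k) (dweight (W x) l k).
Proof.
move=> w0 dW; rewrite /weight /dweight; case: ifP => _; last exact: is_derive_cst.
have [dd de] := dW.
apply: DeriveDef; first exact: derivableV.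
by rewrite deriveV // de /GRing.scale /=; field.
Qed.

(** If two frames solve the same equation with a metric connection, their pairing
    has zero derivative: the terms in the connection cancel the derivative of the
    weights. *)
Lemma pairing_constant (V : normedModType R) n m (E : V -> 'M[R]_(5, n)) (E' : V -> 'M[R]_(5, m))
    (W : V -> R) (x d : V) l Om i j : W x != 0 ->
  is_derive x d W (2 * l * W x) -> metric_conn (W x) (dweight (W x) l) Om ->
  is_derive x d E (Om *m E x) -> is_derive x d E' (Om *m E' x) ->
  is_derive x d (fun y => \sum_(k < 5) wt (W y) k * E y k i * E' y k j) 0.
Proof.
move=> w0 dW mOm dE dE'.
rewrite (_ : (fun y => _) = (\sum_(k < 5) (fun y => wt (W y) k * E y k i * E' y k j))); last first.
  by apply/funext => y; rewrite fct_sumE.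
have de k : is_derive x d (fun y => E y k i) ((Om *m E x) k i) := (is_derive_mx _ _ _ _).1 dE k i.
have de' k : is_derive x d (fun y => E' y k j) ((Om *m E' x) k j) := (is_derive_mx _ _ _ _).1 dE' k j.
have := @is_derive_sum R V R 5 (fun k y => wt (W y) k * E y k i * E' y k j) x d _
  (fun k => is_deriveM (is_deriveM (is_derive_weight k w0 dW) (de k)) (de' k)).
move=> /is_derive_eq; apply; rewrite /GRing.scale /=.
pose w k := wt (W x) k; pose a (k : 'I_5) := E x k i; pose b (k : 'I_5) := E' x k j.
transitivity (\sum_(k < 5) (w k * a k * \sum_(h < 5) Om k h * b h +
    b k * w k * (\sum_(h < 5) Om k h * a h) + dweight (W x) l k * a k * b k)).
  by apply: eq_bigr => k _; rewrite !mxE /a /b /w -[(_ * _) x]/(wt (W x) k * E x k i); ring.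
rewrite big_split /= big_split /=.
have -> : \sum_(k < 5) b k * w k * (\sum_(h < 5) Om k h * a h) =
    \sum_(k < 5) a k * \sum_(h < 5) b h * (w h * Om h k).
  under eq_bigr => k _ do rewrite mulr_sumr.
  rewrite exchange_big; apply: eq_bigr => k _ /=; rewrite mulr_sumr.
  by apply: eq_bigr => h _; ring.
rewrite -!big_split big1 //= => k _.
transitivity (a k * \sum_(h < 5) b h * (w h * Om h k + w k * Om k h + dweight (W x) l k * (k == h)%:R)).
  transitivity (a k * ((\sum_(h < 5) b h * (w h * Om h k)) + (\sum_(h < 5) b h * (w k * Om k h))
     + \sum_(h < 5) b h * (dweight (W x) l k * (k == h)%:R))); last first.
    by rewrite -!big_split; congr (_ * _); apply: eq_bigr => h _; rewrite /= -!mulrDr.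
  have -> : \sum_(h < 5) b h * (dweight (W x) l k * (k == h)%:R) = b k * dweight (W x) l k.
    rewrite (bigD1 k) //= eqxx mulr1 big1 ?addr0 // => h hk.
    by rewrite eq_sym (negPf hk) !mulr0.
  have -> : \sum_(h < 5) b h * (w k * Om k h) = w k * \sum_(h < 5) Om k h * b h.
    by rewrite mulr_sumr; apply: eq_bigr => h _; ring.
  ring.
by rewrite big1 ?mulr0 // => h _; rewrite /w mOm mulr0.
Qed.

End ConstantPairing.

(** * The Codazzi equations in terms of f+ and f- *)
Section CodazziAlgebra.
Context {R : realType}.
Variables (pu pv mu mv puu puv pvv muu muv mvv c s C S au av bu bv lu lv m1 m2 : R).

(** The part of the Codazzi equations carried by f+, and the one carried by f-. *)
Definition codazzi_p := av * pu - au * pv - (lu * pu + lv * pv + m1 * pv - m2 * pu).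
Definition codazzi_m := bv * mu - bu * mv - (- lu * mu - lv * mv + m1 * mv - m2 * mu).

(* derivatives of (c pu - C mu) / 2 and so on, for c = cos a, s = sin a, C = cos b, S = sin b *)
Let dcc pw mw pz mz az bz (k : R) := 2^-1 * ((- s * az * pw + c * pz) + k * (- S * bz * mw + C * mz)).
Let dss pw mw pz mz az bz (e k : R) := 2^-1 * (e * (c * az * pw + s * pz) + k * (C * bz * mw + S * mz)).

Let a1 := 2^-1 * (c * pu - C * mu).
Let a3 := 2^-1 * (- (s * pv) - S * mv).
Let b1 := 2^-1 * (s * pu - S * mu).
Let b3 := 2^-1 * (c * pv + C * mv).
Let a2c := 2^-1 * (c * pv - C * mv).
Let b2c := 2^-1 * (c * pu + C * mu).
Let a2s := 2^-1 * (- (s * pu) - S * mu).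
Let b2s := 2^-1 * (s * pv - S * mv).

(** In the four Codazzi equations the second derivatives of f+ and f- cancel,
    provided al2 and be2 are written with the appropriate one of their two
    expressions; what remains are multiples of [codazzi_p] and [codazzi_m]. *)
Lemma codazzi1 : dcc pu mu puv muv av bv (-1) - dcc pv mv puv muv au bu (-1)
    - (lu * a2s + lv * a3 + b1 * m2 - b2s * m1)
  = 2^-1 * (- s * codazzi_p + S * codazzi_m).
Proof. rewrite /dcc /dss /codazzi_p /codazzi_m /a2s /a3 /b1 /b2s; ring. Qed.

Lemma codazzi2 : dss pu mu puv muv av bv 1 (-1) - dss pv mv puv muv au bu 1 (-1)
    - (lu * b2c + lv * b3 - a1 * m2 + a2c * m1)
  = 2^-1 * (c * codazzi_p - C * codazzi_m).
Proof. rewrite /dcc /dss /codazzi_p /codazzi_m /a2c /a1 /b3 /b2c; ring. Qed.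

Lemma codazzi3 : dss pu mu puv muv av bv (-1) (-1) - dss pv mv puv muv au bu (-1) (-1)
    - (- lu * a1 - lv * a2c + b2c * m2 - b3 * m1)
  = 2^-1 * (- c * codazzi_p - C * codazzi_m).
Proof. rewrite /dcc /dss /codazzi_p /codazzi_m /a2c /a1 /b3 /b2c; ring. Qed.

Lemma codazzi4 : dcc pu mu puv muv av bv 1 - dcc pv mv puv muv au bu 1
    - (- lu * b1 - lv * b2s - a2s * m2 + a3 * m1)
  = 2^-1 * (- s * codazzi_p - S * codazzi_m).
Proof. rewrite /dcc /dss /codazzi_p /codazzi_m /a2s /a3 /b1 /b2s; ring. Qed.

(** (c, s) and (C, S) are unit vectors, so the four combinations vanish only if
    both parts do. *)
Lemma codazzi_split : c ^+ 2 + s ^+ 2 = 1 -> C ^+ 2 + S ^+ 2 = 1 ->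
  2^-1 * (- s * codazzi_p + S * codazzi_m) = 0 -> 2^-1 * (c * codazzi_p - C * codazzi_m) = 0 ->
  2^-1 * (- c * codazzi_p - C * codazzi_m) = 0 -> 2^-1 * (- s * codazzi_p - S * codazzi_m) = 0 ->
  codazzi_p = 0 /\ codazzi_m = 0.
Proof.
move: codazzi_p codazzi_m => P M e1 e2 h1 h2 h3 h4.
have p1 : s * P = 0 by lra.
have p2 : c * P = 0 by lra.
have p3 : S * M = 0 by lra.
have p4 : C * M = 0 by lra.
split.
  have -> : P = c * (c * P) + s * (s * P) by rewrite !mulrA -mulrDl -!expr2 e1 mul1r.
  by rewrite p1 p2 !mulr0 addr0.
have -> : M = C * (C * M) + S * (S * M) by rewrite !mulrA -mulrDl -!expr2 e2 mul1r.
by rewrite p3 p4 !mulr0 addr0.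
Qed.

(** Cramer's rule for the pair of equations, linear in the connection form
    (m1, m2); their determinant is the Jacobian of (f+, f-). *)
Lemma codazzi_cramer (xu xv : R) : pv * mu - mv * pu != 0 -> au = bu - xu -> av = bv - xv ->
  codazzi_p = 0 /\ codazzi_m = 0 <->
  m1 = - bu + (pu * xv - pv * xu) / (pu * mv - pv * mu) * mu
      - (pv * mu - mv * pu)^-1 * (2 * pu * mu * lu + (pv * mu + mv * pu) * lv) /\
  m2 = - bv + (pu * xv - pv * xu) / (pu * mv - pv * mu) * mv
      - (pv * mu - mv * pu)^-1 * ((pv * mu + mv * pu) * lu + 2 * pv * mv * lv).
Proof.
move=> d0 au_ av_.
have d0' : pu * mv - pv * mu != 0.
  by rewrite -oppr_eq0 opprB [pu * mv]mulrC.
rewrite /codazzi_p /codazzi_m au_ av_; split=> [[h1 h2]|[-> ->]]; last first.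
  by split; field; rewrite d0 d0'.
have p1 : pv * (m1 + bu) - pu * (m2 + bv) = xu * pv - xv * pu - lu * pu - lv * pv.
  by apply/eqP; rewrite -subr_eq0 -oppr_eq0; apply/eqP; rewrite -h1; ring.
have p2 : mv * (m1 + bu) - mu * (m2 + bv) = lu * mu + lv * mv.
  by apply/eqP; rewrite -subr_eq0 -oppr_eq0; apply/eqP; rewrite -h2; ring.
have q1 : (pv * mu - mv * pu) * (m1 + bu) =
    mu * (xu * pv - xv * pu - lu * pu - lv * pv) - pu * (lu * mu + lv * mv).
  by rewrite -p1 -p2; ring.
have q2 : (pv * mu - mv * pu) * (m2 + bv) =
    mv * (xu * pv - xv * pu - lu * pu - lv * pv) - pv * (lu * mu + lv * mv).
  by rewrite -p1 -p2; ring.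
split.
  have -> : m1 = (pv * mu - mv * pu)^-1 * ((pv * mu - mv * pu) * (m1 + bu)) - bu.
    by rewrite mulKf // addrK.
  by rewrite q1; field; rewrite d0 d0'.
have -> : m2 = (pv * mu - mv * pu)^-1 * ((pv * mu - mv * pu) * (m2 + bv)) - bv.
  by rewrite mulKf // addrK.
by rewrite q2; field; rewrite d0 d0'.
Qed.

(** The two expressions of al2 and be2 agree as soon as the rotation of angle
    b - a + pi / 2 maps (pv, pu) to (mu, mv); [k] and [l] are the cosine and the
    sine of that angle. *)
Lemma rotation_compat (k l : R) : c = l * C - k * S -> s = k * C + l * S ->
  mu = k * pv - l * pu -> mv = l * pv + k * pu ->
  c * pv - C * mv = - (s * pu) - S * mu /\ c * pu + C * mu = s * pv - S * mv.
Proof. by move=> -> -> -> ->; split; ring. Qed.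

Hypothesis compat :
  c * pv - C * mv = - (s * pu) - S * mu /\ c * pu + C * mu = s * pv - S * mv.

(** Converse: k = s C - c S and l = C c + S s. *)
Lemma compat_rotation : C ^+ 2 + S ^+ 2 = 1 ->
  mu = (s * C - c * S) * pv - (C * c + S * s) * pu /\
  mv = (C * c + S * s) * pv + (s * C - c * S) * pu.
Proof.
case: compat => e1 e2 u.
have f1 : c * pv + s * pu = C * mv - S * mu by lra.
have f2 : c * pu - s * pv = - (C * mu) - S * mv by lra.
split.
  transitivity (- C * (c * pu - s * pv) - S * (c * pv + s * pu)); last ring.
  by rewrite f1 f2 -{1}[mu]mul1r -u; ring.
transitivity (C * (c * pv + s * pu) - S * (c * pu - s * pv)); last ring.
by rewrite f1 f2 -{1}[mv]mul1r -u; ring.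
Qed.

(** Both (c, s) and the rotated pair solve a linear system with determinant
    pu^2 + pv^2. *)
Lemma rotation_unique (k l : R) : pu ^+ 2 + pv ^+ 2 != 0 ->
  mu = k * pv - l * pu -> mv = l * pv + k * pu ->
  c = l * C - k * S /\ s = k * C + l * S.
Proof.
case: compat => e1 e2 n0 mu_ mv_.
have f1 : (c - (l * C - k * S)) * pv + (s - (k * C + l * S)) * pu = 0.
  by move: e1; rewrite mu_ mv_ => e1; lra.
have f2 : (c - (l * C - k * S)) * pu - (s - (k * C + l * S)) * pv = 0.
  by move: e2; rewrite mu_ mv_ => e2; lra.
move: f1 f2; set x := c - _; set y := s - _ => f1 f2.
have x0 : x * (pu ^+ 2 + pv ^+ 2) = 0.
  transitivity ((x * pv + y * pu) * pv + (x * pu - y * pv) * pu); first ring.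
  by rewrite f1 f2 !mul0r addr0.
have y0 : y * (pu ^+ 2 + pv ^+ 2) = 0.
  transitivity ((x * pv + y * pu) * pu - (x * pu - y * pv) * pv); first ring.
  by rewrite f1 f2 !mul0r subr0.
move: x0 y0 => /eqP; rewrite mulf_eq0 (negPf n0) orbF subr_eq0 => /eqP xe /eqP.
by rewrite mulf_eq0 (negPf n0) orbF subr_eq0 => /eqP ye.
Qed.
End CodazziAlgebra.

Section TrigDerivatives.
Context {R : realType}.
Variable O : set (R * R).
Hypothesis oO : open O.
Variables (a b F G : R * R -> R).
Hypotheses (sa : smooth O a) (sb : smooth O b) (sF : smooth O F) (sG : smooth O G).
Variables (i : 'I_2) (p : R * R).
Hypothesis Op : O p.

Let cosM h H : smooth O h -> smooth O H ->
  smooth O (fun q => cos (h q) * H q) /\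
  pd i (fun q => cos (h q) * H q) p = - sin (h p) * pd i h p * H p + cos (h p) * pd i H p.
Proof.
move=> sh sH; split; first by apply: (smoothM oO) => //; exact: smooth_cos.
by rewrite (pdM i (smooth_cos oO sh) sH Op) (pd_cos i sh Op).
Qed.

Let sinM h H : smooth O h -> smooth O H ->
  smooth O (fun q => sin (h q) * H q) /\
  pd i (fun q => sin (h q) * H q) p = cos (h p) * pd i h p * H p + sin (h p) * pd i H p.
Proof.
move=> sh sH; split; first by apply: (smoothM oO) => //; exact: smooth_sin.
by rewrite (pdM i (smooth_sin oO sh) sH Op) (pd_sin i sh Op).
Qed.

Let half (H : R * R -> R) : smooth O H -> pd i (fun q => 2^-1 * H q) p = 2^-1 * pd i H p.
Proof.
by move=> sH; rewrite (pdM i (smooth_cst oO _) sH Op) pd_cst mul0r add0r.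
Qed.

Lemma pd_cosB : pd i (fun q => 2^-1 * (cos (a q) * F q - cos (b q) * G q)) p =
  2^-1 * ((- sin (a p) * pd i a p * F p + cos (a p) * pd i F p)
         + (-1) * (- sin (b p) * pd i b p * G p + cos (b p) * pd i G p)).
Proof.
have [s1 e1] := cosM sa sF; have [s2 e2] := cosM sb sG.
by rewrite half ?(pdB i s1 s2 Op) ?e1 ?e2 ?mulN1r //; apply: (smoothD oO) => //; exact: smoothN.
Qed.

Lemma pd_cosD : pd i (fun q => 2^-1 * (cos (a q) * F q + cos (b q) * G q)) p =
  2^-1 * ((- sin (a p) * pd i a p * F p + cos (a p) * pd i F p)
         + 1 * (- sin (b p) * pd i b p * G p + cos (b p) * pd i G p)).
Proof.
have [s1 e1] := cosM sa sF; have [s2 e2] := cosM sb sG.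
by rewrite half ?(pdD i s1 s2 Op) ?e1 ?e2 ?mul1r //; apply: (smoothD oO).
Qed.

Lemma pd_sinB : pd i (fun q => 2^-1 * (sin (a q) * F q - sin (b q) * G q)) p =
  2^-1 * (1 * (cos (a p) * pd i a p * F p + sin (a p) * pd i F p)
         + (-1) * (cos (b p) * pd i b p * G p + sin (b p) * pd i G p)).
Proof.
have [s1 e1] := sinM sa sF; have [s2 e2] := sinM sb sG.
by rewrite half ?(pdB i s1 s2 Op) ?e1 ?e2 ?mulN1r ?mul1r //; apply: (smoothD oO) => //; exact: smoothN.
Qed.

Lemma pd_sinNB : pd i (fun q => 2^-1 * (- (sin (a q) * F q) - sin (b q) * G q)) p =
  2^-1 * ((-1) * (cos (a p) * pd i a p * F p + sin (a p) * pd i F p)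
         + (-1) * (cos (b p) * pd i b p * G p + sin (b p) * pd i G p)).
Proof.
have [s1 e1] := sinM sa sF; have [s2 e2] := sinM sb sG.
have s3 := smoothN oO s1.
by rewrite half ?(pdB i s3 s2 Op) ?(pdN i s1 Op) ?e1 ?e2 ?mulN1r //; apply: (smoothD oO) => //; exact: smoothN.
Qed.
End TrigDerivatives.

Section TrigSff.
Context {R : realType}.
Variable O : set (R * R).
Hypothesis oO : open O.

(** The second fundamental form in terms of f+ and f- and of angles [a], [b]
    with tangents k+ and k-. *)
Definition sff_of (a b f g : R * R -> R) : sff R := Sff
  (fun p => 2^-1 * (cos (a p) * du f p - cos (b p) * du g p))
  (fun p => 2^-1 * (cos (a p) * dv f p - cos (b p) * dv g p))
  (fun p => 2^-1 * (- (sin (a p) * dv f p) - sin (b p) * dv g p))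
  (fun p => 2^-1 * (sin (a p) * du f p - sin (b p) * du g p))
  (fun p => 2^-1 * (cos (a p) * du f p + cos (b p) * du g p))
  (fun p => 2^-1 * (cos (a p) * dv f p + cos (b p) * dv g p)).

Variables (a b f g : R * R -> R).
Hypotheses (sa : smooth O a) (sb : smooth O b) (sf : smooth O f) (sg : smooth O g).
Let s := sff_of a b f g.

Lemma smooth_sff_of : [/\ smooth O (al1 s), smooth O (al2 s) & smooth O (al3 s)] /\
  [/\ smooth O (be1 s), smooth O (be2 s) & smooth O (be3 s)].
Proof.
have c h k i : smooth O h -> smooth O k -> smooth O (fun q => cos (h q) * pd i k q).
  by move=> sh sk; apply: (smoothM oO); [exact: smooth_cos|exact: smooth_pd].
have d h k i : smooth O h -> smooth O k -> smooth O (fun q => sin (h q) * pd i k q).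
  by move=> sh sk; apply: (smoothM oO); [exact: smooth_sin|exact: smooth_pd].
have n := @smoothN _ _ oO; have D := @smoothD _ _ oO.
have h2 (F : R * R -> R) : smooth O F -> smooth O (fun q => 2^-1 * F q).
  by move=> sF; apply: (smoothM oO) => //; exact: smooth_cst.
by split; split; apply: h2; apply: D; try apply: n; try apply: (c _ _ _ _ _) => //;
  try apply: (d _ _ _ _ _) => //; apply: n; apply: d.
Qed.

Hypothesis compat : forall p, O p ->
  cos (a p) * dv f p - cos (b p) * dv g p = - (sin (a p) * du f p) - sin (b p) * du g p /\
  cos (a p) * du f p + cos (b p) * du g p = sin (a p) * dv f p - sin (b p) * dv g p.

Lemma al2E p : O p -> al2 s p = 2^-1 * (- (sin (a p) * du f p) - sin (b p) * du g p).
Proof. by move=> /compat[e _]; rewrite /s /= e. Qed.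

Lemma be2E p : O p -> be2 s p = 2^-1 * (sin (a p) * dv f p - sin (b p) * dv g p).
Proof. by move=> /compat[_ e]; rewrite /s /= e. Qed.

Variables (lam gam : R * R -> R).

Let P p := codazzi_p (du f p) (dv f p) (du a p) (dv a p) (du lam p) (dv lam p) (du gam p) (dv gam p).
Let M p := codazzi_m (du g p) (dv g p) (du b p) (dv b p) (du lam p) (dv lam p) (du gam p) (dv gam p).

Lemma codazzi_defects p : O p ->
  [/\ dv (al1 s) p - du (al2 s) p - (du lam p * al2 s p + dv lam p * al3 s p
        + be1 s p * dv gam p - be2 s p * du gam p)
        = 2^-1 * (- sin (a p) * P p + sin (b p) * M p),
      dv (be1 s) p - du (be2 s) p - (du lam p * be2 s p + dv lam p * be3 s p
        - al1 s p * dv gam p + al2 s p * du gam p)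
        = 2^-1 * (cos (a p) * P p - cos (b p) * M p),
      dv (al2 s) p - du (al3 s) p - (- du lam p * al1 s p - dv lam p * al2 s p
        + be2 s p * dv gam p - be3 s p * du gam p)
        = 2^-1 * (- cos (a p) * P p - cos (b p) * M p) &
      dv (be2 s) p - du (be3 s) p - (- du lam p * be1 s p - dv lam p * be2 s p
        - al2 s p * dv gam p + al3 s p * du gam p)
        = 2^-1 * (- sin (a p) * P p - sin (b p) * M p)].
Proof.
move=> Op; have pu := @smooth_pd _ _ _ _ 0 sf; have pv := @smooth_pd _ _ _ _ 1 sf.
have mu := @smooth_pd _ _ _ _ 0 sg; have mv := @smooth_pd _ _ _ _ 1 sg.
have suv (f' : R * R -> R) : smooth O f' -> pd 0 (dv f') p = pd 1 (du f') p.
  by move=> s'; have := @schwarz R O oO f' p s' Op.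
have a1v := pd_cosB oO sa sb pu mu 1 Op.
have a2u := pd_cosB oO sa sb pv mv 0 Op.
have b1v := pd_sinB oO sa sb pu mu 1 Op.
have b2u : pd 0 (be2 s) p = _ := etrans (pd_ext oO 0 Op be2E) (pd_sinB oO sa sb pv mv 0 Op).
have a2v : pd 1 (al2 s) p = _ := etrans (pd_ext oO 1 Op al2E) (pd_sinNB oO sa sb pu mu 1 Op).
have a3u := pd_sinNB oO sa sb pv mv 0 Op.
have b2v := pd_cosD oO sa sb pu mu 1 Op.
have b3u := pd_cosD oO sa sb pv mv 0 Op.
rewrite /= (suv f) // (suv g) // in a2u b2u a3u b3u.
split.
- rewrite (al2E Op) (be2E Op).
  rewrite [dv (al1 s) p]a1v [du (al2 s) p]a2u; exact: codazzi1.
- rewrite [dv (be1 s) p]b1v [du (be2 s) p]b2u; exact: codazzi2.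
- rewrite [dv (al2 s) p]a2v [du (al3 s) p]a3u; exact: codazzi3.
- rewrite (al2E Op) (be2E Op).
  rewrite [dv (be2 s) p]b2v [du (be3 s) p]b3u; exact: codazzi4.
Qed.
End TrigSff.

(* [pd] unfolds to a limit, which unification must not look into. *)
#[local] Opaque pd.

(** * Structure equations of a conformal immersion *)
Section FrameDerivatives.
Context {R : realType} {L0 : R}.
Notation vec := 'rV[R]_(adim L0).
Variable O : set (R * R).
Hypothesis oO : open O.

Let add0_opp (x y : R) : x + y = 0 -> x = - y.
Proof. by move=> e; apply/eqP; rewrite -addr_eq0 e. Qed.
Let double_inj (x y z : R) : x + x = 2 * y * z -> x = y * z.
Proof. by move=> e; lra. Qed.
Let zmul (c x : R) : c = 0 -> c * x = 0. Proof. by move=> ->; rewrite mul0r. Qed.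

Definition frame_of (T1 T2 N1 N2 F : vec) : 'M[R]_(5, adim L0) :=
  \matrix_(k, j) (nth 0 [:: T1; T2; N1; N2; F] k : vec) 0 j.

Lemma row_frame_of T1 T2 N1 N2 F k :
  row k (frame_of T1 T2 N1 N2 F) = nth 0 [:: T1; T2; N1; N2; F] k.
Proof. by apply/rowP => j; rewrite !mxE. Qed.

Lemma gram_orthogonal (T1 T2 N1 N2 F : vec) (w : R) : w != 0 ->
  [/\ ip T1 T1 = w, ip T2 T2 = w, ip N1 N1 = w & ip N2 N2 = w] ->
  [/\ ip T1 T2 = 0, ip N1 N2 = 0, ip N1 T1 = 0 & ip N1 T2 = 0] ->
  ip N2 T1 = 0 -> ip N2 T2 = 0 ->
  (L0 != 0 -> [/\ ip T1 F = 0, ip T2 F = 0, ip N1 F = 0, ip N2 F = 0 & ip F F = L0^-1]) ->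
  gram w (frame_of T1 T2 N1 N2 F).
Proof.
move=> w0 [t11 t22 n11 n22] [t12 n12 n1 n2] n3 n4 f.
have L4 : (4 < adim L0)%N -> L0 != 0 by rewrite /adim; case: ifP.
move=> -[[|[|[|[|[|//]]]]] ?] [[|[|[|[|[|//]]]]] ?] /= hk hl; rewrite !row_frame_of /= /weight /=;
  try (have [f1 f2 f3 f4 f5] := f (L4 hk)); try (have [g1 g2 g3 g4 g5] := f (L4 hl));
  rewrite ?t11 ?t22 ?n11 ?n22 ?t12 ?n12 ?n1 ?n2 ?n3 ?n4 ?f1 ?f2 ?f3 ?f4 ?f5 ?g1 ?g2 ?g3 ?g4 ?mulfV ?mul0r ?mulVf ?L4 //;
  rewrite ipC ?t11 ?t22 ?n11 ?n22 ?t12 ?n12 ?n1 ?n2 ?n3 ?n4 ?f1 ?f2 ?f3 ?f4 ?f5 ?g1 ?g2 ?g3 ?g4 ?mul0r //.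
Qed.

Lemma frame_expansion (T1 T2 N1 N2 F x : vec) (w c0 c1 c2 c3 c4 : R) : w != 0 ->
  complete w (frame_of T1 T2 N1 N2 F) ->
  ip x T1 = c0 * w -> ip x T2 = c1 * w -> ip x N1 = c2 * w -> ip x N2 = c3 * w ->
  L0 * ip x F = c4 ->
  x = c0 *: T1 + c1 *: T2 + c2 *: N1 + c3 *: N2 + c4 *: F.
Proof.
move=> w0 C e0 e1 e2 e3 e4; rewrite {1}(resolution x C).
rewrite !big_ord_recl big_ord0 !row_frame_of /weight /= e0 e1 e2 e3 e4 addr0 !addrA.
have d c : w^-1 * (c * w) = c by field.
by rewrite !d.
Qed.

Lemma mulmx_frame_of (c : 'M[R]_5) T1 T2 N1 N2 F k j :
  (c *m frame_of T1 T2 N1 N2 F) k j =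
  (c k 0 *: T1 + c k 1 *: T2 + c k 2 *: N1 + c k 3 *: N2 + c k 4 *: F) 0 j.
Proof.
rewrite !mxE !big_ord_recl big_ord0 !mxE /= addr0 !addrA.
by congr (_ * _ + _ * _ + _ * _ + _ * _ + _ * _); congr (c k _); exact: val_inj.
Qed.

Lemma schwarz_mx m n (F : R * R -> 'M[R]_(m, n)) p : smooth O F -> O p ->
  pd 0 (pd 1 F) p = pd 1 (pd 0 F) p.
Proof.
move=> sF Op; apply/matrixP => k j.
have sj : smooth O (fun q => F q k j) := (smooth_mx oO F).1 sF k j.
have pdj i q : O q -> pd i F q k j = pd i (fun q => F q k j) q by move=> Oq; apply: pd_mx.
apply: (etrans (pd_mx 0 k j (smooth_pd 1 sF) Op)).
apply: (etrans _ (esym (pd_mx 1 k j (smooth_pd 0 sF) Op))).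
apply: (etrans (pd_ext oO 0 Op (pdj 1))).
apply: (etrans _ (esym (pd_ext oO 1 Op (pdj 0)))).
by have := schwarz oO sj Op.
Qed.

Lemma diff_ip i (X Y : R * R -> vec) H p : smooth O X -> smooth O Y -> O p ->
  (forall q, O q -> ip (X q) (Y q) = H q) ->
  ip (pd i X p) (Y p) + ip (pd i Y p) (X p) = pd i H p.
Proof. by move=> sX sY Op e; rewrite [ip (pd i Y p) _]ipC; apply: (etrans (esym (pd_ip oO i sX sY Op))); exact: (pd_ext oO i Op e). Qed.

Variables (lam : R * R -> R) (F N1 N2 : R * R -> vec).
Hypotheses (sF : smooth O F) (sl : smooth O lam).

Lemma pd_metric i p : O p ->
  pd i (fun q => expR (2 * lam q)) p = 2 * pd i lam p * expR (2 * lam p).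
Proof.
move=> Op; have s2 : smooth O (fun q => 2 * lam q).
  by apply: (smoothM oO) => //; exact: smooth_cst.
rewrite (pd_expR i s2 Op) (pdM i (smooth_cst oO _) sl Op) pd_cst mul0r add0r.
by rewrite mulrC.
Qed.

Hypothesis inN : forall p, O p -> in_space_form (F p).
Hypothesis conformal : forall p, O p -> induced_metric F p = (expR (2 * lam p))%:M.
Local Notation W p := (expR (2 * lam p)).
Local Notation T i := (pd i F).

Lemma ip_tangent i j p : O p -> ip (T i p) (T j p) = (i == j)%:R * W p.
Proof.
move=> /conformal/(congr1 (fun M : 'M[R]_2 => M i j)); rewrite !mxE => ->.
by case: eqP => _; rewrite ?mul1r ?mul0r.
Qed.

Lemma ip_radial i p : O p -> L0 * ip (T i p) (F p) = 0.
Proof.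
move=> Op; have [z|L00] := eqVneq L0 0; first exact: zmul.
have e q : O q -> ip (F q) (F q) = L0^-1 by move=> /inN; apply.
have h := etrans (diff_ip i sF sF Op e) (pd_cst i _ p).
have -> : ip (T i p) (F p) = 0 by move: (ip _ _) h => x; lra.
by rewrite mulr0.
Qed.

Lemma ip_dtangent_radial i j p : O p -> L0 * ip (pd i (T j) p) (F p) = - (i == j)%:R * (L0 * W p).
Proof.
move=> Op; have [z|L00] := eqVneq L0 0; first by rewrite !(zmul _ z) mulr0.
have e q : O q -> ip (T j q) (F q) = 0.
  by move=> /(ip_radial j)/eqP; rewrite mulf_eq0 (negPf L00) => /eqP.
have := add0_opp (etrans (diff_ip i (smooth_pd j sF) sF Op e) (pd_cst i _ p)).
by move=> ->; rewrite ip_tangent //; ring.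
Qed.

(** Six derivatives of the relations between tangent vectors and the symmetry of
    second derivatives determine all six products: these are the Christoffel
    symbols of the conformal metric. *)
Lemma ip_dtangent p : O p ->
  [/\ ip (pd 0 (T 0) p) (T 0 p) = pd 0 lam p * W p,
      ip (pd 0 (T 0) p) (T 1 p) = - pd 1 lam p * W p,
      ip (pd 1 (T 1) p) (T 0 p) = - pd 0 lam p * W p &
      ip (pd 1 (T 1) p) (T 1 p) = pd 1 lam p * W p] /\
  ip (pd 0 (T 1) p) (T 0 p) = pd 1 lam p * W p /\
  ip (pd 0 (T 1) p) (T 1 p) = pd 0 lam p * W p.
Proof.
move=> Op; have s i := smooth_pd i sF.
have d k i : ip (pd k (T i) p) (T i p) = pd k lam p * W p.
  have e q : O q -> ip (T i q) (T i q) = W q by move=> Oq; rewrite ip_tangent // eqxx mul1r.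
  exact: double_inj (etrans (diff_ip k (s i) (s i) Op e) (pd_metric k Op)).
have o k : ip (pd k (T 0) p) (T 1 p) = - ip (pd k (T 1) p) (T 0 p).
  have e q : O q -> ip (T 0 q) (T 1 q) = 0 by move=> Oq; rewrite ip_tangent // mul0r.
  exact: add0_opp (etrans (diff_ip k (s 0) (s 1) Op e) (pd_cst k 0 p)).
have c := schwarz_mx sF Op.
have c0 : ip (pd 0 (T 1) p) (T 0 p) = pd 1 lam p * W p.
  exact: (etrans (congr1 (fun x => ip x (T 0 p)) c) (d 1 0)).
have c1 : ip (pd 0 (T 1) p) (T 1 p) = - ip (pd 1 (T 1) p) (T 0 p).
  exact: (etrans (congr1 (fun x => ip x (T 1 p)) c) (o 1)).
have o0 := etrans (o 0) (congr1 -%R c0).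
have o1 := etrans (esym (opprK _)) (congr1 -%R (etrans (esym c1) (d 0 1))).
split; first by split; [exact: (d 0 0)|rewrite mulNr; exact: o0|rewrite mulNr; exact: o1|exact: (d 1 1)].
split; [exact: c0|exact: (d 0 1)].
Qed.

Hypothesis hN : normal_frame O lam F N1 N2.

Let N1s : smooth O N1. Proof. by case: hN => -[]. Qed.
Let N2s : smooth O N2. Proof. by case: hN => _ []. Qed.

Lemma ip_normal_tangent i p : O p -> ip (N1 p) (T i p) = 0 /\ ip (N2 p) (T i p) = 0.
Proof. by move=> Op; case: hN => -[_ h1] [_ h2] _; have [_ ->] := h1 p Op; have [_ ->] := h2 p Op. Qed.

Lemma ip_normal_radial p : O p -> L0 * ip (N1 p) (F p) = 0 /\ L0 * ip (N2 p) (F p) = 0.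
Proof.
move=> Op; have [z|L00] := eqVneq L0 0; first by split; exact: zmul.
by case: hN => -[_ h1] [_ h2] _; have [-> //] := h1 p Op; have [-> //] := h2 p Op; rewrite mulr0.
Qed.

Lemma W_neq0 p : W p != 0. Proof. by rewrite gt_eqF ?expR_gt0. Qed.

Lemma gram_frame p : O p -> gram (W p) (frame_of (T 0 p) (T 1 p) (N1 p) (N2 p) (F p)).
Proof.
move=> Op; have [n11 n22 n12] : [/\ ip (N1 p) (N1 p) = W p, ip (N2 p) (N2 p) = W p & ip (N1 p) (N2 p) = 0].
  by case: hN => _ _; apply.
have [n1 n2] := ip_normal_tangent 0 Op; have [n3 n4] := ip_normal_tangent 1 Op.
have t i j := ip_tangent i j Op.
have [r1 r2] := ip_normal_radial Op; have r i := ip_radial i Op.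
have z x : L0 != 0 -> L0 * x = 0 -> x = 0.
  by move=> L00 /eqP; rewrite mulf_eq0 (negPf L00) => /eqP.
have t00 := etrans (t 0 0) (mul1r _); have t11 := etrans (t 1 1) (mul1r _).
have t01 := etrans (t 0 1) (mul0r _).
apply: (gram_orthogonal (W_neq0 p)) => // L00.
split; [exact: z (r 0)|exact: z (r 1)|exact: z r1|exact: z r2|exact: inN Op L00].
Qed.

Lemma complete_frame p : O p ->
  complete (W p) (frame_of (T 0 p) (T 1 p) (N1 p) (N2 p) (F p)).
Proof. by move=> /gram_frame/gram_complete. Qed.

(** Against a normal vector, the projections in [nabla] and [normal_part] are
    invisible. *)
Lemma ip_normal_part i V p (nu : vec) : ip nu (T 0 p) = 0 -> ip nu (T 1 p) = 0 ->
  L0 * ip nu (F p) = 0 -> ip (normal_part F p (nabla F i V p)) nu = ip (pd i V p) nu.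
Proof.
move=> h0 h1 hF; rewrite /normal_part /nabla ipBl ip_suml big1 ?subr0 => [|k _].
  by rewrite ipBl ipZl [ip (F p) _]ipC mulrAC hF mul0r subr0.
rewrite ip_suml big1 // => l _; rewrite ipZl [ip _ nu]ipC.
suff -> : ip nu (pd k F p) = 0 by rewrite mulr0.
by case: k => [[|[|//]] kk]; [rewrite -h0|rewrite -h1]; congr (ip _ (pd _ _ _)); exact: val_inj.
Qed.

Lemma ip_normal_components i V p x y : O p ->
  normal_part F p (nabla F i V p) = x *: N1 p + y *: N2 p ->
  ip (pd i V p) (N1 p) = x * W p /\ ip (pd i V p) (N2 p) = y * W p.
Proof.
move=> Op; have [n11 n22 n12] : [/\ ip (N1 p) (N1 p) = W p, ip (N2 p) (N2 p) = W p & ip (N1 p) (N2 p) = 0].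
  by case: hN => _ _; apply.
have [n1 n2] := ip_normal_tangent 0 Op; have [n3 n4] := ip_normal_tangent 1 Op.
have [r1 r2] := ip_normal_radial Op => e.
rewrite -(ip_normal_part i V n1 n3 r1) -(ip_normal_part i V n2 n4 r2) e.
by rewrite !ipDl !ipZl [ip (N2 p) (N1 p)]ipC n11 n22 n12 !mulr0 addr0 add0r.
Qed.

Variables (s : sff R) (m1 m2 : R * R -> R).
Hypotheses (hs : is_sff O F N1 N2 s) (hc : is_normal_connection O lam F N1 N2 m1 m2).

Lemma ip_dtangent_normal p : O p ->
  [/\ ip (pd 0 (T 0) p) (N1 p) = al1 s p * W p /\ ip (pd 0 (T 0) p) (N2 p) = be1 s p * W p,
      ip (pd 0 (T 1) p) (N1 p) = al2 s p * W p /\ ip (pd 0 (T 1) p) (N2 p) = be2 s p * W p &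
      ip (pd 1 (T 1) p) (N1 p) = al3 s p * W p /\ ip (pd 1 (T 1) p) (N2 p) = be3 s p * W p].
Proof.
by move=> Op; have [e1 e2 e3] := hs Op; split; [exact: ip_normal_components e1|exact: ip_normal_components e2|exact: ip_normal_components e3].
Qed.

Lemma ip_dnormal p : O p ->
  [/\ ip (pd 0 N1 p) (N1 p) = du lam p * W p /\ ip (pd 0 N1 p) (N2 p) = m1 p * W p,
      ip (pd 0 N2 p) (N1 p) = - m1 p * W p /\ ip (pd 0 N2 p) (N2 p) = du lam p * W p,
      ip (pd 1 N1 p) (N1 p) = dv lam p * W p /\ ip (pd 1 N1 p) (N2 p) = m2 p * W p &
      ip (pd 1 N2 p) (N1 p) = - m2 p * W p /\ ip (pd 1 N2 p) (N2 p) = dv lam p * W p].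
Proof.
move=> Op; have [e1 e2 e3 e4] := hc Op.
by split; [exact: ip_normal_components e1|exact: ip_normal_components e2|exact: ip_normal_components e3|exact: ip_normal_components e4].
Qed.

Lemma ip_dnormal_tangent i j p : O p ->
  ip (pd i N1 p) (T j p) = - ip (pd i (T j) p) (N1 p) /\
  ip (pd i N2 p) (T j p) = - ip (pd i (T j) p) (N2 p).
Proof.
move=> Op; split.
  have e q : O q -> ip (N1 q) (T j q) = 0 by move=> Oq; have [] := ip_normal_tangent j Oq.
  exact: add0_opp (etrans (diff_ip i N1s (smooth_pd j sF) Op e) (pd_cst i _ p)).
have e q : O q -> ip (N2 q) (T j q) = 0 by move=> Oq; have [] := ip_normal_tangent j Oq.
exact: add0_opp (etrans (diff_ip i N2s (smooth_pd j sF) Op e) (pd_cst i _ p)).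
Qed.

Lemma ip_dnormal_radial i p : O p ->
  L0 * ip (pd i N1 p) (F p) = 0 /\ L0 * ip (pd i N2 p) (F p) = 0.
Proof.
move=> Op; have [z|L00] := eqVneq L0 0; first by split; exact: zmul.
have z x : L0 * x = 0 -> x = 0.
  by move=> /eqP; rewrite mulf_eq0 (negPf L00) => /eqP.
have [t1 t2] := ip_normal_tangent i Op.
have e1 q : O q -> ip (N1 q) (F q) = 0 by move=> Oq; have [/z] := ip_normal_radial Oq.
have e2 q : O q -> ip (N2 q) (F q) = 0 by move=> Oq; have [_ /z] := ip_normal_radial Oq.
have h1 := add0_opp (etrans (diff_ip i N1s sF Op e1) (pd_cst i _ p)).
have h2 := add0_opp (etrans (diff_ip i N2s sF Op e2) (pd_cst i _ p)).
by rewrite h1 h2 ![ip (T i p) _]ipC t1 t2 oppr0 mulr0.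
Qed.

Definition frame p := frame_of (T 0 p) (T 1 p) (N1 p) (N2 p) (F p).
Definition omega_u p := conn_u 1 (L0 * W p) (du lam p) (dv lam p)
  (al1 s p) (al2 s p) (be1 s p) (be2 s p) (m1 p).
Definition omega_v p := conn_v 1 (L0 * W p) (du lam p) (dv lam p)
  (al2 s p) (al3 s p) (be2 s p) (be3 s p) (m2 p).

Lemma is_derive_frame i p (c : 'M[R]_5) : O p ->
  (forall k : 'I_5, nth 0 [:: pd i (T 0) p; pd i (T 1) p; pd i N1 p; pd i N2 p; T i p] k =
    c k 0 *: T 0 p + c k 1 *: T 1 p + c k 2 *: N1 p + c k 3 *: N2 p + c k 4 *: F p) ->
  is_derive p (if i == 0 :> 'I_2 then (1, 0) else (0, 1)) frame (c *m frame p).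
Proof.
move=> Op H; have D (X : R * R -> vec) j : smooth O X ->
    is_derive p (if i == 0 :> 'I_2 then (1, 0) else (0, 1)) (fun q => X q 0 j) (pd i X p 0 j).
  by move=> sX; exact: (is_derive_mx _ _ _ _).1 (smooth_is_derive i sX Op) 0 j.
apply/is_derive_mx => k j.
have -> : (c *m frame p) k j = (nth 0 [:: pd i (T 0) p; pd i (T 1) p; pd i N1 p; pd i N2 p; T i p] k : vec) 0 j.
  by rewrite mulmx_frame_of H.
have -> : (fun y => frame y k j) = (fun y => (nth 0 [:: T 0 y; T 1 y; N1 y; N2 y; F y] k : vec) 0 j).
  by apply/funext => y; rewrite mxE.
move: k {H} => -[[|[|[|[|[|//]]]]] ?] /=; apply: D => //; exact: smooth_pd.
Qed.

(** The moving frame solves a linear system whose coefficients only involve the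
    data: all inner products of its derivatives with the frame are determined by
    the metric, the second fundamental form and the normal connection, and
    [frame_expansion] recovers the derivatives from them. *)
Lemma structure_equations p : O p ->
  is_derive p (1, 0) frame (omega_u p *m frame p) /\
  is_derive p (0, 1) frame (omega_v p *m frame p).
Proof.
move=> Op; have C := frame_expansion (W_neq0 p) (complete_frame Op).
have [[t000 t001 t110 t111] [t010 t011]] := ip_dtangent Op.
have [[a1 b1] [a2 b2] [a3 b3]] := ip_dtangent_normal Op.
have [[n1 n2] [n3 n4] [n5 n6] [n7 n8]] := ip_dnormal Op.
have nr i := ip_dnormal_radial i Op.
have tr0 : L0 * ip (pd 0 (T 0) p) (F p) = - (L0 * W p) := etrans (ip_dtangent_radial 0 0 Op) (mulN1r _).
have tr2 : L0 * ip (pd 1 (T 1) p) (F p) = - (L0 * W p) := etrans (ip_dtangent_radial 1 1 Op) (mulN1r _).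
have tr1 : L0 * ip (pd 0 (T 1) p) (F p) = 0.
  by rewrite (ip_dtangent_radial 0 1 Op) oppr0 mul0r.
have c := schwarz_mx sF Op.
have opp (x y z : R) : x = - y -> y = z * W p -> x = - z * W p by move=> -> ->; rewrite mulNr.
have nt i j := ip_dnormal_tangent i j Op.
have q00 := opp _ _ _ (nt 0 0).1 a1; have q01 := opp _ _ _ (nt 0 1).1 a2.
have r00 := opp _ _ _ (nt 0 0).2 b1; have r01 := opp _ _ _ (nt 0 1).2 b2.
have q11 := opp _ _ _ (nt 1 1).1 a3; have r11 := opp _ _ _ (nt 1 1).2 b3.
have q10 := opp _ _ _ (nt 1 0).1 (etrans (congr1 (fun x => ip x (N1 p)) (esym c)) a2).
have r10 := opp _ _ _ (nt 1 0).2 (etrans (congr1 (fun x => ip x (N2 p)) (esym c)) b2).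
split.
  apply: (is_derive_frame (i := 0) Op).
  move=> -[[|[|[|[|[|//]]]]] ?] /=; rewrite !mxE /=.
  - exact: C t000 t001 a1 b1 tr0.
  - exact: C t010 t011 a2 b2 tr1.
  - exact: C q00 q01 n1 n2 (nr 0).1.
  - exact: C r00 r01 n3 n4 (nr 0).2.
  - by rewrite scale1r !scale0r !addr0.
apply: (is_derive_frame (i := 1) Op).
move=> -[[|[|[|[|[|//]]]]] ?] /=; rewrite !mxE /=.
- exact: etrans (esym c) (C _ _ _ _ _ _ t010 t011 a2 b2 tr1).
- exact: C t110 t111 a3 b3 tr2.
- exact: C q10 q11 n5 n6 (nr 1).1.
- exact: C r10 r11 n7 n8 (nr 1).2.
- by rewrite scale1r !scale0r !addr0 add0r.
Qed.

End FrameDerivatives.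

(** * Curvature of a conformal metric *)
Section ConformalCurvature.
Context {R : realType}.
Variable O : set (R * R).
Hypothesis oO : open O.
Variables (lam : R * R -> R) (G : R * R -> 'M[R]_2).
Hypothesis sl : smooth O lam.
Hypothesis GE : forall p, O p -> G p = (expR (2 * lam p))%:M.
Local Notation W p := (expR (2 * lam p)).

Let s i := smooth_pd i sl.

Lemma pd_conformal i j l p : O p ->
  pd i (fun q => G q j l) p = (j == l)%:R * (2 * pd i lam p * W p).
Proof.
move=> Op; have e q : O q -> G q j l = (j == l)%:R * W q.
  by move=> /GE ->; rewrite mxE; case: eqP => _; rewrite ?mul1r ?mul0r.
apply: (etrans (pd_ext oO i Op e)).
have sW : smooth O (fun q => W q).
  by apply: (smooth_expR oO); apply: (smoothM oO) => //; exact: smooth_cst.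
apply: (etrans (pdM i (smooth_cst oO _) sW Op)).
by rewrite pd_cst mul0r add0r (pd_metric oO sl).
Qed.

Lemma christoffel_conformal k i j p : O p -> christoffel G k i j p =
  (j == k)%:R * pd i lam p + (i == k)%:R * pd j lam p - (i == j)%:R * pd k lam p.
Proof.
move=> Op; have W0 := W_neq0 lam p.
rewrite /christoffel (bigD1 k) //= big1 => [|l lk]; rewrite GE // invmx_scalar mxE.
  rewrite eqxx mulr1n !pd_conformal // addr0.
  by move: (pd i lam p) (pd j lam p) (pd k lam p) (W p) W0 => x y z w w0; field.
by rewrite eq_sym (negPf lk) mulr0n mul0r.
Qed.

(** Liouville's formula; condition (i) says that this curvature is L0. *)
Lemma curvature_conformal p : O p ->
  curvature G p = - (du (du lam) p + dv (dv lam) p) / W p.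
Proof.
move=> Op; have W0 := W_neq0 lam p.
have c k i j := christoffel_conformal k i j Op.
have d k i j h : pd h (christoffel G k i j) p =
    (j == k)%:R * pd h (pd i lam) p + (i == k)%:R * pd h (pd j lam) p - (i == j)%:R * pd h (pd k lam) p.
  apply: (etrans (pd_ext oO h Op (fun q => @christoffel_conformal k i j q))).
  have m (x : R) l : smooth O (fun q => x * pd l lam q) /\
      pd h (fun q => x * pd l lam q) p = x * pd h (pd l lam) p.
    split; first by apply: (smoothM oO) => //; exact: smooth_cst.
    by apply: (etrans (pdM h (smooth_cst oO x) (s l) Op)); rewrite pd_cst mul0r add0r.
  have [m1 e1] := m (j == k)%:R i; have [m2 e2] := m (i == k)%:R j.
  have [m3 e3] := m (i == j)%:R k.
  apply: (etrans (pdB h (smoothD oO m1 m2) m3 Op)).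
  apply: (congr2 (fun x y => x - y) _ e3).
  exact: (etrans (pdD h m1 m2 Op) (congr2 +%R e1 e2)).
have sum2 (f : 'I_2 -> R) : \sum_(k < 2) f k = f 0 + f 1.
  by rewrite !big_ord_recl big_ord0 addr0; congr (_ + f _); exact: val_inj.
have G00 : G p 0 0 = W p by rewrite GE // mxE mulr1n.
have G10 : G p 1 0 = 0 by rewrite GE // mxE mulr0n.
have detG : \det (G p) = W p * W p by rewrite GE // det_scalar -expr2.
have c011 : christoffel G 0 1 1 p = - pd 0 lam p by rewrite c /= !mul0r mul1r add0r add0r.
have c111 : christoffel G 1 1 1 p = pd 1 lam p by rewrite c /= !mul1r addrK.
have c001 : christoffel G 0 0 1 p = pd 1 lam p by rewrite c /= !mul0r mul1r add0r subr0.
have c010 : christoffel G 0 1 0 p = pd 1 lam p by rewrite c /= !mul0r mul1r addr0 subr0.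
have c101 : christoffel G 1 0 1 p = pd 0 lam p by rewrite c /= !mul0r mul1r addr0 subr0.
have c000 : christoffel G 0 0 0 p = pd 0 lam p by rewrite c /= !mul1r addrK.
have d011 : pd 0 (christoffel G 0 1 1) p = - pd 0 (pd 0 lam) p.
  by rewrite d /= !mul0r mul1r add0r add0r.
have d001 : pd 1 (christoffel G 0 0 1) p = pd 1 (pd 1 lam) p.
  by rewrite d /= !mul0r mul1r add0r subr0.
rewrite /curvature sum2 G00 G10 detG mulr0 addr0 /riemann_uvv sum2 c011 c111 c001 c010 c101 c000.
rewrite /du /dv d011 d001.
move: (pd 0 (pd 0 lam) p) (pd 1 (pd 1 lam) p) (pd 0 lam p) (pd 1 lam p) (W p) W0 => x y z t w w0.
by field.
Qed.
End ConformalCurvature.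

(** * Flatness of the connection *)
Section Codazzi.
Context {R : realType} {L0 : R}.
Notation vec := 'rV[R]_(adim L0).
Variable O : set (R * R).
Hypothesis oO : open O.
Variables (lam gam : R * R -> R) (s : sff R).
Hypotheses (sl : smooth O lam) (sg : smooth O gam).
Hypothesis ss : [/\ smooth O (al1 s), smooth O (al2 s) & smooth O (al3 s)] /\
  [/\ smooth O (be1 s), smooth O (be2 s) & smooth O (be3 s)].
Local Notation W p := (expR (2 * lam p)).
Local Notation Omu := (@omega_u R L0 lam s (du gam)).
Local Notation Omv := (@omega_v R L0 lam s (dv gam)).

Lemma smooth_metric : smooth O (fun q => W q).
Proof. by apply: (smooth_expR oO); apply: (smoothM oO) => //; exact: smooth_cst. Qed.

Let sz : smooth O (fun q => L0 * W q).
Proof. by apply: (smoothM oO); [exact: smooth_cst|exact: smooth_metric]. Qed.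

Lemma smooth_omega : smooth O Omu /\ smooth O Omv.
Proof.
have [[s1 s2 s3] [s4 s5 s6]] := ss; have p i := smooth_pd i sl; have g i := smooth_pd i sg.
split; first exact: (smooth_conn_u oO sz (p 0) (p 1) s1 s2 s4 s5 (g 0)).
exact: (smooth_conn_v oO sz (p 0) (p 1) s2 s3 s5 s6 (g 1)).
Qed.

Let dz i p : O p -> is_derive p (if i == 0 :> 'I_2 then (1, 0) else (0, 1)) (fun q => L0 * W q)
  (2 * pd i lam p * (L0 * W p)).
Proof.
move=> Op; apply: (is_derive_eq (smooth_is_derive i sz Op)).
apply: (etrans (pdM i (smooth_cst oO _) smooth_metric Op)).
rewrite pd_cst mul0r add0r (pd_metric oO sl) //; exact: mulrCA.
Qed.

Lemma pd_omega p : O p ->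
  pd 1 Omu p = conn_u 0 (2 * dv lam p * (L0 * W p)) (pd 0 (pd 1 lam) p) (pd 1 (pd 1 lam) p)
    (dv (al1 s) p) (dv (al2 s) p) (dv (be1 s) p) (dv (be2 s) p) (pd 0 (pd 1 gam) p) /\
  pd 0 Omv p = conn_v 0 (2 * du lam p * (L0 * W p)) (pd 0 (pd 0 lam) p) (pd 0 (pd 1 lam) p)
    (du (al2 s) p) (du (al3 s) p) (du (be2 s) p) (du (be3 s) p) (pd 0 (pd 1 gam) p).
Proof.
move=> Op; have [[s1 s2 s3] [s4 s5 s6]] := ss; have g i := smooth_pd i sg.
have pl i := smooth_pd i sl.
have D (h : R * R -> R) i : smooth O h ->
    is_derive p (if i == 0 :> 'I_2 then (1, 0) else (0, 1)) h (pd i h p).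
  by move=> sh; exact: smooth_is_derive.
have sw (h : R * R -> R) : smooth O h -> pd 0 (pd 1 h) p = pd 1 (pd 0 h) p.
  by move=> sh; have := schwarz oO sh Op.
split.
  rewrite (sw lam) // (sw gam) //; apply: (pd_val (i := 1)).
  exact: (is_derive_conn_u (dz 1 Op) (D _ 1 (pl 0)) (D _ 1 (pl 1)) (D _ 1 s1) (D _ 1 s2)
    (D _ 1 s4) (D _ 1 s5) (D _ 1 (g 0))).
apply: (pd_val (i := 0)).
exact: (is_derive_conn_v (dz 0 Op) (D _ 0 (pl 0)) (D _ 0 (pl 1)) (D _ 0 s2) (D _ 0 s3)
    (D _ 0 s5) (D _ 0 s6) (D _ 0 (g 1))).
Qed.

Definition codazzi p := [/\
  dv (al1 s) p - du (al2 s) p = du lam p * al2 s p + dv lam p * al3 s p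
        + be1 s p * dv gam p - be2 s p * du gam p,
  dv (be1 s) p - du (be2 s) p = du lam p * be2 s p + dv lam p * be3 s p
        - al1 s p * dv gam p + al2 s p * du gam p,
  dv (al2 s) p - du (al3 s) p = - du lam p * al1 s p - dv lam p * al2 s p
        + be2 s p * dv gam p - be3 s p * du gam p &
  dv (be2 s) p - du (be3 s) p = - du lam p * be1 s p - dv lam p * be2 s p
        - al2 s p * dv gam p + al3 s p * du gam p].

Lemma omega_integrable p : O p ->
  du (du lam) p + dv (dv lam) p + L0 * W p = 0 ->
  al1 s p * al3 s p + be1 s p * be3 s p = al2 s p ^+ 2 + be2 s p ^+ 2 ->
  al1 s p * be2 s p + al2 s p * be3 s p = al2 s p * be1 s p + al3 s p * be2 s p ->
  codazzi p -> dv Omu p + Omu p *m Omv p = du Omv p + Omv p *m Omu p.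
Proof.
move=> Op e1 e2 e3 [c1 c2 c3 c4]; have [p1 p2] := pd_omega Op.
rewrite [dv Omu p]p1 [du Omv p]p2; apply/eqP; rewrite -subr_eq0; apply/eqP.
exact: (structure_integrable (pd 0 (pd 1 lam) p) e1 e2 e3 erefl c1 c2 c3 c4).
Qed.

(** Equality of the mixed second derivatives of the frame makes the curvature
    matrix annihilate the frame; its entries in the normal columns, which are the
    Codazzi equations, vanish because the frame is orthogonal. *)
Lemma codazzi_of_frame (T1 T2 N1 N2 F : R * R -> vec) p : O p ->
  (forall q, O q -> gram (W q) (frame_of (T1 q) (T2 q) (N1 q) (N2 q) (F q))) ->
  smooth O (fun q => frame_of (T1 q) (T2 q) (N1 q) (N2 q) (F q)) ->
  (forall q, O q ->
    is_derive q (1, 0) (fun q => frame_of (T1 q) (T2 q) (N1 q) (N2 q) (F q))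
      (Omu q *m frame_of (T1 q) (T2 q) (N1 q) (N2 q) (F q)) /\
    is_derive q (0, 1) (fun q => frame_of (T1 q) (T2 q) (N1 q) (N2 q) (F q))
      (Omv q *m frame_of (T1 q) (T2 q) (N1 q) (N2 q) (F q))) ->
  codazzi p.
Proof.
set E := fun q => _; move=> Op gE sE dE.
have [sOu sOv] := smooth_omega.
have pu q : O q -> pd 0 E q = Omu q *m E q by move=> /dE[h _]; exact: (pd_val (i := 0)).
have pv q : O q -> pd 1 E q = Omv q *m E q by move=> /dE[_ h]; exact: (pd_val (i := 1)).
have e1 : pd 1 (pd 0 E) p = pd 1 Omu p *m E p + Omu p *m (Omv p *m E p).
  apply: (etrans (pd_ext oO 1 Op pu)); apply: (pd_val (i := 1)).
  exact: (is_derive_mulmx (smooth_is_derive 1 sOu Op) (dE p Op).2).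
have e2 : pd 0 (pd 1 E) p = pd 0 Omv p *m E p + Omv p *m (Omu p *m E p).
  apply: (etrans (pd_ext oO 0 Op pv)); apply: (pd_val (i := 0)).
  exact: (is_derive_mulmx (smooth_is_derive 0 sOv Op) (dE p Op).1).
have e := etrans (esym e1) (etrans (esym (schwarz_mx oO sE Op)) e2).
have {}e : (pd 1 Omu p + Omu p *m Omv p - (pd 0 Omv p + Omv p *m Omu p)) *m E p = 0.
  rewrite mulmxBl !mulmxDl -!mulmxA; apply/eqP; rewrite subr_eq0; apply/eqP; exact: e.
have [p1 p2] := pd_omega Op; rewrite p1 p2 in e.
have [c02 c03 c12 c13 [c04 c14]] := curvature_entries (L0 * W p) (du lam p) (dv lam p)
  (pd 0 (pd 0 lam) p) (pd 0 (pd 1 lam) p) (pd 1 (pd 1 lam) p)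
  (al1 s p) (al2 s p) (al3 s p) (be1 s p) (be2 s p) (be3 s p) (du gam p) (dv gam p)
  (dv (al1 s) p) (dv (al2 s) p) (dv (be1 s) p) (dv (be2 s) p) (pd 0 (pd 1 gam) p)
  (du (al2 s) p) (du (al3 s) p) (du (be2 s) p) (du (be3 s) p) (pd 0 (pd 1 gam) p).
move: e c02 c03 c12 c13 c04 c14; set D := _ - _ => e c02 c03 c12 c13 c04 c14.
have W0 := W_neq0 lam p.
clearbody D.
have gEp : gram (W p) (E p) := gE p Op.
have independent (k l : 'I_5) : D k 4 = 0 -> (l < 4)%N -> D k l = 0.
  move=> D4 l4; 
  have z : ip (row k (D *m E p)) (row l (E p)) * weight (L0 := L0) (W p) l = 0.
    by rewrite e row0 ip0l mul0r.
  by rewrite -z (gram_coord gEp).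
rewrite (independent 0 2 c04 isT) in c02; rewrite (independent 0 3 c04 isT) in c03.
rewrite (independent 1 2 c14 isT) in c12; rewrite (independent 1 3 c14 isT) in c13.
by split; apply/eqP; rewrite -subr_eq0; apply/eqP; apply: esym.
Qed.

End Codazzi.

(** * Angles, and the functions attached to an immersion *)
Section AngleAlgebra.
Context {R : realType}.

(** The relations defining k+, k-, f+ and f- give all of X, Y, Z, W; their sums
    and differences give the second fundamental form, in two ways for al2 and
    be2. *)
Lemma sff_of_signs (a1 a2 a3 b1 b2 b3 k l c s C S pu pv mu mv : R) :
  s = k * c -> S = l * C ->
  a2 - b1 = k * - (b2 + a1) /\ b2 - a3 = k * (a2 + b3) ->
  a2 + b1 = l * - (b2 - a1) /\ b2 + a3 = l * (a2 - b3) ->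
  a2 + b3 = pv * c /\ b2 + a1 = pu * c ->
  a2 - b3 = - (mv * C) /\ b2 - a1 = mu * C ->
  [/\ a1 = 2^-1 * (c * pu - C * mu), a2 = 2^-1 * (c * pv - C * mv)
    & a3 = 2^-1 * (- (s * pv) - S * mv)] /\
  [/\ b1 = 2^-1 * (s * pu - S * mu), b2 = 2^-1 * (c * pu + C * mu)
    & b3 = 2^-1 * (c * pv + C * mv)] /\
  (c * pv - C * mv = - (s * pu) - S * mu /\ c * pu + C * mu = s * pv - S * mv).
Proof.
move=> sE SE [e1 e2] [e3 e4] [e5 e6] [e7 e8].
rewrite e6 in e1; rewrite e5 in e2; rewrite e8 in e3; rewrite e7 in e4.
have f1 : a2 - b1 = - (s * pu) by rewrite e1 sE; ring.
have f2 : b2 - a3 = s * pv by rewrite e2 sE; ring.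
have f3 : a2 + b1 = - (S * mu) by rewrite e3 SE; ring.
have f4 : b2 + a3 = - (S * mv) by rewrite e4 SE; ring.
rewrite mulrC in e5; rewrite mulrC in e6; rewrite mulrC in e7; rewrite mulrC in e8.
clear e1 e2 e3 e4 sE SE k l.
move: (c * pu) (c * pv) (C * mu) (C * mv) (s * pu) (s * pv) (S * mu) (S * mv) e5 e6 e7 e8 f1 f2 f3 f4.
move=> x1 x2 x3 x4 y1 y2 y3 y4 *.
by split; [split|split; [split|split]]; lra.
Qed.

Variables (c s C S k l pu pv mu mv : R).
Hypotheses (cE : c = l * C - k * S) (sE : s = k * C + l * S).
Hypotheses (muE : mu = k * pv - l * pu) (mvE : mv = l * pv + k * pu).

Lemma kp_num_algebra : (pu * mu - pv * mv) * S - (pv * mu + mv * pu) * C =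
  - ((pu ^+ 2 + pv ^+ 2) * s).
Proof. by rewrite sE muE mvE; ring. Qed.

Lemma kp_den_algebra : (pv * mu + mv * pu) * S + (pu * mu - pv * mv) * C =
  - ((pu ^+ 2 + pv ^+ 2) * c).
Proof. by rewrite cE muE mvE; ring. Qed.
End AngleAlgebra.

Section Angles.
Context {R : realType}.
Implicit Type x : R.

Lemma sin_atan_cos x : sin (atan x) = x * cos (atan x).
Proof.
have c0 : cos (atan x) != 0.
  by rewrite cos_atan invr_eq0 sqrtr_eq0 -ltNge ltr_wpDr ?sqr_ge0.
by rewrite -{2}[x]atanK /tan divfK.
Qed.

Lemma atan_tan x : - (pi / 2) < x < pi / 2 -> atan (tan x) = x.
Proof. by move=> h; rewrite tanK // in_itv. Qed.

Lemma tan_eq0 x : - (pi / 2) < x < pi / 2 -> (tan x == 0) = (x == 0).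
Proof.
move=> h; apply/eqP/eqP => [e|->]; last exact: tan0.
by rewrite -(atan_tan h) e atan0.
Qed.

Lemma angle_shift (b psi : R) :
  cos (b - psi + pi / 2) = sin psi * cos b - cos psi * sin b /\
  sin (b - psi + pi / 2) = cos psi * cos b + sin psi * sin b.
Proof. by rewrite cosDpihalf sinDpihalf sinB cosB; split; ring. Qed.

End Angles.

Lemma smooth_frame_of (R : realType) (L0 : R) (O : set (R * R))
    (T1 T2 N1 N2 F : R * R -> 'rV[R]_(adim L0)) : open O ->
  smooth O T1 -> smooth O T2 -> smooth O N1 -> smooth O N2 -> smooth O F ->
  smooth O (fun q => frame_of (T1 q) (T2 q) (N1 q) (N2 q) (F q)).
Proof.
move=> oO s1 s2 s3 s4 s5; apply/(smooth_mx oO) => k j.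
apply: (smooth_ext oO (f := fun q => (nth 0 [:: T1 q; T2 q; N1 q; N2 q; F q] k : 'rV[R]_(adim L0)) 0 j)).
  by move=> q _; rewrite mxE.
by case: k => -[|[|[|[|[|//]]]]] ? /=; exact: (smooth_coord oO).
Qed.

Section Necessary.
Context {R : realType} {L0 : R}.
Variables (O : set (R * R)) (F N1 N2 : R * R -> 'rV[R]_(adim L0)) (s : sff R).
Variables (lam gam kp km thm fp fm : R * R -> R).
Hypothesis oO : open O.
Hypothesis att : attached O F N1 N2 s lam gam kp km thm fp fm.

Let a0 p := atan (kp p).

(** With a = arctan k+ and b = theta-, the square roots become cosines. *)
Lemma attached_sff p : O p ->
  let t := sff_of a0 thm fp fm in
  [/\ al1 s p = al1 t p, al2 s p = al2 t p & al3 s p = al3 t p] /\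
  [/\ be1 s p = be1 t p, be2 s p = be2 t p & be3 s p = be3 t p] /\
  (cos (a0 p) * dv fp p - cos (thm p) * dv fm p
     = - (sin (a0 p) * du fp p) - sin (thm p) * du fm p /\
   cos (a0 p) * du fp p + cos (thm p) * du fm p
     = sin (a0 p) * dv fp p - sin (thm p) * dv fm p).
Proof.
move=> Op t; have [th tm] := att_thm att Op.
have e1 : sin (a0 p) = kp p * cos (a0 p) by exact: sin_atan_cos.
have e2 : sin (thm p) = km p * cos (thm p).
  by rewrite -tm /tan divfK // gt_eqF // cos_gt0_pihalf.
have kpE := att_kp att Op; have kmE := att_km att Op.
have fpE := att_fp att Op; have fmE := att_fm att Op.
rewrite -(cos_atan (kp p)) in fpE; rewrite -(cos_atan (km p)) -tm (atan_tan th) in fmE.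
exact: sff_of_signs e1 e2 kpE kmE fpE fmE.
Qed.

Let smp : [/\ smooth O lam, smooth O gam & smooth O kp] /\
  [/\ smooth O thm, smooth O fp & smooth O fm].
Proof. by case: (att_smooth att) => -[? ? ?] [? ? ?]; case: (att_immersion att). Qed.

Let sa0 : smooth O a0.
Proof. by apply: (smooth_atan oO); case: smp => -[]. Qed.

(** The angle is psi = theta- - arctan k+ + pi / 2. *)
Lemma exists_psi : exists psi : R * R -> R, smooth O psi /\ cond_iv O psi fp fm.
Proof.
have [_ [sth _ _]] := smp.
exists (fun p => thm p - a0 p + pi / 2); split.
  apply: (smoothD oO); last exact: smooth_cst.
  by apply: (smoothD oO) => //; exact: smoothN.
move=> p Op; rewrite cosDpihalf sinDpihalf sinB cosB.
have [_ [_ compat]] := attached_sff Op.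
have [-> ->] := compat_rotation compat (cos2Dsin2 _).
by split; congr (_ * _ + _ * _) || congr (_ * _ - _ * _); ring.
Qed.

Variable psi : R * R -> R.
Hypotheses (spsi : smooth O psi) (iv : cond_iv O psi fp fm).
Let a p := thm p - psi p + pi / 2.

(** For an arbitrary psi in relation (iv), the angle theta- - psi + pi / 2 agrees
    with arctan k+ modulo 2 pi, hence can replace it in the second fundamental
    form; unlike arctan k+, its derivatives are those occurring in (v). *)
Lemma attached_angle p : O p -> du fp p ^+ 2 + dv fp p ^+ 2 != 0 ->
  cos (a p) = cos (a0 p) /\ sin (a p) = sin (a0 p).
Proof.
move=> Op n0; have [_ [_ compat]] := attached_sff Op; have [i1 i2] := iv Op.
have [-> ->] := angle_shift (thm p) (psi p).
by have [-> ->] := rotation_unique compat n0 i1 i2.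
Qed.

Hypothesis nondegenerate : forall p, O p -> du fp p ^+ 2 + dv fp p ^+ 2 != 0.
Let t := sff_of a thm fp fm.

Let sa : smooth O a.
Proof.
have [_ [sth _ _]] := smp; apply: (smoothD oO); last exact: smooth_cst.
by apply: (smoothD oO) => //; exact: smoothN.
Qed.

Let compat p : O p ->
  cos (a p) * dv fp p - cos (thm p) * dv fm p
    = - (sin (a p) * du fp p) - sin (thm p) * du fm p /\
  cos (a p) * du fp p + cos (thm p) * du fm p
    = sin (a p) * dv fp p - sin (thm p) * dv fm p.
Proof.
move=> Op; have [-> ->] := attached_angle Op (nondegenerate Op).
by have [_ [_ ?]] := attached_sff Op.
Qed.

Let sffE p : O p ->
  [/\ al1 s p = al1 t p, al2 s p = al2 t p & al3 s p = al3 t p] /\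
  [/\ be1 s p = be1 t p, be2 s p = be2 t p & be3 s p = be3 t p].
Proof.
move=> Op; have [ec es] := attached_angle Op (nondegenerate Op).
by have [h1 [h2 _]] := attached_sff Op; rewrite /t /= -/(a p) ec es.
Qed.

Let is_sff_t : is_sff O F N1 N2 t.
Proof.
move=> p Op; have := att_sff att Op.
by have [[-> -> ->] [-> -> ->]] := sffE Op.
Qed.

Lemma attached_codazzi p : O p ->
  codazzi_p (du fp p) (dv fp p) (du a p) (dv a p) (du lam p) (dv lam p) (du gam p) (dv gam p) = 0 /\
  codazzi_m (du fm p) (dv fm p) (du thm p) (dv thm p) (du lam p) (dv lam p) (du gam p) (dv gam p) = 0.
Proof.
move=> Op; have [[sl sg _] [sth sfp sfm]] := smp.
have [sF _ FI] := att_immersion att.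
have inN q : O q -> in_space_form (F q) by move=> /FI[].
have conf q : O q -> induced_metric F q = (expR (2 * lam q))%:M by move=> /FI[].
have hN := att_frame att; have [[sN1 _] [sN2 _] _] := hN.
have [c1 c2 c3 c4] := codazzi_of_frame oO sl sg (smooth_sff_of oO sa sth sfp sfm) Op
  (fun q Oq => gram_frame oO sF inN conf hN Oq)
  (smooth_frame_of oO (smooth_pd 0 sF) (smooth_pd 1 sF) sN1 sN2 sF)
  (fun q Oq => structure_equations oO sF sl inN conf hN is_sff_t (att_connection att) Oq).
have sub0 (x y : R) : x = y -> x - y = 0 by move=> ->; rewrite subrr.
have [d1 d2 d3 d4] := codazzi_defects oO sa sth sfp sfm compat lam gam Op.
apply: (codazzi_split (cos2Dsin2 (a p)) (cos2Dsin2 (thm p))).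
- exact: etrans (esym d1) (sub0 _ _ c1).
- exact: etrans (esym d2) (sub0 _ _ c2).
- exact: etrans (esym d3) (sub0 _ _ c3).
- exact: etrans (esym d4) (sub0 _ _ c4).
Qed.

Lemma pd_angle i p : O p -> pd i a p = pd i thm p - pd i psi p.
Proof.
move=> Op; have [_ [sth _ _]] := smp; have sN := smoothN oO spsi.
apply: (etrans (pdD i (smoothD oO sth sN) (smooth_cst oO _) Op)).
by rewrite pd_cst addr0; apply: (etrans (pdD i sth sN Op)); congr (_ + _); exact: pdN.
Qed.

Lemma attached_v : (forall p, O p -> coefA' fp fm p != 0) -> cond_v O lam gam thm psi fp fm.
Proof.
move=> A0 p Op; apply/(codazzi_cramer _ _ _ _ (A0 p Op) (pd_angle 0 Op) (pd_angle 1 Op)).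
exact: attached_codazzi.
Qed.

End Necessary.

(** * Characterization of the conditions *)
Section NecessaryAndSufficient.
Context {R : realType}.

Lemma sqr_cross_neq0 (pu pv mu mv : R) :
  pv ^+ 2 * mu ^+ 2 - mv ^+ 2 * pu ^+ 2 != 0 ->
  (pv * mu + mv * pu) * (pv * mu - mv * pu) != 0.
Proof. by apply: contra_neq => e; rewrite -[RHS]e; ring. Qed.

Lemma cross_norm_neq0 (pu pv mu mv : R) :
  pv * mu - mv * pu != 0 -> pu ^+ 2 + pv ^+ 2 != 0.
Proof.
apply: contra_neq => /eqP; rewrite paddr_eq0 ?sqr_ge0 // !sqrf_eq0 => /andP[/eqP -> /eqP ->].
by rewrite mul0r mulr0 subrr.
Qed.

Variables (L0 : R) (O : set (R * R)) (F N1 N2 : R * R -> 'rV[R]_(adim L0)) (s : sff R).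
Variables (lam gam kp km thm fp fm : R * R -> R).
Hypothesis oO : open O.
Hypothesis att : attached O F N1 N2 s lam gam kp km thm fp fm.

Let Q p := Xp s p ^+ 2 * Ym s p ^+ 2 - Xm s p ^+ 2 * Yp s p ^+ 2.

Let cosp_neq0 p : cos (atan (kp p)) != 0.
Proof. by rewrite cos_atan invr_eq0 sqrtr_eq0 -ltNge ltr_wpDr ?sqr_ge0. Qed.

Let cosm_neq0 p : O p -> cos (thm p) != 0.
Proof. by move=> Op; have [th _] := att_thm att Op; rewrite gt_eqF // cos_gt0_pihalf. Qed.

(* X and Y are multiples of the partial derivatives of f+ and f- by nonzero cosines *)
Let QE p : O p -> Q p = cos (atan (kp p)) ^+ 2 * cos (thm p) ^+ 2 *
  (dv fp p ^+ 2 * du fm p ^+ 2 - dv fm p ^+ 2 * du fp p ^+ 2).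
Proof.
move=> Op; have [[e1 e2 e3] [[f1 f2 f3] _]] := attached_sff att Op.
by rewrite /Q /Xp /Ym /Xm /Yp e1 e2 f2 f3 /=; field.
Qed.

Let km_neq0 p : O p -> (km p != 0) = (thm p != 0).
Proof. by move=> Op; have [th <-] := att_thm att Op; rewrite tan_eq0. Qed.

Variable psi : R * R -> R.
Hypotheses (spsi : smooth O psi) (iv : cond_iv O psi fp fm).

(* k+ and its expression through f+, f-, theta- vanish together with sin a *)
Let kpE p : O p -> du fp p ^+ 2 + dv fp p ^+ 2 != 0 ->
  (kp_num thm fp fm p != 0) = (kp p != 0).
Proof.
move=> Op n0; have [ec es] := attached_angle att iv Op n0.
have [c1 s1] := angle_shift (thm p) (psi p); have [i1 i2] := iv Op.
have := kp_num_algebra (etrans (esym es) s1) i1 i2; rewrite sin_atan_cos => e.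
have c0 := cosm_neq0 Op.
have -> : kp_num thm fp fm p = - ((du fp p ^+ 2 + dv fp p ^+ 2) * (kp p * cos (atan (kp p)))) / cos (thm p).
  by rewrite -e /kp_num /coefA /Defs.coefB /tan; field.
by rewrite mulf_eq0 invr_eq0 (negPf c0) orbF oppr_eq0 !mulf_eq0 (negPf n0) (negPf (cosp_neq0 p)) orbF.
Qed.

Lemma conditions_neq0 p : conditions L0 O lam gam thm psi fp fm -> O p ->
  km p != 0 /\ Q p != 0.
Proof.
move=> [_ ii iii _ _] Op; rewrite km_neq0 //; split; first exact: ii.
have [e A0] := iii p Op; rewrite e in A0.
rewrite QE //; apply: mulf_neq0 => //.
by apply: mulf_neq0; apply: expf_neq0; [exact: cosp_neq0|exact: cosm_neq0].
Qed.

Lemma neq0_iff_conditions : curvature_eq O F ->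
  (forall p, O p -> [/\ kp p != 0, km p != 0 & Q p != 0]) <->
  (conditions L0 O lam gam thm psi fp fm /\ (forall p, O p -> kp_num thm fp fm p != 0)).
Proof.
move=> KF; split=> [h|[C n] p Op]; last first.
  have [h1 h2] := conditions_neq0 C Op; have [_ _ iii _ _] := C.
  have [_] := iii p Op; rewrite mulf_eq0 => /norP[_ /cross_norm_neq0 n0].
  by split => //; rewrite -kpE //; exact: n.
have AA p : O p -> coefA fp fm p * coefA' fp fm p != 0.
  move=> Op; have [_ _] := h p Op; rewrite QE // mulf_eq0 => /norP[_].
  exact: sqr_cross_neq0.
have A0 p : O p -> coefA' fp fm p != 0 by move=> /AA; rewrite mulf_eq0 => /norP[].
have n0 p : O p -> du fp p ^+ 2 + dv fp p ^+ 2 != 0 by move=> /A0; exact: cross_norm_neq0.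
split; last by move=> p Op; rewrite kpE ?n0 //; have [] := h p Op.
split => //.
- move=> p Op; have [sF sl FI] := att_immersion att.
  have conf q : O q -> induced_metric F q = (expR (2 * lam q))%:M by move=> /FI[].
  have := KF p Op; rewrite (curvature_conformal oO sl conf Op).
  move: (du (du lam) p + dv (dv lam) p) (W_neq0 lam p) => x W0 <-.
  by field.
- by move=> p Op; rewrite -km_neq0 //; have [] := h p Op.
- move=> p Op; split; last exact: AA.
  by rewrite /coefA /coefA'; ring.
- exact: (attached_v oO att spsi iv n0 A0).
Qed.

End NecessaryAndSufficient.

(** * The normal connection *)
Section VectorAlgebra.
Context {R : realType} {V : lmodType R}.

Lemma ord2_ind (P : 'I_2 -> Prop) : P 0 -> P 1 -> forall i, P i.
Proof.
by move=> P0 P1 [[|[|//]] i2]; [rewrite (_ : Ordinal _ = 0)|rewrite (_ : Ordinal _ = 1)] => //;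
  exact: val_inj.
Qed.

Lemma normal_components (w t1 t2 n1 n2 z : R) (x T1 T2 N1 N2 F : V) :
  x = (w * t1) *: T1 + (w * t2) *: T2 + (w * n1) *: N1 + (w * n2) *: N2 + z *: F ->
  t1 = 0 -> t2 = 0 -> z = 0 -> x = (w * n1) *: N1 + (w * n2) *: N2.
Proof. by move=> -> -> -> ->; rewrite !mulr0 !scale0r !add0r addr0. Qed.

Lemma sum_scalar_mx (a : R) (f : 'I_2 -> R) (T : 'I_2 -> V) :
  \sum_(k < 2) \sum_(l < 2) ((a%:M : 'M[R]_2) k l * f l) *: T k = (a * f 0) *: T 0 + (a * f 1) *: T 1.
Proof.
have sum2 (g : 'I_2 -> V) : \sum_(k < 2) g k = g 0 + g 1.
  by rewrite !big_ord_recl big_ord0 addr0; congr (_ + g _); exact: val_inj.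
by rewrite !sum2 !mxE /= !mulr1n !mulr0n !mul0r !scale0r addr0 add0r.
Qed.

Lemma split_normal (w t1 t2 n1 n2 z : R) (x T1 T2 N1 N2 F : V) :
  x = (w * t1) *: T1 + (w * t2) *: T2 + (w * n1) *: N1 + (w * n2) *: N2 + z *: F ->
  x - z *: F - ((w * t1) *: T1 + (w * t2) *: T2) = w *: (n1 *: N1 + n2 *: N2).
Proof.
by move=> ->; rewrite addrK -[X in X - _]addrA [X in X - _]addrC addrK scalerDr !scalerA.
Qed.

(** The two sides are the mixed second covariant derivatives of x N1 + y N2; they
    share the mixed derivative [m12] of the potential of the connection form. *)
Lemma commutator_algebra (x y xu yu xv yv xuv yuv lu lv luv m1 m2 m12 : R) (N1 N2 : V) :
  let x0 := xu + x * lu - y * m1 in let y0 := yu + y * lu + x * m1 in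
  let x1 := xv + x * lv - y * m2 in let y1 := yv + y * lv + x * m2 in
  (xuv + (xu * lv + x * luv) - (yu * m2 + y * m12) + x1 * lu - y1 * m1) *: N1
  + (yuv + (yu * lv + y * luv) + (xu * m2 + x * m12) + y1 * lu + x1 * m1) *: N2
  - ((xuv + (xv * lu + x * luv) - (yv * m1 + y * m12) + x0 * lv - y0 * m2) *: N1
  + (yuv + (yv * lu + y * luv) + (xv * m1 + x * m12) + y0 * lv + x0 * m2) *: N2) = 0.
Proof.
move=> x0 y0 x1 y1; apply/eqP; rewrite subr_eq0; apply/eqP.
by congr (_ *: _ + _ *: _); rewrite /x0 /x1 /y0 /y1; ring.
Qed.
End VectorAlgebra.

Lemma project_derivative (R : realType) (L0 : R) (v N1 N2 D1 D2 : 'rV[R]_(adim L0))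
    (x y xi yi l m w : R) : w != 0 -> v = xi *: N1 + x *: D1 + (yi *: N2 + y *: D2) ->
  ip N1 N1 = w -> ip N2 N2 = w -> ip N1 N2 = 0 ->
  ip D1 N1 = l * w -> ip D1 N2 = m * w -> ip D2 N1 = - m * w -> ip D2 N2 = l * w ->
  w^-1 *: (ip v N1 *: N1 + ip v N2 *: N2) =
  (xi + x * l - y * m) *: N1 + (yi + y * l + x * m) *: N2.
Proof.
move=> w0 -> n11 n22 n12 h1 h2 h3 h4.
rewrite !ipDl !ipZl h1 h2 h3 h4 n11 n22 [ip N2 N1]ipC n12 scalerDr !scalerA.
by congr (_ *: _ + _ *: _); field.
Qed.

Section NormalPart.
Context {R : realType} {L0 : R}.
Notation vec := 'rV[R]_(adim L0).
Variable O : set (R * R).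
Hypothesis oO : open O.
Variables (lam : R * R -> R) (F N1 N2 : R * R -> vec).
Hypotheses (sF : smooth O F) (sl : smooth O lam).
Hypothesis inN : forall p, O p -> in_space_form (F p).
Hypothesis conformal : forall p, O p -> induced_metric F p = (expR (2 * lam p))%:M.
Hypothesis hN : normal_frame O lam F N1 N2.
Local Notation W p := (expR (2 * lam p)).
Local Notation T i := (pd i F).

Lemma resolution_frame p (x : vec) : O p ->
  x = ((W p)^-1 * ip x (T 0 p)) *: T 0 p + ((W p)^-1 * ip x (T 1 p)) *: T 1 p
        + ((W p)^-1 * ip x (N1 p)) *: N1 p + ((W p)^-1 * ip x (N2 p)) *: N2 p
        + (L0 * ip x (F p)) *: F p.
Proof.
move=> Op; have C := complete_frame oO sF inN conformal hN Op.
have W0 := W_neq0 lam p.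
have d y : y = (W p)^-1 * y * W p by rewrite mulrC mulrA mulfV // mul1r.
exact: frame_expansion W0 C (d _) (d _) (d _) (d _) erefl.
Qed.

Lemma normal_part_nabla i V p : O p -> normal_part F p (nabla F i V p) =
  (W p)^-1 *: (ip (pd i V p) (N1 p) *: N1 p + ip (pd i V p) (N2 p) *: N2 p).
Proof.
move=> Op; have r k := ip_radial oO sF inN k Op.
have tan k : ip (nabla F i V p) (T k p) = ip (pd i V p) (T k p).
  by rewrite ipBl ipZl [ip (F p) _]ipC mulrAC r mul0r subr0.
rewrite /normal_part (conformal Op) invmx_scalar.
rewrite (sum_scalar_mx _ (fun l => ip (nabla F i V p) (T l p)) (fun k => T k p)) !tan.
exact: (split_normal (resolution_frame (pd i V p) Op)).
Qed.

Lemma nabla_perp_ext i (xi xi' : R * R -> vec) p : O p -> (forall q, O q -> xi q = xi' q) ->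
  nabla_perp F i xi p = nabla_perp F i xi' p.
Proof.
move=> Op e; apply: (etrans (normal_part_nabla i xi Op)).
apply: (etrans _ (esym (normal_part_nabla i xi' Op))).
exact: (congr1 (fun v => (W p)^-1 *: (ip v (N1 p) *: N1 p + ip v (N2 p) *: N2 p)) (pd_ext oO i Op e)).
Qed.

Variables gam : R * R -> R.
Hypothesis sg : smooth O gam.
Hypothesis hc : is_normal_connection O lam F N1 N2 (du gam) (dv gam).

Let N1s : smooth O N1. Proof. by case: hN => -[]. Qed.
Let N2s : smooth O N2. Proof. by case: hN => _ []. Qed.

Lemma smooth_scale (x : R * R -> R) (V : R * R -> vec) i p : smooth O x -> smooth O V -> O p ->
  smooth O (fun q => x q *: V q) /\
  pd i (fun q => x q *: V q) p = pd i x p *: V p + x p *: pd i V p.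
Proof.
move=> sx sV Op; have sVj j : smooth O (fun q => V q 0 j) := smooth_coord oO j sV.
have sm : smooth O (fun q => x q *: V q).
  apply/(smooth_mx oO) => k j.
  apply: (smooth_ext oO (f := fun q => x q * V q 0 j)) => [q _|].
    by rewrite mxE (ord1 k).
  exact: (smoothM oO).
split => //; apply/rowP => j.
rewrite (pd_mx i 0 j sm Op) !mxE (pd_mx i 0 j sV Op).
apply: (etrans _ (pdM i sx (sVj j) Op)).
by congr (pd i _ p); apply/funext => q; rewrite mxE.
Qed.

Lemma nabla_perp_normal i (x y : R * R -> R) p : smooth O x -> smooth O y -> O p ->
  nabla_perp F i (fun q => x q *: N1 q + y q *: N2 q) p =
  (pd i x p + x p * pd i lam p - y p * pd i gam p) *: N1 p +
  (pd i y p + y p * pd i lam p + x p * pd i gam p) *: N2 p.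
Proof.
move=> sx sy Op; have W0 := W_neq0 lam p.
have [n11 n22 n12] : [/\ ip (N1 p) (N1 p) = W p, ip (N2 p) (N2 p) = W p & ip (N1 p) (N2 p) = 0].
  by case: hN => _ _; apply.
have [s1 d1] := smooth_scale i sx N1s Op; have [s2 d2] := smooth_scale i sy N2s Op.
have d := etrans (pdD i s1 s2 Op) (congr2 +%R d1 d2).
have h (j : 'I_2) : [/\ ip (pd j N1 p) (N1 p) = pd j lam p * W p, ip (pd j N1 p) (N2 p) = pd j gam p * W p,
    ip (pd j N2 p) (N1 p) = - pd j gam p * W p & ip (pd j N2 p) (N2 p) = pd j lam p * W p].
  have [[a1 a2] [a3 a4] [a5 a6] [a7 a8]] := ip_dnormal hN hc Op.
  by elim/ord2_ind: j; [exact: And4 a1 a2 a3 a4|exact: And4 a5 a6 a7 a8].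
have [h1 h2 h3 h4] := h i.
apply: (etrans (normal_part_nabla i _ Op)).
exact: (project_derivative W0 d n11 n22 n12 h1 h2 h3 h4).
Qed.

(** A normal field is x N1 + y N2, and the commutator of its covariant derivatives
    is the exterior derivative of the connection form d gam, which vanishes. *)
Lemma flat_normal : flat_normal_connection O F.
Proof.
move=> xi [sxi hxi] p Op.
have sW : smooth O (fun q => (W q)^-1).
  apply: (smoothV oO) (smooth_metric oO sl) => q _; exact: W_neq0.
pose x q := (W q)^-1 * ip (xi q) (N1 q); pose y q := (W q)^-1 * ip (xi q) (N2 q).
have sx : smooth O x by apply: (smoothM oO) => //; exact: (smooth_ip oO).
have sy : smooth O y by apply: (smoothM oO) => //; exact: (smooth_ip oO).
have xiE q : O q -> xi q = x q *: N1 q + y q *: N2 q.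
  move=> Oq; have [f t] := hxi q Oq.
  have f0 : L0 * ip (xi q) (F q) = 0.
    have [z|L00] := eqVneq L0 0; last by rewrite f ?mulr0.
    by move: (ip _ _) => r; rewrite z mul0r.
  exact: (normal_components (resolution_frame (xi q) Oq) (t 0) (t 1) f0).
pose X i q := pd i x q + x q * pd i lam q - y q * pd i gam q.
pose Y i q := pd i y q + y q * pd i lam q + x q * pd i gam q.
have np i q : O q -> nabla_perp F i xi q = X i q *: N1 q + Y i q *: N2 q.
  move=> Oq; exact: (etrans (nabla_perp_ext i Oq xiE) (nabla_perp_normal i sx sy Oq)).
have pr (f g : R * R -> R) i j : smooth O f -> smooth O g ->
    smooth O (fun q => f q * pd i g q) /\
    pd j (fun q => f q * pd i g q) p = pd j f p * pd i g p + f p * pd j (pd i g) p.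
  by move=> sf s'; have sp := smooth_pd i s'; split; [exact: (smoothM oO)|exact: pdM].
have sX i : smooth O (X i) /\ forall j, pd j (X i) p =
    pd j (pd i x) p + (pd j x p * pd i lam p + x p * pd j (pd i lam) p)
    - (pd j y p * pd i gam p + y p * pd j (pd i gam) p).
  have A := pr x lam i; have B := pr y gam i.
  have s1 := smoothD oO (smooth_pd i sx) (A i sx sl).1.
  split; first by apply: (smoothD oO s1); apply: (smoothN oO); exact: (B i sy sg).1.
  move=> j; apply: (etrans (pdB j s1 (B i sy sg).1 Op)).
  apply: (congr2 (fun a b => a - b) _ (B j sy sg).2).
  exact: (etrans (pdD j (smooth_pd i sx) (A i sx sl).1 Op) (congr1 (fun c => _ + c) (A j sx sl).2)).
have sY i : smooth O (Y i) /\ forall j, pd j (Y i) p =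
    pd j (pd i y) p + (pd j y p * pd i lam p + y p * pd j (pd i lam) p)
    + (pd j x p * pd i gam p + x p * pd j (pd i gam) p).
  have A := pr y lam i; have B := pr x gam i.
  have s1 := smoothD oO (smooth_pd i sy) (A i sy sl).1.
  split; first by apply: (smoothD oO s1); exact: (B i sx sg).1.
  move=> j; apply: (etrans (pdD j s1 (B i sx sg).1 Op)).
  apply: (congr2 +%R _ (B j sx sg).2).
  exact: (etrans (pdD j (smooth_pd i sy) (A i sy sl).1 Op) (congr1 (fun c => _ + c) (A j sy sl).2)).
have np01 := etrans (nabla_perp_ext 0 Op (np 1)) (nabla_perp_normal 0 (sX 1).1 (sY 1).1 Op).
have np10 := etrans (nabla_perp_ext 1 Op (np 0)) (nabla_perp_normal 1 (sX 0).1 (sY 0).1 Op).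
apply: (etrans (congr2 (fun a b => a - b) np01 np10)).
rewrite (sX 1).2 (sX 0).2 (sY 1).2 (sY 0).2.
have sw (h : R * R -> R) : smooth O h -> pd 0 (pd 1 h) p = pd 1 (pd 0 h) p.
  by move=> sh; have := schwarz oO sh Op.
rewrite (sw x sx) (sw y sy) (sw lam sl) (sw gam sg).
exact: commutator_algebra.
Qed.

End NormalPart.

(** * The surface of a moving frame *)
Section SurfaceOfFrame.
Context {R : realType} {L0 : R}.
Notation vec := 'rV[R]_(adim L0).
Variable O : set (R * R).
Hypothesis oO : open O.
Variables (lam gam : R * R -> R) (s : sff R) (E : R * R -> 'M[R]_(5, adim L0)).
Hypotheses (sl : smooth O lam) (sg : smooth O gam).
Hypothesis ss : [/\ smooth O (al1 s), smooth O (al2 s) & smooth O (al3 s)] /\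
  [/\ smooth O (be1 s), smooth O (be2 s) & smooth O (be3 s)].
Hypothesis sE : smooth O E.
Local Notation W p := (expR (2 * lam p)).
Local Notation Omu := (@omega_u R L0 lam s (du gam)).
Local Notation Omv := (@omega_v R L0 lam s (dv gam)).
Hypothesis dE : forall p, O p ->
  is_derive p (1, 0) E (Omu p *m E p) /\ is_derive p (0, 1) E (Omv p *m E p).
Hypothesis CE : forall p, O p -> complete (W p) (E p).

Definition field_of (k : 'I_5) (q : R * R) : vec := row k (E q).
Let F := field_of 4.
Let N1 := field_of 2.
Let N2 := field_of 3.

Lemma smooth_field k : smooth O (field_of k).
Proof.
apply/(smooth_mx oO) => i j.
apply: (smooth_ext oO (f := fun q => E q k j)) => [q _|]; first by rewrite mxE.
exact: (smooth_mx oO E).1 sE k j.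
Qed.

Lemma pd_field i k p (Om : 'M[R]_5) : O p ->
  is_derive p (if i == 0 :> 'I_2 then (1, 0) else (0, 1)) E (Om *m E p) ->
  pd i (field_of k) p = row k (Om *m E p).
Proof.
move=> Op d; apply: pd_val; apply/is_derive_mx => a j.
have -> : row k (Om *m E p) a j = (Om *m E p) k j by rewrite mxE.
have -> : (fun y => field_of k y a j) = (fun y => E y k j).
  by apply/funext => y; rewrite mxE.
exact: (is_derive_mx _ _ _ _).1 d k j.
Qed.

Lemma du_field k p : O p -> pd 0 (field_of k) p = row k (Omu p *m E p).
Proof. by move=> Op; apply: pd_field => //; exact: (dE Op).1. Qed.

Lemma dv_field k p : O p -> pd 1 (field_of k) p = row k (Omv p *m E p).
Proof. by move=> Op; apply: pd_field => //; exact: (dE Op).2. Qed.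

Let gE p : O p -> gram (W p) (E p) := fun Op => (gram_complete _ _).2 (CE Op).

Lemma du_position p : O p -> pd 0 F p = field_of 0 p.
Proof.
move=> Op; apply: (etrans (du_field 4 Op)); apply/rowP => j.
rewrite !mxE !big_ord_recl big_ord0 !mxE /= !mul0r !addr0 mul1r.
by congr (E p _ j); exact: val_inj.
Qed.

Lemma dv_position p : O p -> pd 1 F p = field_of 1 p.
Proof.
move=> Op; apply: (etrans (dv_field 4 Op)); apply/rowP => j.
rewrite !mxE !big_ord_recl big_ord0 !mxE /= !mul0r !addr0 mul1r add0r.
by congr (E p _ j); exact: val_inj.
Qed.

Lemma ip_field p (k l : 'I_5) : O p -> (k < 4)%N -> (l < 4)%N ->
  ip (field_of k p) (field_of l p) = (k == l)%:R * W p.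
Proof.
move=> Op k4 l4; have a4 : (4 <= adim L0)%N by rewrite /adim; case: ifP.
have := gE Op (leq_trans k4 a4) (leq_trans l4 a4); rewrite /weight l4 => <-.
by rewrite divfK // W_neq0.
Qed.

Lemma ip_field_radial p (k : 'I_5) : O p -> L0 != 0 -> (k < 4)%N ->
  ip (field_of k p) (F p) = 0.
Proof.
move=> Op L00 k4; have a5 : adim L0 = 5%N by rewrite /adim (negPf L00).
have k5 : (k < adim L0)%N by rewrite a5.
have f5 : (4 < adim L0)%N by rewrite a5.
have := gE Op k5 (l := 4) f5; rewrite /weight /= => e.
have kn : (k == 4) = false by apply/eqP => ke; move: k4; rewrite ke.
by move/eqP: e; rewrite kn mulf_eq0 (negPf L00) orbF => /eqP.
Qed.

Lemma ip_radial_field p : O p -> L0 != 0 -> ip (F p) (F p) = L0^-1.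
Proof.
move=> Op L00; have a5 : adim L0 = 5%N by rewrite /adim (negPf L00).
have f5 : (4 < adim L0)%N by rewrite a5.
have := gE Op (k := 4) (l := 4) f5 f5; rewrite /weight /= => e.
by apply: (mulIf L00); rewrite e mulVf.
Qed.

Let inN p : O p -> in_space_form (F p).
Proof. by move=> Op L00; exact: ip_radial_field. Qed.

Let pd_position (i : 'I_2) p : O p -> pd i F p = field_of (if i == 0 then 0 else 1) p.
Proof.
move=> Op; case: i => -[|[|//]] ii.
  by rewrite -(du_position Op); congr (pd _ _ _); exact: val_inj.
by rewrite -(dv_position Op); congr (pd _ _ _); exact: val_inj.
Qed.

Let conformal p : O p -> induced_metric F p = (W p)%:M.
Proof.
move=> Op; apply/matrixP => i j; rewrite !mxE.
apply: (etrans (congr2 (@ip R L0) (pd_position i Op) (pd_position j Op))).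
rewrite ip_field //; try by case: ifP.
by case: i j => -[|[|//]] ii [[|[|//]] jj]; rewrite /= ?mul1r ?mul0r.
Qed.

Lemma surface_immersion : conformal_immersion O lam F.
Proof. by split => //; [exact: smooth_field|move=> p Op; split; [exact: inN|exact: conformal]]. Qed.

Let normal (k : 'I_5) : (1 < k)%N -> (k < 4)%N -> normal_field O F (field_of k).
Proof.
move=> k1 k4; split; first exact: smooth_field.
move=> p Op; split=> [L00|i]; first exact: ip_field_radial.
apply: (etrans (congr1 (fun v => ip (field_of k p) v) (pd_position i Op))).
rewrite ip_field //; last by case: ifP.
suff -> : (k == (if i == 0 then 0 else 1)) = false by rewrite mul0r.
by apply/eqP => ke; move: k1; rewrite ke; case: ifP.
Qed.

Lemma surface_frame : normal_frame O lam F N1 N2.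
Proof.
split; [exact: normal|exact: normal|move=> p Op].
by rewrite !ip_field //= !mul1r mul0r.
Qed.

Let hN := surface_frame.
Let sF : smooth O F := smooth_field 4.

(* the normal components of a derivative are the entries of the connection in the normal columns *)
Let component i (k : 'I_5) p (Om : 'M[R]_5) V : O p ->
  pd i V p = row k (Om *m E p) -> (L0 = 0 -> Om k 4 = 0) ->
  normal_part F p (nabla F i V p) = Om k 2 *: N1 p + Om k 3 *: N2 p.
Proof.
move=> Op d Om4; have W0 := W_neq0 lam p.
apply: (etrans (normal_part_nabla oO sF inN conformal hN i V Op)).
have c (l : 'I_5) : (l < 4)%N -> ip (pd i V p) (field_of l p) = Om k l * W p.
  move=> l4; have <- := gram_coord (gE Op) Om4 l4.
  by rewrite d /weight l4 divfK.
have [c2 c3] := (c 2 isT, c 3 isT).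
apply: (etrans (congr2 (fun x y => (W p)^-1 *: (x *: N1 p + y *: N2 p)) c2 c3)).
rewrite scalerDr !scalerA; move: (W p) W0 => w w0.
by congr (_ *: _ + _ *: _); field.
Qed.

Lemma surface_sff : is_sff O F N1 N2 s.
Proof.
move=> p Op.
have z0 : L0 = 0 -> - (L0 * W p) = 0 by move=> z; move: (W p) => w; rewrite z mul0r oppr0.
have t0 : pd 0 (du F) p = row 0 (Omu p *m E p).
  exact: (etrans (pd_ext oO 0 Op du_position) (du_field 0 Op)).
have t1 : pd 0 (dv F) p = row 1 (Omu p *m E p).
  exact: (etrans (pd_ext oO 0 Op dv_position) (du_field 1 Op)).
have t2 : pd 1 (dv F) p = row 1 (Omv p *m E p).
  exact: (etrans (pd_ext oO 1 Op dv_position) (dv_field 1 Op)).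
split.
- by rewrite (component Op t0) !mxE.
- by rewrite (component Op t1) !mxE.
- by rewrite (component Op t2) !mxE.
Qed.

Lemma surface_connection : is_normal_connection O lam F N1 N2 (du gam) (dv gam).
Proof.
move=> p Op.
have t0 := du_field 2 Op; have t1 := du_field 3 Op.
have t2 := dv_field 2 Op; have t3 := dv_field 3 Op.
split.
- by apply: (etrans (component Op t0 _)); rewrite ?mxE.
- by apply: (etrans (component Op t1 _)); rewrite ?mxE.
- by apply: (etrans (component Op t2 _)); rewrite ?mxE.
- by apply: (etrans (component Op t3 _)); rewrite ?mxE.
Qed.

Lemma surface_flat : flat_normal_connection O F.
Proof. exact: (flat_normal oO sF sl inN conformal hN sg surface_connection). Qed.

Lemma surface_curvature : cond_i L0 O lam -> curvature_eq O F.
Proof.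
move=> ci p Op; rewrite (curvature_conformal oO sl conformal Op).
have := ci p Op; move: (du (du lam) p + dv (dv lam) p) (W p) (W_neq0 lam p) => x w w0 e.
by have -> : x = - (L0 * w) by [apply/eqP; rewrite -addr_eq0 e|]; field.
Qed.

End SurfaceOfFrame.

(** * Linear independence, and an initial frame *)
Section Independence.
Context {R : realType}.

(** The vectors (a_k, b_k) lie on one line, so with the Gauss equation their
    components along it satisfy w1 w3 = w2^2, which equates the three products. *)
Lemma rank_one_minor (x y u v : R) (a1 a2 a3 b1 b2 b3 : R) :
  x ^+ 2 + y ^+ 2 != 0 -> x * a1 + y * b1 = 0 -> x * a2 + y * b2 = 0 -> x * a3 + y * b3 = 0 ->
  a1 * a3 + b1 * b3 = a2 ^+ 2 + b2 ^+ 2 -> a2 * b2 = a1 * b3 /\ a2 * b2 = a3 * b1.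
Proof.
move=> n0 e1 e2 e3 g.
have key t : t * (x ^+ 2 + y ^+ 2) = 0 -> t = 0.
  by move=> /eqP; rewrite mulf_eq0 (negPf n0) orbF => /eqP.
pose h := a2 ^+ 2 - a1 * a3.
have h2 : b2 ^+ 2 - b1 * b3 = - h by rewrite /h; lra.
have f1 : x * a1 = - (y * b1) by lra.
have f2 : x * a2 = - (y * b2) by lra.
have f3 : x * a3 = - (y * b3) by lra.
have [g1 g2 g3] : [/\ y * b1 = - (x * a1), y * b2 = - (x * a2) & y * b3 = - (x * a3)].
  by rewrite f1 f2 f3 !opprK.
have h0 : h = 0.
  apply: key.
  have u1 : x ^+ 2 * h = y ^+ 2 * (b2 ^+ 2 - b1 * b3).
    transitivity ((x * a2) * (x * a2) - (x * a1) * (x * a3)); first by rewrite /h; ring.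
    by rewrite f1 f2 f3; ring.
  by rewrite mulrDr mulrC u1 h2; ring.
have k0 : b2 ^+ 2 - b1 * b3 = 0 by rewrite h2 h0 oppr0.
split; apply/eqP; rewrite -subr_eq0; apply/eqP; apply: key.
  have u1 : x * ((x * a2) * b2 - (x * a1) * b3) = - (x * y) * (b2 ^+ 2 - b1 * b3).
    by rewrite f1 f2; ring.
  have u2 : y * ((y * b2) * a2 - (y * b3) * a1) = - (x * y) * h.
    by rewrite g2 g3 /h; ring.
  transitivity (x * ((x * a2) * b2 - (x * a1) * b3) + y * ((y * b2) * a2 - (y * b3) * a1)); first ring.
  by rewrite u1 u2 k0 h0 !mulr0 addr0.
have u1 : x * ((x * a2) * b2 - (x * a3) * b1) = - (x * y) * (b2 ^+ 2 - b1 * b3).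
  by rewrite f3 f2; ring.
have u2 : y * ((y * b2) * a2 - (y * b1) * a3) = - (x * y) * h.
  by rewrite g2 g1 /h; ring.
transitivity (x * ((x * a2) * b2 - (x * a3) * b1) + y * ((y * b2) * a2 - (y * b1) * a3)); first ring.
by rewrite u1 u2 k0 h0 !mulr0 addr0.
Qed.

Variables (c s C S pu pv mu mv : R).
Let a1 := 2^-1 * (c * pu - C * mu).
Let a2 := 2^-1 * (c * pv - C * mv).
Let a3 := 2^-1 * (- (s * pv) - S * mv).
Let b1 := 2^-1 * (s * pu - S * mu).
Let b2 := 2^-1 * (c * pu + C * mu).
Let b3 := 2^-1 * (c * pv + C * mv).
Hypothesis compat :
  c * pv - C * mv = - (s * pu) - S * mu /\ c * pu + C * mu = s * pv - S * mv.

Let a2s : a2 = 2^-1 * (- (s * pu) - S * mu). Proof. by case: compat => e _; rewrite /a2 e. Qed.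
Let b2s : b2 = 2^-1 * (s * pv - S * mv). Proof. by case: compat => _ e; rewrite /b2 e. Qed.

(** The Gauss equation for K = L0 and the Ricci equation are the sum and the
    difference of the relations X+ W- + Y+ Z- = 0 and X- W+ + Y- Z+ = 0. *)
Lemma gauss_ricci : a1 * a3 + b1 * b3 = a2 ^+ 2 + b2 ^+ 2 /\ a1 * b2 + a2 * b3 = a2 * b1 + a3 * b2.
Proof.
have p : (a2 + b3) * (a2 - b1) + (b2 + a1) * (b2 - a3) = 0.
  have -> : a2 + b3 = c * pv by rewrite /a2 /b3; field.
  have -> : b2 + a1 = c * pu by rewrite /b2 /a1; field.
  have -> : a2 - b1 = - (s * pu) by rewrite a2s /b1; field.
  have -> : b2 - a3 = s * pv by rewrite b2s /a3; field.
  ring.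
have m : (a2 - b3) * (a2 + b1) + (b2 - a1) * (b2 + a3) = 0.
  have -> : a2 - b3 = - (C * mv) by rewrite /a2 /b3; field.
  have -> : b2 - a1 = C * mu by rewrite /b2 /a1; field.
  have -> : a2 + b1 = - (S * mu) by rewrite a2s /b1; field.
  have -> : b2 + a3 = - (S * mv) by rewrite b2s /a3; field.
  ring.
move: (a1) (a2) (a3) (b1) (b2) (b3) p m => x1 x2 x3 y1 y2 y3 p m.
by split; lra.
Qed.

(** The products in [rank_one_minor] differ by multiples of c C A' and s S A', so
    dependence would force c = s = 0. *)
Lemma sff_of_independent (x y : R) : c ^+ 2 + s ^+ 2 = 1 -> C != 0 -> S != 0 ->
  pv * mu - mv * pu != 0 ->
  x * a1 + y * b1 = 0 -> x * a2 + y * b2 = 0 -> x * a3 + y * b3 = 0 -> x = 0 /\ y = 0.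
Proof.
move=> u C0 S0 A0 e1 e2 e3; have [g _] := gauss_ricci.
have [|n0] := eqVneq (x ^+ 2 + y ^+ 2) 0.
  by move=> /eqP; rewrite paddr_eq0 ?sqr_ge0 // !sqrf_eq0 => /andP[/eqP -> /eqP ->].
have [m1 m2] := rank_one_minor 0 0 n0 e1 e2 e3 g.
have z1 : c * (C * (pv * mu - mv * pu)) = 0.
  transitivity (2 * (a2 * b2 - a1 * b3)); last by rewrite m1 subrr mulr0.
  by rewrite /a1 /a2 /b2 /b3; field.
have z2 : s * (S * (pv * mu - mv * pu)) = 0.
  transitivity (- 2 * (a2 * b2 - a3 * b1)); last by rewrite m2 subrr mulr0.
  by rewrite a2s b2s /a3 /b1; field.
move: z1 z2 => /eqP; rewrite mulf_eq0 mulf_eq0 (negPf C0) (negPf A0) !orbF => /eqP c0 /eqP.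
rewrite mulf_eq0 mulf_eq0 (negPf S0) (negPf A0) !orbF => /eqP s0.
by move: u; rewrite c0 s0 !expr0n addr0 => /eqP; rewrite eq_sym oner_eq0.
Qed.
End Independence.

Lemma zero_components (R : realType) (V : lmodType R) (w t1 t2 n1 n2 z : R) (x T1 T2 N1 N2 F : V) :
  x = (w * t1) *: T1 + (w * t2) *: T2 + (w * n1) *: N1 + (w * n2) *: N2 + z *: F ->
  t1 = 0 -> t2 = 0 -> n1 = 0 -> n2 = 0 -> z = 0 -> x = 0.
Proof. by move=> -> -> -> -> -> ->; rewrite !mulr0 !scale0r !addr0. Qed.

Section NotDependent.
Context {R : realType} {L0 : R}.
Notation vec := 'rV[R]_(adim L0).
Variable O : set (R * R).
Hypothesis oO : open O.
Variables (lam : R * R -> R) (F N1 N2 : R * R -> vec) (s : sff R).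
Hypotheses (sF : smooth O F) (sl : smooth O lam).
Hypothesis inN : forall p, O p -> in_space_form (F p).
Hypothesis conformal : forall p, O p -> induced_metric F p = (expR (2 * lam p))%:M.
Hypothesis hN : normal_frame O lam F N1 N2.
Hypothesis hs : is_sff O F N1 N2 s.

(** A dependence for some normal frame is a normal vector orthogonal to the second
    fundamental form; its components in the given frame are a dependence there. *)
Lemma not_linearly_dependent p : O p ->
  (forall x y, x * al1 s p + y * be1 s p = 0 -> x * al2 s p + y * be2 s p = 0 ->
     x * al3 s p + y * be3 s p = 0 -> x = 0 /\ y = 0) -> ~ linearly_dependent O lam F.
Proof.
move=> Op ind [M1 [M2 [t [th [hM ht dep]]]]].
have [d1 d2 d3] := dep p Op.
have [m11 m22 m12] : [/\ ip (M1 p) (M1 p) = expR (2 * lam p),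
    ip (M2 p) (M2 p) = expR (2 * lam p) & ip (M1 p) (M2 p) = 0] by case: hM => _ _; apply.
pose nu := cos (th p) *: M1 p + sin (th p) *: M2 p.
have nuM a b : ip (a *: M1 p + b *: M2 p) nu =
    expR (2 * lam p) * (cos (th p) * a + sin (th p) * b).
  rewrite !ipDl !ipDr !ipZl !ipZr [ip (M2 p) (M1 p)]ipC m11 m22 m12; ring.
have nuN a b : ip (a *: N1 p + b *: N2 p) nu = ip (N1 p) nu * a + ip (N2 p) nu * b.
  by rewrite ipDl !ipZl; ring.
have ii a b a' b' v : v = a *: N1 p + b *: N2 p -> v = a' *: M1 p + b' *: M2 p ->
    cos (th p) * a' + sin (th p) * b' = 0 -> ip (N1 p) nu * a + ip (N2 p) nu * b = 0.
  by move=> e e' z; rewrite -nuN -e e' nuM z mulr0.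
have [s1 s2 s3] := hs Op; have [t1 t2 t3] := ht p Op.
have [x0 y0] := ind _ _ (ii _ _ _ _ _ s1 t1 d1) (ii _ _ _ _ _ s2 t2 d2) (ii _ _ _ _ _ s3 t3 d3).
have tz i : ip nu (pd i F p) = 0.
  have [z1 z2] := ip_normal_tangent hM i Op.
  by rewrite ipDl !ipZl z1 z2 !mulr0 addr0.
have rz : L0 * ip nu (F p) = 0.
  have [z1 z2] := ip_normal_radial hM Op.
  by rewrite ipDl !ipZl mulrDr !(mulrCA L0) z1 z2 !mulr0 addr0.
have nu0 := zero_components (resolution_frame oO sF inN conformal hN nu Op) (tz 0) (tz 1)
  (etrans (ipC _ _) x0) (etrans (ipC _ _) y0) rz.
have := nuM (cos (th p)) (sin (th p)).
rewrite -/nu nu0 ip0l -!expr2 cos2Dsin2 mulr1 => /esym/eqP.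
by rewrite (negPf (W_neq0 lam p)).
Qed.
End NotDependent.

Section InitialFrame.
Context {R : realType} {L0 : R}.

Definition initial_frame (r : R) : 'M[R]_(5, adim L0) := \matrix_(k, j)
  (if (k < 4)%N then (k == j :> nat)%:R * r else (j == 4%N :> nat)%:R / Num.sqrt `|L0|).

Lemma initial_frame_complete (r : R) : r != 0 ->
  complete (L0 := L0) (r * r) (initial_frame r).
Proof.
move=> r0 [i hi] [j hj]; rewrite /complete !big_ord_recl big_ord0 !mxE /weight /eps -val_eqE /=.
have L4 : (4 < adim L0)%N -> L0 != 0 by rewrite /adim; case: ifP.
have i5 := leq_trans hi (adim_le5 (L0 := L0)); have j5 := leq_trans hj (adim_le5 (L0 := L0)).
have rr : (r * r)^-1 * (1 * r) * (1 * r) = 1 by field.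
have diag : L0 != 0 -> L0 * (1 / Num.sqrt `|L0|) * (1 / Num.sqrt `|L0|) = (if L0 < 0 then -1 else 1).
  move=> L00; rewrite -mulrA !mul1r -invfM -expr2 sqr_sqrtr ?normr_ge0 //.
  by case: ltrP => h; [rewrite ltr0_norm // invrN mulrN mulfV|rewrite ger0_norm // mulfV].
move: i j hi hj i5 j5 => [|[|[|[|[|//]]]]] [|[|[|[|[|//]]]]] hi hj _ _ /=;
  rewrite ?mulr1n ?mulr0n ?rr ?andbF ?andbT ?mul0r ?mulr0 ?mul0r ?addr0 ?add0r ?mulr1 //.
by rewrite diag ?L4 // mul1r.
Qed.
End InitialFrame.

(** * Existence *)
Section Signs.
Context {R : realType}.

(** Converse of [sff_of_signs]. *)
Lemma signs_of_sff (c s C S pu pv mu mv : R) : c != 0 -> C != 0 ->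
  c * pv - C * mv = - (s * pu) - S * mu /\ c * pu + C * mu = s * pv - S * mv ->
  let a1 := 2^-1 * (c * pu - C * mu) in
  let a2 := 2^-1 * (c * pv - C * mv) in
  let a3 := 2^-1 * (- (s * pv) - S * mv) in
  let b1 := 2^-1 * (s * pu - S * mu) in
  let b2 := 2^-1 * (c * pu + C * mu) in
  let b3 := 2^-1 * (c * pv + C * mv) in
  [/\ a2 - b1 = s / c * - (b2 + a1) /\ b2 - a3 = s / c * (a2 + b3),
      a2 + b1 = S / C * - (b2 - a1) /\ b2 + a3 = S / C * (a2 - b3),
      a2 + b3 = c * pv /\ b2 + a1 = c * pu &
      a2 - b3 = - (C * mv) /\ b2 - a1 = C * mu].
Proof.
move=> c0 C0 [e1 e2] a1 a2 a3 b1 b2 b3.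
have a2s : a2 = 2^-1 * (- (s * pu) - S * mu) by rewrite /a2 e1.
have b2s : b2 = 2^-1 * (s * pv - S * mv) by rewrite /b2 e2.
have X1 : a2 + b3 = c * pv by rewrite /a2 /b3; field.
have X2 : b2 + a1 = c * pu by rewrite /b2 /a1; field.
have X3 : a2 - b3 = - (C * mv) by rewrite /a2 /b3; field.
have X4 : b2 - a1 = C * mu by rewrite /b2 /a1; field.
split; split; rewrite ?X1 ?X2 ?X3 ?X4 // ?a2s ?b2s /a3 /b1; field.
all: by [exact: c0|exact: C0].
Qed.

(** [e] is the sign of the cosine. *)
Lemma sqrt_tan (e c s : R) : e = 1 \/ e = -1 -> 0 < e * c -> c ^+ 2 + s ^+ 2 = 1 ->
  (Num.sqrt (1 + (s / c) ^+ 2))^-1 = e * c.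
Proof.
move=> he ec u; have e2 : e ^+ 2 = 1 by case: he => ->; rewrite ?sqrrN expr1n.
have c0 : c != 0 by apply: contraTneq ec => ->; rewrite mulr0 ltxx.
have -> : 1 + (s / c) ^+ 2 = ((e * c)^-1) ^+ 2.
  have -> : (e * c)^-1 ^+ 2 = (c ^+ 2)^-1 by rewrite exprVn exprMn e2 mul1r.
  by rewrite -[RHS]mul1r -[X in _ = X * _]u; field.
by rewrite sqrtr_sqr ger0_norm ?invr_ge0 ?(ltW ec) // invrK.
Qed.
End Signs.

Section Existence.
Context {R : realType}.
Variables (L0 : R) (O : set (R * R)) (lam gam thm psi fp fm : R * R -> R).
Hypotheses (oO : open O) (scO : simply_connected O).
Hypotheses (sl : smooth O lam) (sg : smooth O gam) (sth : smooth O thm).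
Hypotheses (spsi : smooth O psi) (sfp : smooth O fp) (sfm : smooth O fm).
Hypothesis thr : forall p, O p -> - (pi / 2) < thm p < pi / 2.
Hypothesis cond : conditions L0 O lam gam thm psi fp fm.

Let a p := thm p - psi p + pi / 2.
Let s := sff_of a thm fp fm.

Let sa : smooth O a.
Proof.
apply: (smoothD oO); last exact: smooth_cst.
by apply: (smoothD oO) => //; exact: smoothN.
Qed.

Let A0 p : O p -> dv fp p * du fm p - dv fm p * du fp p != 0.
Proof.
by have [_ _ iii _ _] := cond => /iii[_]; rewrite mulf_eq0 => /norP[].
Qed.

Let compat p : O p ->
  cos (a p) * dv fp p - cos (thm p) * dv fm p
    = - (sin (a p) * du fp p) - sin (thm p) * du fm p /\
  cos (a p) * du fp p + cos (thm p) * du fm p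
    = sin (a p) * dv fp p - sin (thm p) * dv fm p.
Proof.
have [_ _ _ iv _] := cond => Op; have [i1 i2] := iv p Op.
have [ec es] := angle_shift (thm p) (psi p).
exact: rotation_compat ec es i1 i2.
Qed.

Let pd_a i p : O p -> pd i a p = pd i thm p - pd i psi p.
Proof.
move=> Op; have sN := smoothN oO spsi.
apply: (etrans (pdD i (smoothD oO sth sN) (smooth_cst oO _) Op)).
by rewrite pd_cst addr0; apply: (etrans (pdD i sth sN Op)); congr (_ + _); exact: pdN.
Qed.

Lemma codazzi_sff_of p : O p -> codazzi lam gam s p.
Proof.
move=> Op; have [_ _ _ _ v] := cond.
have [P0 M0] := (codazzi_cramer _ _ _ _ (A0 Op) (pd_a 0 Op) (pd_a 1 Op)).2 (v p Op).
have [c1 c2 c3 c4] := codazzi_defects oO sa sth sfp sfm compat lam gam Op.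
have zD (x y c d P M : R) : P = 0 -> M = 0 -> x - y = 2^-1 * (c * P + d * M) -> x = y.
  by move=> -> ->; rewrite !mulr0 addr0 mulr0 => /eqP; rewrite subr_eq0 => /eqP.
have zB (x y c d P M : R) : P = 0 -> M = 0 -> x - y = 2^-1 * (c * P - d * M) -> x = y.
  by move=> -> ->; rewrite !mulr0 subr0 mulr0 => /eqP; rewrite subr_eq0 => /eqP.
split; [exact: zD P0 M0 c1|exact: zB P0 M0 c2|exact: zB P0 M0 c3|exact: zB P0 M0 c4].
Qed.

(** The equations of Gauss, Ricci and Codazzi hold, so the connection is
    integrable and the frame exists globally on the simply connected domain. *)
Lemma exists_frame : exists E : R * R -> 'M[R]_(5, adim L0),
  [/\ smooth O E,
      forall p, O p ->
        is_derive p (1, 0) E (@omega_u R L0 lam s (du gam) p *m E p) /\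
        is_derive p (0, 1) E (@omega_v R L0 lam s (dv gam) p *m E p) &
      forall p, O p -> complete (expR (2 * lam p)) (E p)].
Proof.
have [[p0 Op0] cO _] := scO; have [i _ _ _ _] := cond.
have ss := smooth_sff_of oO sa sth sfp sfm.
have [sOu sOv] := smooth_omega (L0 := L0) oO sl sg ss.
have int p : O p -> dv (@omega_u R L0 lam s (du gam)) p
      + @omega_u R L0 lam s (du gam) p *m @omega_v R L0 lam s (dv gam) p
    = du (@omega_v R L0 lam s (dv gam)) p
      + @omega_v R L0 lam s (dv gam) p *m @omega_u R L0 lam s (du gam) p.
  move=> Op; have [g r] := gauss_ricci (compat Op).
  exact: (omega_integrable oO sl sg ss Op (i p Op) g r (codazzi_sff_of Op)).
have [Y [Y0 sY dY]] := total_system oO sOu sOv int scO Op0.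
pose E0 : 'M[R]_(5, adim L0) := initial_frame (expR (lam p0)).
pose E p := Y p *m E0.
have dE p : O p ->
    is_derive p (1, 0) E (@omega_u R L0 lam s (du gam) p *m E p) /\
    is_derive p (0, 1) E (@omega_v R L0 lam s (dv gam) p *m E p).
  move=> Op; have [d1 d2] := dY p Op.
  have c v : is_derive p v (fun=> E0) 0 by exact: is_derive_cst.
  have e (Om : 'M[R]_5) : Om *m E p = Om *m Y p *m E0 + Y p *m 0.
    by rewrite mulmx0 addr0 mulmxA.
  by split; rewrite e; exact: is_derive_mulmx.
have sE : smooth O E.
  apply/(smooth_mx oO) => k j.
  apply: (smooth_ext oO (f := fun q => \sum_(l < 5) Y q k l * E0 l j)) => [q _|].
    by rewrite mxE.
  apply: (smooth_sum oO) => l; apply: (smoothM oO); last exact: smooth_cst.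
  exact: (smooth_mx oO Y).1 sY k l.
exists E; split => // p Op i' j'.
have W0 q := W_neq0 lam q.
have z q : O q -> is_derive q (1, 0) (fun y => \sum_(k < 5)
      @weight R L0 (expR (2 * lam y)) k * E y k i' * E y k j') 0 /\
    is_derive q (0, 1) (fun y => \sum_(k < 5)
      @weight R L0 (expR (2 * lam y)) k * E y k i' * E y k j') 0.
  move=> Oq; have [d1 d2] := dE q Oq; have sW := smooth_metric oO sl.
  have w i'' : is_derive q (if i'' == 0 :> 'I_2 then (1, 0) else (0, 1)) (fun y => expR (2 * lam y))
      (2 * pd i'' lam q * expR (2 * lam q)).
    by rewrite -(pd_metric oO sl) //; exact: smooth_is_derive.
  have m1 : metric_conn (L0 := L0) (expR (2 * lam q)) (dweight (expR (2 * lam q)) (pd 0 lam q))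
      (@omega_u R L0 lam s (du gam) q) := metric_conn_u _ _ _ _ _ _ _ (W0 q).
  have m2 : metric_conn (L0 := L0) (expR (2 * lam q)) (dweight (expR (2 * lam q)) (pd 1 lam q))
      (@omega_v R L0 lam s (dv gam) q) := metric_conn_v _ _ _ _ _ _ _ (W0 q).
  split.
    exact: (pairing_constant (W := fun y => expR (2 * lam y)) i' j' (W0 q) (w 0) m1 d1 d1).
  exact: (pairing_constant (W := fun y => expR (2 * lam y)) i' j' (W0 q) (w 1) m2 d2 d2).
apply: (etrans (derive0_constant oO cO Op0 z Op)).
have -> : E p0 = E0 by rewrite /E Y0 mul1mx.
have -> : expR (2 * lam p0) = expR (lam p0) * expR (lam p0).
  by rewrite mulr2n mulrDl mul1r expRD.
by apply: initial_frame_complete; rewrite gt_eqF ?expR_gt0.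
Qed.

Let C0 p : O p -> cos (thm p) != 0.
Proof. by move=> /thr th; rewrite gt_eqF // cos_gt0_pihalf. Qed.

Let S0 p : O p -> sin (thm p) != 0.
Proof.
move=> Op; have [_ ii _ _ _] := cond; apply: contra (ii p Op) => /eqP e.
by rewrite -(tan_eq0 (thr Op)) /tan e mul0r.
Qed.

Let ss := smooth_sff_of oO sa sth sfp sfm.

Lemma exists_surface : exists F N1 N2 : R * R -> 'rV[R]_(adim L0),
  [/\ conformal_immersion O lam F, curvature_eq O F, flat_normal_connection O F,
      ~ linearly_dependent O lam F &
      [/\ normal_frame O lam F N1 N2, is_sff O F N1 N2 s &
          is_normal_connection O lam F N1 N2 (du gam) (dv gam)]].
Proof.
have [E [sE dE CE]] := exists_frame; have [ci _ _ _ _] := cond.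
have FI := surface_immersion oO sl sE dE CE.
have hN := surface_frame oO sE dE CE.
have hs := surface_sff oO sE dE CE.
exists (field_of E 4), (field_of E 2), (field_of E 3); split => //.
- exact: (surface_curvature oO sl dE CE ci).
- exact: (surface_flat oO sl sg sE dE CE).
- have [[p0 Op0] _ _] := scO; have [sF _ H] := FI.
  apply: (not_linearly_dependent oO sF (fun p Op => (H p Op).1) (fun p Op => (H p Op).2) hN hs Op0).
  move=> x y; exact: (sff_of_independent (compat Op0) (cos2Dsin2 _) (C0 Op0) (S0 Op0) (A0 Op0)).
- by split => //; exact: (surface_connection oO sE dE CE).
Qed.

Let n0 p : O p -> 0 < du fp p ^+ 2 + dv fp p ^+ 2.
Proof.
by move=> /A0/cross_norm_neq0 h; rewrite lt_neqAle eq_sym h addr_ge0 ?sqr_ge0.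
Qed.

Let kp_numE p : O p ->
  kp_num thm fp fm p = - ((du fp p ^+ 2 + dv fp p ^+ 2) * sin (a p)) / cos (thm p).
Proof.
have [_ _ _ iv _] := cond => Op; have [i1 i2] := iv p Op.
have [ec es] := angle_shift (thm p) (psi p); have c0 := C0 Op.
rewrite -(kp_num_algebra es i1 i2) /kp_num /coefA /Defs.coefB /tan.
by field.
Qed.

Let kp_denE p : O p ->
  kp_den thm fp fm p = - ((du fp p ^+ 2 + dv fp p ^+ 2) * cos (a p)) / cos (thm p).
Proof.
have [_ _ _ iv _] := cond => Op; have [i1 i2] := iv p Op.
have [ec es] := angle_shift (thm p) (psi p); have c0 := C0 Op.
rewrite -(kp_den_algebra ec i1 i2) /kp_den /coefA /Defs.coefB /tan.
by field.
Qed.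

Hypothesis den0 : forall p, O p -> kp_den thm fp fm p != 0.

Let ca0 p : O p -> cos (a p) != 0.
Proof.
by move=> Op; have := den0 Op; rewrite kp_denE //; apply: contra_neq => ->; rewrite mulr0 oppr0 mul0r.
Qed.

Lemma constant_sign : exists e : R, (e = 1 \/ e = -1) /\ forall p, O p -> 0 < e * cos (a p).
Proof.
have [[p0 Op0] cO _] := scO.
exists (if 0 < cos (a p0) then 1 else -1); split; first by case: ifP; [left|right].
set e := if _ then _ else _ => p Op.
apply: (@clopen_connected R O (fun p => 0 < e * cos (a p)) p0) => //.
  rewrite /e; case: ifP => [h|/negbT]; first by rewrite mul1r.
  by rewrite -leNgt mulN1r oppr_gt0 lt_neqAle ca0.
move=> q Oq; have [r1 r10 rO] := open_square oO Oq.
have cc : {for q, continuous (fun x => e * cos (a x))}.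
  by apply: (smooth_continuous _ Oq); apply: (smoothM oO); [exact: smooth_cst|exact: smooth_cos].
have e0 : e != 0 by rewrite /e; case: ifP => _; rewrite ?oner_eq0 // oppr_eq0 oner_eq0.
have h0 : 0 < `|e * cos (a q)| by rewrite normr_gt0 mulf_neq0 ?ca0.
have /cvgrPdist_lt/(_ _ h0)/nbhs_ballP[r2 /= r20 B2] := cc.
exists (Num.min r1 r2); first by rewrite lt_min r10.
split=> [x hx|x hx]; first by apply: rO; apply: square_le hx; rewrite ge_min lexx.
have {}hx := B2 x (square_le (_ : Num.min r1 r2 <= r2) hx); move: hx => /(_ _)/=.
rewrite ge_min lexx orbT => /(_ isT).
move: (e * cos (a q)) (e * cos (a x)) h0 => u v; rewrite normr_gt0 => u0.
by case: (ltrgt0P u) u0 => // hu _; rewrite ltr_norml => /andP[h1 h2]; split=> // hv; first [lra|exfalso; lra].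
Qed.

(** k+ = tan a, and e = sign (cos a) is the sign with which f+ has to be taken,
    since sqrt (1 + k+^2) is the inverse of |cos a|. *)
Lemma attached_surface (F N1 N2 : R * R -> 'rV[R]_(adim L0)) :
  conformal_immersion O lam F -> normal_frame O lam F N1 N2 -> is_sff O F N1 N2 s ->
  is_normal_connection O lam F N1 N2 (du gam) (dv gam) -> obtained_from O lam gam thm fp fm F.
Proof.
move=> FI hN hs hc; have [e [he ec]] := constant_sign.
have ta p : O p -> kp_num thm fp fm p / kp_den thm fp fm p = sin (a p) / cos (a p).
  move=> Op; rewrite kp_numE // kp_denE //.
  have n00 : du fp p ^+ 2 + dv fp p ^+ 2 != 0 by rewrite gt_eqF // n0.
  move: (du fp p ^+ 2 + dv fp p ^+ 2) (cos (a p)) (sin (a p)) (cos (thm p)) n00 (ca0 Op) (C0 Op).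
  by move=> n c' s' c'' h1 h2 h3; field; rewrite h1 h2 h3.
have sq p : O p -> (Num.sqrt (1 + (kp_num thm fp fm p / kp_den thm fp fm p) ^+ 2))^-1 = e * cos (a p).
  by move=> Op; rewrite ta //; exact: sqrt_tan he (ec p Op) (cos2Dsin2 _).
have ee : e * e = 1 by case: he => ->; rewrite ?mulrNN mulr1.
have pde i p : O p -> pd i (fun q => e * fp q) p = e * pd i fp p.
  move=> Op; apply: (etrans (pdM i (smooth_cst oO _) sfp Op)).
  by rewrite pd_cst mul0r add0r.
have stan : smooth O (fun p => tan (thm p)) by apply: (smooth_tan oO) => // p; exact: C0.
have pu := smooth_pd 0 sfp; have pv := smooth_pd 1 sfp.
have mu := smooth_pd 0 sfm; have mv := smooth_pd 1 sfm.
have sA : smooth O (coefA fp fm) by exact: (smoothD oO (smoothM oO pv mu) (smoothM oO mv pu)).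
have sB : smooth O (Defs.coefB fp fm).
  exact: (smoothD oO (smoothM oO pu mu) (smoothN oO (smoothM oO pv mv))).
exists e, N1, N2, s; split => // [p Op|].
  rewrite kp_denE // mulNr mulrN oppr_lt0.
  have -> : e * ((du fp p ^+ 2 + dv fp p ^+ 2) * cos (a p) / cos (thm p)) =
      (du fp p ^+ 2 + dv fp p ^+ 2) * (e * cos (a p)) / cos (thm p) by ring.
  apply: divr_gt0; last exact: cos_gt0_pihalf (thr Op).
  by apply: mulr_gt0; [exact: n0|exact: ec].
have sgn p (Op : O p) := signs_of_sff (ca0 Op) (C0 Op) (compat Op).
split => //.
- split; split => //; last by apply: (smoothM oO) => //; exact: smooth_cst.
  apply: (smoothM oO).
    by apply: (smoothD oO); [exact: (smoothM oO)|exact: (smoothN oO)].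
  by apply: (smoothV oO) => //; apply: (smoothD oO) => //; exact: (smoothM oO).
- by move=> p Op; rewrite ta //; have [] := sgn p Op.
- by move=> p Op; have [] := sgn p Op.
- move=> p Op; have [_ _ [h1 h2] _] := sgn p Op.
  rewrite sq // [du _ p](pde 0) // [dv _ p](pde 1) // [Xp s p]h1 [Yp s p]h2.
  split.
    by transitivity ((e * e) * (cos (a p) * dv fp p)); [rewrite ee mul1r|rewrite /dv; ring].
  by transitivity ((e * e) * (cos (a p) * du fp p)); [rewrite ee mul1r|rewrite /du; ring].
- move=> p Op; have [_ _ _ [h1 h2]] := sgn p Op.
  have -> : Num.sqrt (1 + tan (thm p) ^+ 2) = (cos (thm p))^-1.
    have tc : 0 < 1 * cos (thm p) by rewrite mul1r cos_gt0_pihalf // thr.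
    by rewrite -[LHS]invrK (sqrt_tan (or_introl erefl) tc (cos2Dsin2 _)) mul1r.
  by rewrite invrK [Xm s p]h1 [Ym s p]h2; split; rewrite mulrC.
- by move=> p Op; split => //; exact: thr.
Qed.

End Existence.

(** * Rigidity *)
Section LinearIsometry.
Context {R : realType} {L0 : R}.
Notation vec := 'rV[R]_(adim L0).
Variables (w : R) (E E' : 'M[R]_(5, adim L0)).
Hypotheses (gE : gram w E) (gE' : gram w E').
Notation wt := (@weight R L0 w).

(** The linear map sending the frame [E] to the frame [E'], written as their
    pairing so that its constancy is [frame_pairing_constant]. *)
Definition frame_map : 'M[R]_(adim L0) :=
  \matrix_(i, j) (eps (L0 := L0) i * \sum_(k < 5) wt k * E k i * E' k j).

Lemma mul_frame_map (x : vec) :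
  x *m frame_map = \sum_(k < 5) (wt k * ip x (row k E)) *: row k E'.
Proof.
apply/rowP => j; rewrite summxE mxE.
transitivity (\sum_(i < adim L0) \sum_(k < 5) eps (L0 := L0) i * x 0 i * E k i * (wt k * E' k j)).
  apply: eq_bigr => i _; rewrite !mxE !mulr_sumr; apply: eq_bigr => k _; ring.
rewrite exchange_big; apply: eq_bigr => k _ /=.
have -> : ip x (row k E) = \sum_(i < adim L0) eps (L0 := L0) i * x 0 i * E k i.
  by rewrite ipE; apply: eq_bigr => i _; rewrite mxE.
by rewrite !mxE -mulr_suml; ring.
Qed.

Let dim_cases (k : 'I_5) : (k < adim L0)%N \/ wt k = 0.
Proof.
rewrite /adim /weight; case: eqP => [z|_]; last by left.
by case: ltnP => h; [left|right].
Qed.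

Lemma frame_map_row (k : 'I_5) : (k < adim L0)%N -> row k E *m frame_map = row k E'.
Proof.
move=> ka; rewrite mul_frame_map (bigD1 k) //= big1 ?addr0 => [|l lk].
  by rewrite mulrC (gE ka ka) eqxx scale1r.
have [la|->] := dim_cases l; last by rewrite mul0r scale0r.
by rewrite mulrC (gE ka la) eq_sym (negPf lk) scale0r.
Qed.

Lemma frame_map_isometry x y : ip (x *m frame_map) (y *m frame_map) = ip x y.
Proof.
have dual z (l : 'I_5) : (l < adim L0)%N -> ip (z *m frame_map) (row l E') = ip z (row l E).
  move=> la; rewrite mul_frame_map ip_suml (bigD1 l) //= big1 ?addr0 => [|k kl].
    by rewrite ipZl mulrC mulrA (gE' la la) eqxx mul1r.
  rewrite ipZl; have [ka|->] := dim_cases k; last by rewrite !mul0r.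
  by rewrite mulrAC [wt k * _]mulrC ipC (gE' la ka) eq_sym (negPf kl) mul0r.
rewrite [y *m _]mul_frame_map ipC ip_suml.
rewrite {2}(resolution y ((gram_complete w E).1 gE)) [RHS]ipC ip_suml.
apply: eq_bigr => k _; rewrite !ipZl.
have [ka|->] := dim_cases k; last by rewrite !mul0r.
by rewrite ![ip (row k _) _]ipC dual.
Qed.
End LinearIsometry.

Section Rigidity.
Context {R : realType} {L0 : R}.
Notation vec := 'rV[R]_(adim L0).
Variables (O : set (R * R)) (p0 : R * R).
Hypotheses (oO : open O) (cO : connected O) (Op0 : O p0).
Variables (lam m1 m2 : R * R -> R) (s : sff R).
Hypothesis sl : smooth O lam.
Local Notation W p := (expR (2 * lam p)).
Local Notation Omu := (@omega_u R L0 lam s m1).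
Local Notation Omv := (@omega_v R L0 lam s m2).

Lemma frame_pairing_constant (E E' : R * R -> 'M[R]_(5, adim L0)) :
  (forall p, O p -> is_derive p (1, 0) E (Omu p *m E p) /\ is_derive p (0, 1) E (Omv p *m E p)) ->
  (forall p, O p -> is_derive p (1, 0) E' (Omu p *m E' p) /\ is_derive p (0, 1) E' (Omv p *m E' p)) ->
  forall p, O p -> forall i j,
    \sum_(k < 5) @weight R L0 (W p) k * E p k i * E' p k j =
    \sum_(k < 5) @weight R L0 (W p0) k * E p0 k i * E' p0 k j.
Proof.
move=> dE dE' p Op i j; have W0 q := W_neq0 lam q.
suff z q : O q ->
    is_derive q (1, 0) (fun y => \sum_(k < 5) @weight R L0 (W y) k * E y k i * E' y k j) 0 /\
    is_derive q (0, 1) (fun y => \sum_(k < 5) @weight R L0 (W y) k * E y k i * E' y k j) 0.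
  exact: (derive0_constant oO cO Op0 z Op).
move=> Oq; have [d1 d2] := dE q Oq; have [d1' d2'] := dE' q Oq; have sW := smooth_metric oO sl.
have w i'' : is_derive q (if i'' == 0 :> 'I_2 then (1, 0) else (0, 1)) (fun y => W y)
    (2 * pd i'' lam q * W q).
  by rewrite -(pd_metric oO sl) //; exact: smooth_is_derive.
have c1 : metric_conn (L0 := L0) (W q) (dweight (W q) (pd 0 lam q)) (Omu q)
  := metric_conn_u _ _ _ _ _ _ _ (W0 q).
have c2 : metric_conn (L0 := L0) (W q) (dweight (W q) (pd 1 lam q)) (Omv q)
  := metric_conn_v _ _ _ _ _ _ _ (W0 q).
split.
  exact: (pairing_constant (W := fun y => W y) i j (W0 q) (w 0) c1 d1 d1').
exact: (pairing_constant (W := fun y => W y) i j (W0 q) (w 1) c2 d2 d2').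
Qed.

Variables (F N1 N2 F' N1' N2' : R * R -> vec).
Hypotheses (FI : conformal_immersion O lam F) (FI' : conformal_immersion O lam F').
Hypotheses (hN : normal_frame O lam F N1 N2) (hN' : normal_frame O lam F' N1' N2').
Hypotheses (hs : is_sff O F N1 N2 s) (hs' : is_sff O F' N1' N2' s).
Hypotheses (hc : is_normal_connection O lam F N1 N2 m1 m2)
  (hc' : is_normal_connection O lam F' N1' N2' m1 m2).

(** The linear isometry matching the moving frames at a point does not depend on
    the point; it maps dF to dF', so F' differs from the image of F by a
    constant, which is zero when F is itself a vector of the frame. *)
Theorem rigidity : exists2 Phi, is_isometry Phi & forall p, O p -> F' p = Phi (F p).
Proof.
have [sF _ H] := FI; have [sF' _ H'] := FI'.
have inN p : O p -> in_space_form (F p) by move=> /H[].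
have inN' p : O p -> in_space_form (F' p) by move=> /H'[].
have cf p : O p -> induced_metric F p = (W p)%:M by move=> /H[].
have cf' p : O p -> induced_metric F' p = (W p)%:M by move=> /H'[].
pose E := frame F N1 N2; pose E' := frame F' N1' N2'.
have dE p (Op : O p) := structure_equations oO sF sl inN cf hN hs hc Op.
have dE' p (Op : O p) := structure_equations oO sF' sl inN' cf' hN' hs' hc' Op.
have gE p (Op : O p) : gram (W p) (E p) := gram_frame oO sF inN cf hN Op.
have gE' p (Op : O p) : gram (W p) (E' p) := gram_frame oO sF' inN' cf' hN' Op.
pose Q := frame_map (W p0) (E p0) (E' p0).
have QE p : O p -> frame_map (W p) (E p) (E' p) = Q.
  by move=> Op; apply/matrixP => i j; rewrite !mxE (frame_pairing_constant dE dE' Op).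
have rowE p (k : 'I_5) : O p -> (k < adim L0)%N -> row k (E p) *m Q = row k (E' p).
  by move=> Op ka; rewrite -(QE p Op); exact: (frame_map_row _ (gE p Op) ka).
have a4 : (4 <= adim L0)%N by rewrite /adim; case: ifP.
have dF (i : 'I_2) p : O p -> pd i F p *m Q = pd i F' p.
  move=> Op; have e0 := rowE p 0 Op (leq_trans (isT : (0 < 4)%N) a4).
  have e1 := rowE p 1 Op (leq_trans (isT : (1 < 4)%N) a4).
  rewrite /E /E' /frame !row_frame_of /= in e0 e1.
  by elim/ord2_ind: i; [exact: e0|exact: e1].
pose b := F' p0 - F p0 *m Q.
have const p : O p -> F' p - F p *m Q = b.
  move=> Op; apply/rowP => j.
  suff z q : O q -> is_derive q (1, 0) (fun q => (F' q - F q *m Q) 0 j) 0 /\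
      is_derive q (0, 1) (fun q => (F' q - F q *m Q) 0 j) 0.
    exact: (derive0_constant oO cO Op0 z Op).
  move=> Oq; have d i : is_derive q (if i == 0 :> 'I_2 then (1, 0) else (0, 1)) (fun y => F' y - F y *m Q) 0.
    have c v : is_derive q v (fun=> Q) 0 by exact: is_derive_cst.
    have -> : 0 = pd i F' q - (pd i F q *m Q + F q *m 0) by rewrite mulmx0 addr0 dF // subrr.
    exact: (is_deriveB (smooth_is_derive i sF' Oq) (is_derive_mulmx (smooth_is_derive i sF Oq) (c _))).
  have z i := (is_derive_mx _ _ _ _).1 (d i) 0 j.
  by split; [have := z 0|have := z 1]; rewrite mxE.
exists (fun x => x *m Q + b); last first.
  by move=> p Op; rewrite -(const p Op) addrC subrK.
exists Q, b; split => // [x y|L00].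
  exact: (frame_map_isometry (gE p0 Op0) (gE' p0 Op0)).
have a5 : (4 < adim L0)%N by rewrite /adim (negPf L00).
have e4 := rowE p0 4 Op0 a5; rewrite /E /E' /frame !row_frame_of /= in e4.
by rewrite /b e4 subrr.
Qed.
End Rigidity.

(** The sign e is fixed by that of A k- + B, and the second fundamental form by
    the data, so both immersions satisfy the same structure equations. *)
Lemma obtained_unique (R : realType) (L0 : R) (O : set (R * R)) (lam gam thm fp fm : R * R -> R)
    (F F' : R * R -> 'rV[R]_(adim L0)) : open O -> connected O -> O !=set0 ->
  obtained_from O lam gam thm fp fm F -> obtained_from O lam gam thm fp fm F' ->
  exists2 Phi, is_isometry Phi & forall p, O p -> F' p = Phi (F p).
Proof.
move=> oO cO [p0 Op0] [e [N1 [N2 [s [he den att]]]]] [e' [N1' [N2' [s' [he' den' att']]]]].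
have ee : e' = e.
  have := den p0 Op0; have := den' p0 Op0; move: (kp_den _ _ _ _) => d.
  by case: he => ->; case: he' => -> //; rewrite mul1r mulN1r => h1 h2; exfalso; lra.
rewrite ee in att'.
pose kp p := kp_num thm fp fm p / kp_den thm fp fm p.
pose t := sff_of (fun p => atan (kp p)) thm (fun p => e * fp p) fm.
have sffE M1 M2 G u : attached O G M1 M2 u lam gam kp (fun p => tan (thm p)) thm
    (fun p => e * fp p) fm -> is_sff O G M1 M2 t.
  move=> h p Op; have := att_sff h Op.
  by have [[-> -> ->] [[-> -> ->] _]] := attached_sff h Op.
have [_ sl _] := att_immersion att.
exact: (rigidity oO cO Op0 sl (att_immersion att) (att_immersion att') (att_frame att)
  (att_frame att') (sffE _ _ _ _ _ att) (sffE _ _ _ _ _ att') (att_connection att) (att_connection att')).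
Qed.

Theorem theorem2p7 (R : realType) (L0 : R) :
  (forall (O : set (R * R)) (F N1 N2 : R * R -> 'rV[R]_(adim L0)) (s : sff R)
     (lam gam kp km thm fp fm : R * R -> R),
     open O ->
     attached O F N1 N2 s lam gam kp km thm fp fm ->
     curvature_eq O F ->
     flat_normal_connection O F ->
     (exists psi : R * R -> R, smooth O psi /\ cond_iv O psi fp fm) /\
     (forall psi : R * R -> R, smooth O psi -> cond_iv O psi fp fm ->
        ((forall p, O p ->
            [/\ kp p != 0, km p != 0 &
                Xp s p ^+ 2 * Ym s p ^+ 2 - Xm s p ^+ 2 * Yp s p ^+ 2 != 0])
         <->
         (conditions L0 O lam gam thm psi fp fm /\
          (forall p, O p -> kp_num thm fp fm p != 0)))
        /\
        (conditions L0 O lam gam thm psi fp fm ->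
         forall p, O p ->
           km p != 0 /\
           Xp s p ^+ 2 * Ym s p ^+ 2 - Xm s p ^+ 2 * Yp s p ^+ 2 != 0)))
  /\
  (forall (O : set (R * R)) (lam gam thm psi fp fm : R * R -> R),
     open O -> simply_connected O ->
     [/\ smooth O lam, smooth O gam & smooth O thm] ->
     [/\ smooth O psi, smooth O fp & smooth O fm] ->
     (forall p, O p -> - (pi / 2) < thm p < pi / 2) ->
     conditions L0 O lam gam thm psi fp fm ->
     (exists F : R * R -> 'rV[R]_(adim L0),
        [/\ conformal_immersion O lam F, curvature_eq O F,
            flat_normal_connection O F,
            ~ linearly_dependent O lam F &
            (forall p, O p -> kp_den thm fp fm p != 0) ->
            obtained_from O lam gam thm fp fm F]) /\
     ((forall p, O p -> kp_den thm fp fm p != 0) ->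
      forall F F' : R * R -> 'rV[R]_(adim L0),
        obtained_from O lam gam thm fp fm F ->
        obtained_from O lam gam thm fp fm F' ->
        exists2 Phi, is_isometry Phi & forall p, O p -> F' p = Phi (F p))).
Proof.
split=> [ O F N1 N2 s lam gam kp km thm fp fm oO att KF _|
         O lam gam thm psi fp fm oO scO [sl sg sth] [spsi sfp sfm] thr cond].
  split; first exact: exists_psi oO att.
  move=> psi spsi iv; split; first exact: (neq0_iff_conditions oO att spsi iv KF).
  by move=> C p; exact: (conditions_neq0 att C).
split; last first.
  have [ ne cO _] := scO.
  by move=> _ F F'; exact: obtained_unique.
have [F [N1 [N2 [h1 h2 h3 h4 [h5 h6 h7]]]]] :=
  exists_surface oO scO sl sg sth spsi sfp sfm thr cond.
exists F; split => // den0.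
exact: (attached_surface oO scO sg sth spsi sfp sfm thr cond den0 h1 h5 h6 h7).
Qed.
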